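(* Let $(X,d)$ be a metric space with bounded geometry, and $p \in \{0\}\cup[1,\infty]$. Suppose $E$ is a Banach space and $B \subseteq \mathfrak{B}(\ell^p_E(X))$ is a Banach subalgebra such that $C_b(X)BC_b(X)=B$ and $B$ is closed under block cutdowns. For $b \in B$, consider the following conditions: \begin{enumerate} \item[(i)] $[b,f]=0$ for all $f \in \mathrm{VL}_\infty(X)$; \item[(ii)] $b$ is quasi-local; \item[(iii)] $[b,g] \in \mathcal{K}(X,B)$ for any $g \in C_h(X)$; \item[(iv)] $b \in \mathrm{Roe}(X,B)$. \end{enumerate} Then we have: \begin{enumerate} \item when $p\in \{0,1,\infty\}$, conditions (i), (ii), (iii), (iv) are equivalent; \item when $p\in (1,\infty)$, conditions (i), (ii), (iii) are equivalent, and they are also equivalent to (iv) provided $X$ has Property A. \end{enumerate}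
   Context: Bounded geometry: for every $R\ge 0$, $\sup_{x\in X}\sharp B(x,R)<\infty$, where $B(x,R)$ is the closed ball and $\sharp$ denotes cardinality. Spaces: for $p\in[1,\infty)$, $\ell^p_E(X)=\ell^p(X;E)$ is the Banach space of $p$-summable functions $X\to E$ (counting measure); $\ell^\infty_E(X)$ is the Banach space of bounded functions $X\to E$; $\ell^0_E(X)=c_0(X;E)$ is the Banach space of (continuous) functions $X\to E$ vanishing at infinity, with sup-norm. $\mathfrak{B}(\cdot)$ denotes bounded linear operators. $C_b(X)$ is the C*-algebra of bounded continuous (complex-valued) functions on $X$ with sup-norm (equal to $\ell^\infty(X)$ here), $C_0(X)$ its subalgebra of functions vanishing at infinity; they act on $\ell^p_E(X)$ by point-wise multiplication. For a normed space, the subscript $1$ (as in $C_b(X)_1$) denotes its closed unit ball. $[a,c]=ac-ca$. Block cutdowns: a net $(a_i)$ in $\mathfrak{B}(\ell^\infty_E(X))$ converges point-wise strongly to $a$ if for each $v\in\ell^\infty_E(X)$, $(a_iv)(x)\to(av)(x)$ for every $x\in X$. For a family $(e_j)_{j\in J}$ of positive contractions in $C_b(X)$ with pairwise disjoint supports, the block cutdown map is $\theta_{(e_j)_{j\in J}}(a)=\sum_{j\in J}e_jae_j$, which converges in the strong operator topology if $p\in\{0\}\cup[1,\infty)$ and point-wise strongly if $p=\infty$. A subalgebra $B$ is closed under block cutdowns if $\theta_{(e_j)}(a)\in B$ for every $a\in B$ and every such family. Propagation: $\mathrm{supp}(f)$ is the support of $f$. An operator $a\in\mathfrak{B}(\ell^p_E(X))$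 has propagation at most $R\ge0$ if $faf'=0$ whenever $f,f'\in C_b(X)$ with $d(\mathrm{supp}(f),\mathrm{supp}(f'))>R$; it has finite propagation if this holds for some $R$. For $\varepsilon>0$, $a$ has $\varepsilon$-propagation at most $R$ if $\|faf'\|<\varepsilon$ whenever $f,f'\in C_b(X)_1$ with $d(\mathrm{supp}(f),\mathrm{supp}(f'))>R$. $a$ is quasi-local if for every $\varepsilon>0$ it has finite $\varepsilon$-propagation (i.e. $\varepsilon$-propagation at most $R$ for some $R\ge 0$). $\mathrm{Roe}(X,B)$ is the norm-closure of the set of all operators in $B$ with finite propagation. $\mathcal{K}(X,B)$ is the norm-closure of $C_0(X)BC_0(X)$ in $\mathfrak{B}(\ell^p_E(X))$. Very Lipschitz sequences: a bounded sequence $(f_n)_{n\in\mathbb N}$ in $C_b(X)$ is very Lipschitz if for every $L>0$ there is $n_0$ such that $f_n$ is $L$-Lipschitz for all $n\ge n_0$. $\mathrm{VL}(X)$ is the set of all very Lipschitz bounded sequences, and $\mathrm{VL}_\infty(X)=\mathrm{VL}(X)/\{(f_n)\in \mathrm{VL}(X):\lim_n\|f_n\|=0\}$. For a Banach space $V$, $V_\infty=\ell^\infty(\mathbb N,V)/\{(a_n):\lim_n\|a_n\|=0\}$ with norm $\|[(a_n)]\|=\limsup_n\|a_n\|$. Both $\mathrm{VL}_\infty(X)$ (via multiplication operators) and $B$ (via constant sequences) are regarded as subalgebras of $\mathfrak{B}(\ell^p_E(X))_\infty$, where the commutator $[b,f]$ in (i) is taken; so $[b,f]=0$ for $f=[(f_n)]$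 means $\lim_n\|bf_n-f_nb\|=0$. Higson functions: $C_h(X)$ is the set of $g\in C_b(X)$ such that for every $R>0$, $\varepsilon>0$ there is a compact $A\subseteq X$ with $|g(x)-g(y)|<\varepsilon$ for all $x,y\in X\setminus A$ with $d(x,y)<R$. Property A: for $p\in[1,\infty)$, a metric $p$-partition of unity on $X$ is a collection $\{\phi_i:X\to[0,1]\}_{i\in I}$ such that $\{\mathrm{supp}(\phi_i)\}_{i\in I}$ is uniformly bounded ($\sup_i\mathrm{diam}(\mathrm{supp}(\phi_i))<\infty$) and of finite multiplicity (some $M$ such that each $x\in X$ lies in at most $M$ of the supports), and $\sum_{i}\phi_i(x)^p=1$ for every $x$. It has $(r,\varepsilon)$-variation if $\sum_{i}|\phi_i(x)-\phi_i(y)|^p<\varepsilon^p$ whenever $d(x,y)\le r$. $X$ has Property A if for any $r,\varepsilon>0$ there exists a metric $p$-partition of unity with $(r,\varepsilon)$-variation (this is independent of $p\in[1,\infty)$). *)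

(* Defs.v *)
From HB Require Import structures.
From mathcomp Require Import all_boot all_order all_algebra finmap.
From mathcomp Require Import all_classical all_reals all_analysis.
From mathcomp Require Import complex ring lra.

Set Implicit Arguments.
Unset Strict Implicit.
Unset Printing Implicit Defensive.

Import Order.TTheory GRing.Theory Num.Theory.
Import numFieldNormedType.Exports.

Local Open Scope classical_set_scope.
Local Open Scope ring_scope.

(* In a normed space over the complex field R[i] the library norm `|v| is a
   (nonnegative real) element of R[i]; [rnorm] is the same number in R. *)
Section RealNorm.
Variables (R : realType) (V : normedModType R[i]).
Implicit Types u v : V.

Definition rnorm v : R := complex.Re `|v|.

Lemma rnormE v : `|v| = (rnorm v)%:C%C.
Proof.
have := normr_ge0 v; rewrite /rnorm; case: `|v| => a b.
by rewrite lecE/= => /andP[/eqP -> _].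
Qed.

Lemma rnorm_ge0 v : 0 <= rnorm v.
Proof. by have := normr_ge0 v; rewrite rnormE -(lecR 0). Qed.

Lemma ler_rnormD u v : rnorm (u + v) <= rnorm u + rnorm v.
Proof. by have := ler_normD u v; rewrite !rnormE -rmorphD/= lecR. Qed.

Lemma rnorm0_eq0 v : rnorm v = 0 -> v = 0.
Proof. by move=> v0; apply/normr0_eq0; rewrite rnormE v0. Qed.

Lemma rnorm_gt0 v : v != 0 -> 0 < rnorm v.
Proof.
move=> v0; rewrite lt_neqAle rnorm_ge0 andbT eq_sym.
by apply: contra_neq v0 => /rnorm0_eq0.
Qed.

Lemma rnorm0 : rnorm 0 = 0.
Proof. by rewrite /rnorm normr0. Qed.

Lemma rnormN v : rnorm (- v) = rnorm v.
Proof. by rewrite /rnorm normrN. Qed.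

Lemma rnorm_continuous : continuous rnorm.
Proof.
move=> v; apply/cvgrPdist_lt => e e0.
have e0C : 0 < e%:C%C :> R[i] by rewrite ltcR.
near=> w.
have : `|v - w| < e%:C%C by near: w; exact: cvgr_dist_lt.
rewrite rnormE ltcR; apply: le_lt_trans.
have h u u' : rnorm u - rnorm u' <= rnorm (u - u').
  by rewrite lerBlDr (le_trans _ (ler_rnormD _ _))// subrK.
by rewrite ler_norml h andbT lerNl opprB -(rnormN (v - w)) opprB h.
Unshelve. all: by end_near. Qed.

End RealNorm.

Lemma rnormZ (R : realType) (V : normedModType R[i]) (l : (R[i])^o) (v : V) :
  rnorm (l *: v) = rnorm l * rnorm v.
Proof.
by apply/(@complexI R); rewrite rmorphM/= -!rnormE normrZ.
Qed.

Section Minkowski.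
Variables (R : realType) (p : R).
Hypothesis p1 : 1 <= p.

Let p0 : 0 < p. Proof. exact: lt_le_trans p1. Qed.

Lemma sum_powR_minkowski (T : Type) (s : seq T) (F G : T -> R) (a b : R) :
  (forall x, 0 <= F x) -> (forall x, 0 <= G x) -> 0 <= a -> 0 <= b ->
  \sum_(x <- s) F x `^ p <= a `^ p -> \sum_(x <- s) G x `^ p <= b `^ p ->
  \sum_(x <- s) (F x + G x) `^ p <= (a + b) `^ p.
Proof.
have zero (H K : T -> R) (c : R) : (forall x, 0 <= H x) ->
    \sum_(x <- s) H x `^ p <= 0 ->
    \sum_(x <- s) (H x + K x) `^ p = \sum_(x <- s) K x `^ p.
  move=> H0; elim: s => [|x t ih]; first by rewrite !big_nil.
  rewrite !big_cons => h.
  have t0 : 0 <= \sum_(j <- t) H j `^ p by apply: sumr_ge0 => ? _; exact: powR_ge0.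
  have : H x `^ p = 0.
    by apply/eqP; rewrite eq_le powR_ge0 andbT (le_trans _ h)// lerDl.
  move/powR_eq0_eq0 => ->; rewrite add0r ih// (le_trans _ h)// lerDr.
  exact: powR_ge0.
move=> F0 G0; rewrite le_eqVlt => /orP[/eqP<- b0|a0].
  rewrite powR0 ?gt_eqF// add0r => F0s Gs.
  by rewrite zero.
rewrite le_eqVlt => /orP[/eqP<-|b0].
  rewrite powR0 ?gt_eqF// addr0 => Fs Gs.
  by under eq_bigr do rewrite addrC; rewrite zero.
move=> Fs Gs.
have ab0 : 0 < a + b by rewrite addr_gt0.
set l := a / (a + b).
have l0 : 0 <= l by rewrite divr_ge0// ltW.
have l1 : l <= 1 by rewrite ler_pdivrMr// mul1r lerDl ltW.
have lE : 1 - l = b / (a + b).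
  by rewrite /l -{1}(@divff _ (a + b)) ?gt_eqF// -mulrBl addrAC subrr add0r.
have step x : (F x + G x) `^ p <=
    (a + b) `^ p * (l * (F x `^ p / a `^ p) + (1 - l) * (G x `^ p / b `^ p)).
  have -> : F x + G x = (a + b) * (l * (F x / a) + (1 - l) * (G x / b)).
    by rewrite lE /l; field; rewrite !gt_eqF.
  have Fa : 0 <= F x / a by rewrite divr_ge0// ltW.
  have Gb : 0 <= G x / b by rewrite divr_ge0// ltW.
  rewrite powRM ?(ltW ab0)//; last first.
    by rewrite addr_ge0// mulr_ge0// subr_ge0.
  rewrite ler_pM2l ?powR_gt0//.
  have div (u c : R) : 0 <= u -> 0 < c -> (u / c) `^ p = u `^ p / c `^ p.
    move=> u0 c0; rewrite powRM ?invr_ge0 ?(ltW c0)//; congr (_ * _).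
    by rewrite -powR_inv1 ?ltW// -powRrM mulN1r powRN.
  rewrite -(div (F x))// -(div (G x))//.
  apply: (convex_powR p1 (Itv01 l0 l1));
    by rewrite inE/= in_itv/= andbT.
apply: (@le_trans _ _ (\sum_(x <- s)
  (a + b) `^ p * (l * (F x `^ p / a `^ p) + (1 - l) * (G x `^ p / b `^ p)))).
  by apply: ler_sum => x _; exact: step.
rewrite -mulr_sumr -[leRHS]mulr1 ler_pM2l ?powR_gt0//.
rewrite big_split/= -!mulr_sumr -!mulr_suml.
rewrite -[leRHS](subrK l) addrC lerD//.
  by rewrite -[leRHS]mulr1 ler_wpM2l// ?subr_ge0// ler_pdivrMr ?powR_gt0// mul1r.
by rewrite -[leRHS]mulr1 ler_wpM2l// ler_pdivrMr ?powR_gt0// mul1r.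
Qed.

End Minkowski.

Lemma esum_EFin_leP (R : realType) (I : choiceType) (F : I -> R) (M : R) :
  (forall i, 0 <= F i) ->
  (\esum_(i in [set: I]) (F i)%:E <= M%:E)%E <->
  forall s : seq I, uniq s -> \sum_(i <- s) F i <= M.
Proof.
move=> F0; split=> [h s us|h].
  rewrite -lee_fin; apply: le_trans h; apply: esum_ge.
  exists [set` s]; first by split => //; exact: finite_seq.
  by rewrite -fsbig_seq// sumEFin.
apply: ge_ereal_sup => _ [A [fA _] <-].
by rewrite fsbig_finite//= sumEFin lee_fin h// fset_uniq.
Qed.

Lemma rnorm_scale_eq (R : realType) (V : lmodType R[i]) (N : V -> R) :
  (forall v, 0 <= N v) ->
  (forall l v, N (l *: v) <= @rnorm R (R[i])^o l * N v) ->
  forall l v, (N (l *: v))%:C%C = `|l| * (N v)%:C%C :> R[i].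
Proof.
move=> N0 NZ l v.
have -> : `|l| = (@rnorm R (R[i])^o l)%:C%C by exact: (@rnormE R (R[i])^o l).
rewrite -rmorphM/=; congr (_%:C)%C; apply/eqP.
rewrite eq_le NZ/=.
have [->|l0] := eqVneq l 0; first by rewrite rnorm0 mul0r.
have ln0 : 0 < @rnorm R (R[i])^o l by exact: rnorm_gt0.
rewrite mulrC -ler_pdivlMr// mulrC.
have := NZ l^-1 (l *: v); rewrite scalerA mulVf// scale1r.
move=> /le_trans; apply; rewrite ler_wpM2r//.
have := @rnormZ R (R[i])^o l^-1 l; rewrite /GRing.scale/= mulVf//.
rewrite {1}/rnorm normr1/= => h.
by rewrite -[leRHS]mul1r h mulfK ?gt_eqF.
Qed.

Lemma bounded_fun_rnorm (R : realType) (T : Type) (V : normedModType R[i])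
    (f : T -> V) :
  bounded_fun f <-> exists M : R, forall x, rnorm (f x) <= M.
Proof.
split=> [[M [Mreal h]]|[M h]].
  exists (complex.Re (M + 1)) => x.
  have := h (M + 1); rewrite ltrDl ltr01 => /(_ isT x I) /=.
  by rewrite rnormE; case: (M + 1) => a b; rewrite lecE/= => /andP[].
exists M%:C%C; split; first by rewrite realE !lecR; exact: le_total.
by move=> y My x _ /=; rewrite rnormE (le_trans _ (ltW My))// lecR.
Qed.

Definition vanishes_at_infty (R : realType) (T : topologicalType)
    (V : normedModType R[i]) (f : T -> V) :=
  forall e : R, 0 < e ->
    exists2 A : set T, compact A & forall x, ~ A x -> rnorm (f x) < e.

Lemma c0_bounded (R : realType) (T : topologicalType) (V : normedModType R[i])
    (f : T -> V) :
  continuous f -> vanishes_at_infty f -> bounded_fun f.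
Proof.
move=> cf /(_ 1 ltr01)[A cA fA]; apply/bounded_fun_rnorm.
have cg : {within A, continuous (@rnorm R V \o f)}.
  apply: continuous_subspaceT => x; apply: continuous_comp; first exact: cf.
  exact: rnorm_continuous.
have [M [_ hM]] := compact_bounded (continuous_compact cg cA).
exists (Num.max 1 (M + 1)) => x; rewrite le_max.
have [Ax|nAx] := pselect (A x); last by rewrite ltW ?fA.
apply/orP; right; rewrite -(ger0_norm (rnorm_ge0 _)).
by apply: (hM (M + 1)); [rewrite ltrDl|exists x].
Qed.

(* Only p = 0 and 1 <= p <= +oo are used: c_0 for p = 0, the p-summable
   functions for p finite, the bounded functions for p = +oo. *)
Section Lspace.
Variables (R : realType) (p : \bar R) (X : metricType R).
Variable E : normedModType R[i].

Definition lspace_mem (f : X -> E) : Prop :=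
  match p with
  | r%:E => if r == 0 then continuous f /\ vanishes_at_infty f
            else (\esum_(x in [set: X]) (rnorm (f x) `^ r)%:E < +oo)%E
  | _ => bounded_fun f
  end.

Definition lspace_norm (f : X -> E) : R :=
  match p with
  | r%:E => if r == 0 then sup [set rnorm (f x) | x in [set: X]]
            else fine (\esum_(x in [set: X]) (rnorm (f x) `^ r)%:E) `^ r^-1
  | _ => sup [set rnorm (f x) | x in [set: X]]
  end.

End Lspace.

Record lspace (R : realType) (p : \bar R) (hp : ((p == 0) || (1 <= p))%E)
    (X : metricType R) (E : normedModType R[i]) := Lspace {
  lspace_fun :> X -> E;
  lspace_funP : `[< lspace_mem p lspace_fun >] }.

Section LspaceType.
Variables (R : realType) (p : \bar R).
Hypothesis hp : ((p == 0) || (1 <= p))%E.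
Variables (X : metricType R) (E : normedModType R[i]).

Local Notation mem := (@lspace_mem R p X E).
Local Notation N := (@lspace_norm R p X E).

Let bnd_le (f : X -> E) : bounded_fun f ->
  forall M : R, 0 <= M ->
  sup [set rnorm (f x) | x in [set: X]] <= M <-> forall x, rnorm (f x) <= M.
Proof.
move=> /bounded_fun_rnorm[M0 hM0] M Mp; split=> [h x|h].
  apply: le_trans h; apply: ub_le_sup; last by exists x.
  by exists M0 => _ [y _ <-].
have [->|/set0P ne] := eqVneq [set rnorm (f x) | x in [set: X]] set0.
  by rewrite sup0.
by apply: ge_sup => // _ [x _ <-].
Qed.

Let rcase (r : R) : p = r%:E -> r != 0 -> 1 <= r.
Proof.
by move=> pr r0; move: hp; rewrite pr eqe (negbTE r0)/= lee_fin.
Qed.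

Let pow_le (r : R) (f : X -> E) : 1 <= r ->
  (\esum_(x in [set: X]) (rnorm (f x) `^ r)%:E < +oo)%E ->
  forall M : R, 0 <= M ->
  fine (\esum_(x in [set: X]) (rnorm (f x) `^ r)%:E) `^ r^-1 <= M <->
  forall s : seq X, uniq s -> \sum_(x <- s) rnorm (f x) `^ r <= M `^ r.
Proof.
move=> r1 foo M M0; have r0 : 0 < r by exact: lt_le_trans r1.
have e0 : (0 <= \esum_(x in [set: X]) (rnorm (f x) `^ r)%:E)%E.
  by apply: esum_ge0 => x _; rewrite lee_fin powR_ge0.
rewrite -esum_EFin_leP; last by move=> x; exact: powR_ge0.
move: foo e0; case: (\esum_(_ in _) _)%E => //= s _; rewrite !lee_fin => s0.
split=> h.
  rewrite -[leLHS](@powRr1 _ s)// -(@mulVf _ r) ?gt_eqF// powRrM.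
  by apply: ge0_ler_powR; rewrite ?nnegrE ?powR_ge0// ltW.
rewrite -[leRHS](@powRr1 _ M)// -(@mulfV _ r) ?gt_eqF// powRrM.
by apply: ge0_ler_powR; rewrite ?nnegrE ?powR_ge0// invr_ge0 ltW.
Qed.

Let pow_mem (r : R) (f : X -> E) (M : R) :
  (forall s : seq X, uniq s -> \sum_(x <- s) rnorm (f x) `^ r <= M) ->
  (\esum_(x in [set: X]) (rnorm (f x) `^ r)%:E < +oo)%E.
Proof.
move=> h; apply: (@le_lt_trans _ _ M%:E); last exact: ltry.
by apply/esum_EFin_leP => // x; exact: powR_ge0.
Qed.

(* the inequality [lspace_norm f <= M] freed of its suprema, see [lspace_normP] *)
Definition lspace_le (f : X -> E) (M : R) : Prop :=
  match p with
  | r%:E => if r == 0 then forall x, rnorm (f x) <= M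
            else forall s : seq X, uniq s ->
                   \sum_(x <- s) rnorm (f x) `^ r <= M `^ r
  | _ => forall x, rnorm (f x) <= M
  end.

Lemma lspace_norm_ge0 f : 0 <= N f.
Proof.
have bd : 0 <= sup [set rnorm (f x) | x in [set: X]].
  have [hs|/sup_out->//] := pselect (has_sup [set rnorm (f x) | x in [set: X]]).
  have [[_ [x _ _]] hu] := hs.
  by apply: le_trans (rnorm_ge0 (f x)) _; apply: ub_le_sup => //; exists x.
rewrite /lspace_norm; case: p => [r| |]//.
by case: ifP => // _; exact: powR_ge0.
Qed.

Lemma lspace_normP f M : mem f -> 0 <= M -> N f <= M <-> lspace_le f M.
Proof.
move: rcase; rewrite /lspace_mem /lspace_norm /lspace_le.
case: p => [r| |] rc; [|by move=> ?; exact: bnd_le..].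
case: eqP => [_|/eqP r0].
  by move=> [cf f0]; apply: bnd_le; exact: c0_bounded.
by move=> ff; apply: pow_le => //; exact: rc.
Qed.

Lemma lspace_le_bounded f M : 0 <= M -> lspace_le f M ->
  forall x, rnorm (f x) <= M.
Proof.
move: rcase; rewrite /lspace_le; case: p => [r| |] rc M0 //.
case: eqP => [//|/eqP r0] h x; have r1 := rc _ erefl r0.
have := h [:: x] isT; rewrite big_seq1 => h'.
rewrite leNgt; apply/negP => /(@gt0_ltr_powR _ r) hlt.
by move: h'; rewrite leNgt hlt// ?nnegrE// ?(lt_le_trans _ r1)// rnorm_ge0.
Qed.

Lemma lspace_mem_of_le f M :
  (p == 0%E -> continuous f /\ vanishes_at_infty f) -> lspace_le f M -> mem f.
Proof.
rewrite /lspace_mem /lspace_le; case: p => [r| |] h.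
- rewrite eqe in h; case: eqP h => [r0 h _|r0 _ h]; first exact: h.
  exact: pow_mem h.
- by move=> hM; apply/bounded_fun_rnorm; exists M.
- by move=> hM; apply/bounded_fun_rnorm; exists M.
Qed.

Lemma lspace_mem0 : p == 0%E -> forall f, mem f ->
  continuous f /\ vanishes_at_infty f.
Proof. by move=> /eqP p0 f; rewrite /lspace_mem p0/= eqxx. Qed.

Lemma lspace_leD f g a b : 0 <= a -> 0 <= b ->
  lspace_le f a -> lspace_le g b -> lspace_le (f + g) (a + b).
Proof.
move: rcase; rewrite /lspace_le; case: p => [r| |] rc a0 b0.
- case: eqP => [_|/eqP r0] fa gb.
    by move=> x; rewrite (le_trans (ler_rnormD _ _))// lerD.
  have r1 := rc _ erefl r0 => s us.
  apply: (@le_trans _ _ (\sum_(x <- s) (rnorm (f x) + rnorm (g x)) `^ r)).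
    apply: ler_sum => x _; apply: ge0_ler_powR; rewrite ?nnegrE.
    + by rewrite (le_trans _ r1).
    + exact: rnorm_ge0.
    + by rewrite addr_ge0// rnorm_ge0.
    + exact: ler_rnormD.
  by apply: sum_powR_minkowski => //; [| |exact: fa|exact: gb]
    => x; exact: rnorm_ge0.
- by move=> fa gb x; rewrite (le_trans (ler_rnormD _ _))// lerD.
- by move=> fa gb x; rewrite (le_trans (ler_rnormD _ _))// lerD.
Qed.

Lemma lspace_leM (c : X -> (R[i])^o) f C M : 0 <= C -> 0 <= M ->
  (forall x, rnorm (c x) <= C) -> lspace_le f M ->
  lspace_le (fun x => c x *: f x) (C * M).
Proof.
move: rcase; rewrite /lspace_le; case: p => [r| |] rc C0 M0 hc.
- case: eqP => [_|/eqP r0] fM.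
    by move=> x; rewrite rnormZ ler_pM ?rnorm_ge0.
  have r1 := rc _ erefl r0 => s us.
  rewrite powRM//; apply: (@le_trans _ _ (\sum_(x <- s) C `^ r * rnorm (f x) `^ r)).
    apply: ler_sum => x _; rewrite rnormZ powRM ?rnorm_ge0//.
    rewrite ler_wpM2r ?powR_ge0//; apply: ge0_ler_powR; rewrite ?nnegrE ?rnorm_ge0//.
    by rewrite (le_trans _ r1).
  by rewrite -mulr_sumr ler_wpM2l ?powR_ge0// fM.
- by move=> fM x; rewrite rnormZ ler_pM ?rnorm_ge0.
- by move=> fM x; rewrite rnormZ ler_pM ?rnorm_ge0.
Qed.

Lemma lspace_leN f : mem f -> lspace_le f (N f).
Proof. by move=> mf; apply/lspace_normP => //; exact: lspace_norm_ge0. Qed.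

Lemma lspace_memM (c : X -> (R[i])^o) f :
  continuous c -> bounded_fun c -> mem f -> mem (fun x => c x *: f x).
Proof.
move=> cc /bounded_fun_rnorm[C0 hC0] mf.
pose C := Num.max 0 C0; have C_ge0 : 0 <= C by rewrite le_max lexx.
have hC x : rnorm (c x) <= C by rewrite le_max hC0 orbT.
apply: (@lspace_mem_of_le _ (C * N f)); last first.
  by apply: lspace_leM => //; [exact: lspace_norm_ge0|exact: lspace_leN].
move=> p0; have [cf f0] := lspace_mem0 p0 mf; split.
  by move=> x; apply: cvgZ; [exact: cc|exact: cf].
move=> e e0; have C1 : 0 < C + 1 by rewrite ltr_wpDl.
have [|A cA hA] := f0 (e / (C + 1)); first by rewrite divr_gt0.
exists A => // x /hA hx; rewrite rnormZ.
apply: (@le_lt_trans _ _ ((C + 1) * rnorm (f x))).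
  by rewrite ler_wpM2r ?rnorm_ge0// (le_trans (hC x))// lerDl.
by rewrite mulrC -ltr_pdivlMr.
Qed.

Lemma lspace_memD f g : mem f -> mem g -> mem (f + g).
Proof.
move=> mf mg; apply: (@lspace_mem_of_le _ (N f + N g)); last first.
  by apply: lspace_leD; try exact: lspace_norm_ge0; exact: lspace_leN.
move=> p0; have [cf f0] := lspace_mem0 p0 mf.
have [cg g0] := lspace_mem0 p0 mg; split.
  by move=> x; apply: cvgD; [exact: cf|exact: cg].
move=> e e0; have e2 : 0 < e / 2 by rewrite divr_gt0.
have [A cA hA] := f0 _ e2; have [B cB hB] := g0 _ e2.
exists (A `|` B); first exact: compactU.
move=> x /not_orP[nA nB]; rewrite (le_lt_trans (ler_rnormD _ _))//.
by rewrite (splitr e) ltrD ?hA ?hB.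
Qed.

Lemma lspace_memZ (l : R[i]) f : mem f -> mem (l *: f).
Proof.
move=> mf; apply: (@lspace_memM (fun=> l)) => //; first exact: cst_continuous.
by apply/bounded_fun_rnorm; exists (@rnorm R (R[i])^o l).
Qed.

Lemma lspace_mem_cst0 : mem 0.
Proof.
apply: (@lspace_mem_of_le _ 0) => [_|].
  split; first exact: cst_continuous.
  by move=> e e0; exists set0; [exact: compact0|move=> x _; rewrite rnorm0].
move: rcase; rewrite /lspace_le; case: p => [r| |] rc; rewrite ?rnorm0//.
- case: eqP => [_ x|/eqP r0 s _]; first by rewrite rnorm0.
  by rewrite big1// => x _; rewrite rnorm0 powR0.
- by move=> x; rewrite rnorm0.
- by move=> x; rewrite rnorm0.
Qed.

Local Notation lspace := (lspace hp X E).
Local Notation lspace_fun := (@lspace_fun R p hp X E).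

HB.instance Definition _ := [isSub for lspace_fun].
HB.instance Definition _ := [Choice of lspace by <:].

Let lspace_submod : submod_closed (fun f : X -> E => `[< mem f >] : bool).
Proof.
split; first by apply/asboolP; exact: lspace_mem_cst0.
move=> l f g /asboolP mf /asboolP mg; apply/asboolP.
by apply: lspace_memD => //; exact: lspace_memZ.
Qed.

HB.instance Definition _ :=
  GRing.SubChoice_isSubLmodule.Build _ _ _ lspace lspace_submod.

Lemma lspaceP (f : lspace) : mem f.
Proof. by case: f => g gP; exact/asboolP. Qed.

Let lspace_normD (f g : lspace) :
  (N (f + g : lspace))%:C%C <= (N f)%:C%C + (N g)%:C%C :> R[i].
Proof.
have NfNg : 0 <= N f + N g by rewrite addr_ge0// lspace_norm_ge0.
rewrite -rmorphD/= lecR; apply/(lspace_normP (lspaceP (f + g)) NfNg).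
apply: (@lspace_leD f g); try exact: lspace_norm_ge0.
  exact/lspace_leN/lspaceP.
exact/lspace_leN/lspaceP.
Qed.

Let lspace_norm0_eq0 (f : lspace) : (N f)%:C%C = 0 :> R[i] -> f = 0.
Proof.
move=> /complexI nf; apply/val_inj/funext => x /=.
have := lspace_leN (lspaceP f); rewrite nf => /(lspace_le_bounded (lexx 0)).
move=> /(_ x) h; apply: rnorm0_eq0; apply/eqP.
by rewrite eq_le h rnorm_ge0.
Qed.

Let lspace_normZ_le (l : R[i]) (f : lspace) :
  N (l *: f : lspace) <= @rnorm R (R[i])^o l * N f.
Proof.
have lN : 0 <= @rnorm R (R[i])^o l * N f.
  by rewrite mulr_ge0 ?rnorm_ge0// lspace_norm_ge0.
apply/(lspace_normP (lspaceP (l *: f)) lN).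
apply: (@lspace_leM (fun=> l) f) => //; first exact: rnorm_ge0.
  exact: lspace_norm_ge0.
exact/lspace_leN/lspaceP.
Qed.

Let lspace_normZ (l : R[i]) (f : lspace) :
  (N (l *: f : lspace))%:C%C = `|l| * (N f)%:C%C :> R[i].
Proof.
exact: (rnorm_scale_eq (fun f : lspace => lspace_norm_ge0 f) lspace_normZ_le).
Qed.

HB.instance Definition _ := @Lmodule_isNormed.Build R[i] lspace
  (fun f => (N f)%:C%C) lspace_normD lspace_normZ lspace_norm0_eq0.

End LspaceType.

Section BoundedOperators.
Variables (R : realType) (V : normedModType R[i]).

Definition bounded_linear (a : V -> V) : Prop :=
  linear a /\ exists M : R, forall v, rnorm (a v) <= M * rnorm v.

Record bop := Bop {
  bop_fun :> V -> V;
  bop_funP : `[< bounded_linear bop_fun >] }.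

HB.instance Definition _ := [isSub for bop_fun].
HB.instance Definition _ := [Choice of bop by <:].

Let bop_submod : submod_closed (fun a : V -> V => `[< bounded_linear a >] : bool).
Proof.
split.
  apply/asboolP; split; first by move=> l u v /=; rewrite scaler0 addr0.
  by exists 0 => v /=; rewrite rnorm0 mul0r.
move=> l a b /asboolP[la [Ma hMa]] /asboolP[lb [Mb hMb]]; apply/asboolP; split.
  move=> k u v; rewrite !fctE la lb !scalerDr !scalerA (mulrC l k) addrACA.
  by rewrite /=.
exists (@rnorm R (R[i])^o l * Ma + Mb) => v; rewrite !fctE mulrDl.
rewrite (le_trans (ler_rnormD _ _))// lerD// rnormZ -mulrA.
by rewrite ler_wpM2l ?rnorm_ge0.
Qed.

HB.instance Definition _ :=
  GRing.SubChoice_isSubLmodule.Build _ _ _ bop bop_submod.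

Lemma bopP (a : bop) : bounded_linear a.
Proof. exact/asboolP/bop_funP. Qed.

HB.instance Definition _ (a : bop) :=
  GRing.isLinear.Build R[i] V V *:%R a (bopP a).1.

Definition opnorm (a : V -> V) : R :=
  sup [set rnorm (a v) | v in [set v | rnorm v <= 1]].

Lemma opnorm_le (a : bop) (M : R) : 0 <= M ->
  opnorm a <= M <-> forall v, rnorm (a v) <= M * rnorm v.
Proof.
move=> M0; split=> [h v|h]; last first.
  apply: ge_sup; first by exists (rnorm (a 0)), 0 => //=; rewrite rnorm0 ler01.
  move=> _ [v /= v1 <-]; apply: le_trans (h v) _.
  by rewrite -[leRHS]mulr1 ler_wpM2l.
have [->|v0] := eqVneq v 0; first by rewrite linear0 rnorm0 mulr0.
have vp : 0 < rnorm v by exact: rnorm_gt0.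
have vi : @rnorm R (R[i])^o (rnorm v)^-1%:C%C = (rnorm v)^-1.
  by apply/(@complexI R); rewrite -rnormE ger0_norm// lecR invr_ge0 ltW.
rewrite -ler_pdivrMr// mulrC -[X in X * _]vi -rnormZ -linearZ.
apply: le_trans h; apply: ub_le_sup.
  have [M1 hM1] := (bopP a).2; exists (Num.max 0 M1) => _ [w /= w1 <-].
  have := hM1 w; have := rnorm_ge0 w => w0 /le_trans; apply.
  rewrite -[leRHS]mulr1; apply: (@le_trans _ _ (Num.max 0 M1 * rnorm w)).
    by rewrite ler_wpM2r// le_max lexx orbT.
  by rewrite ler_wpM2l// le_max lexx.
exists ((rnorm v)^-1%:C%C *: v) => //=.
by rewrite rnormZ vi mulVf// gt_eqF.
Qed.

Lemma opnorm_ge0 (a : bop) : 0 <= opnorm a.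
Proof.
have [M hM] := (bopP a).2.
apply: (@ub_le_sup _ [set rnorm (a v) | v in [set v | rnorm v <= 1]]); last first.
  by exists 0 => /=; rewrite ?rnorm0 ?ler01// linear0 rnorm0.
exists (Num.max 0 M) => _ [w /= w1 <-]; apply: le_trans (hM w) _.
rewrite -[leRHS]mulr1; apply: (@le_trans _ _ (Num.max 0 M * rnorm w)).
  by rewrite ler_wpM2r ?rnorm_ge0// le_max lexx orbT.
by rewrite ler_wpM2l// le_max lexx.
Qed.

Lemma rnorm_bop (a : bop) v : rnorm (a v) <= opnorm a * rnorm v.
Proof. by move: v; apply/opnorm_le => //; exact: opnorm_ge0. Qed.

Let opnormD (a b : bop) :
  (opnorm (a + b : bop))%:C%C <= (opnorm a)%:C%C + (opnorm b)%:C%C :> R[i].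
Proof.
rewrite -rmorphD/= lecR.
have ab0 : 0 <= opnorm a + opnorm b by rewrite addr_ge0 ?opnorm_ge0.
apply/(opnorm_le (a + b : bop) ab0) => v /=.
by rewrite (le_trans (ler_rnormD _ _))// mulrDl lerD// rnorm_bop.
Qed.

Let opnorm0_eq0 (a : bop) : (opnorm a)%:C%C = 0 :> R[i] -> a = 0.
Proof.
move=> /complexI a0; apply/val_inj/funext => v /=.
have := rnorm_bop a v; rewrite a0 mul0r => h; apply: rnorm0_eq0; apply/eqP.
by rewrite eq_le h rnorm_ge0.
Qed.

Let opnormZ_le (l : R[i]) (a : bop) :
  opnorm (l *: a : bop) <= @rnorm R (R[i])^o l * opnorm a.
Proof.
have la : 0 <= @rnorm R (R[i])^o l * opnorm a.
  by rewrite mulr_ge0 ?rnorm_ge0// opnorm_ge0.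
apply/(opnorm_le (l *: a : bop) la) => v /=; rewrite fctE rnormZ -mulrA.
by rewrite ler_wpM2l ?rnorm_ge0// rnorm_bop.
Qed.

Let opnormZ (l : R[i]) (a : bop) :
  (opnorm (l *: a : bop))%:C%C = `|l| * (opnorm a)%:C%C :> R[i].
Proof. exact: (rnorm_scale_eq opnorm_ge0 opnormZ_le). Qed.

HB.instance Definition _ := @Lmodule_isNormed.Build R[i] bop
  (fun a => (opnorm a)%:C%C) opnormD opnormZ opnorm0_eq0.

Let bounded_linear_comp (a b : bop) : `[< bounded_linear (a \o b) >].
Proof.
apply/asboolP; split; first by move=> l u v; rewrite /= !linearP.
exists (opnorm a * opnorm b) => v /=; rewrite (le_trans (rnorm_bop a _))//.
by rewrite -mulrA ler_wpM2l ?opnorm_ge0// rnorm_bop.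
Qed.

Let bounded_linear_id : `[< bounded_linear (@id V) >].
Proof. by apply/asboolP; split => //; exists 1 => v; rewrite mul1r. Qed.

Definition bop_comp (a b : bop) : bop := Bop (bounded_linear_comp a b).
Definition bop_id : bop := Bop bounded_linear_id.

Let bop_compA : associative bop_comp.
Proof. by move=> a b c; exact/val_inj. Qed.

Let bop_comp1l : left_id bop_id bop_comp.
Proof. by move=> a; exact/val_inj. Qed.

Let bop_comp1r : right_id bop_id bop_comp.
Proof. by move=> a; exact/val_inj. Qed.

Let bop_compDl : left_distributive bop_comp +%R.
Proof. by move=> a b c; exact/val_inj. Qed.

Let bop_compDr : right_distributive bop_comp +%R.
Proof.
by move=> a b c; apply/val_inj/funext => v; rewrite /= !fctE/= linearD.
Qed.

HB.instance Definition _ := GRing.Zmodule_isPzRing.Build bop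
  bop_compA bop_comp1l bop_comp1r bop_compDl bop_compDr.

End BoundedOperators.

Section BoundedContinuous.
Variables (R : realType) (X : metricType R).

Definition Cb_mem (f : X -> (R[i])^o) : Prop := continuous f /\ bounded_fun f.

Record Cb := MkCb {
  Cb_fun :> X -> (R[i])^o;
  Cb_funP : `[< Cb_mem Cb_fun >] }.

HB.instance Definition _ := [isSub for Cb_fun].
HB.instance Definition _ := [Choice of Cb by <:].

Let infp : ((+oo == 0 :> \bar R) || (1 <= +oo :> \bar R))%E.
Proof. by rewrite leey. Qed.

Let Cb_submod : submod_closed (fun f : X -> (R[i])^o => `[< Cb_mem f >] : bool).
Proof.
split.
  apply/asboolP; split; first exact: cst_continuous.
  by apply: (lspace_mem_cst0 infp).
move=> l f g /asboolP[cf bf] /asboolP[cg bg]; apply/asboolP; split.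
  move=> x; apply: cvgD; last exact: cg.
  by apply: cvgZr; exact: cf.
by apply: (lspace_memD infp) => //; exact: (lspace_memZ infp).
Qed.

HB.instance Definition _ :=
  GRing.SubChoice_isSubLmodule.Build _ _ _ Cb Cb_submod.

Lemma CbP (f : Cb) : Cb_mem f.
Proof. exact/asboolP/Cb_funP. Qed.

Let emb (f : Cb) : lspace infp X (R[i])^o := Lspace infp (asboolT (CbP f).2).

Definition Cb_norm (f : X -> (R[i])^o) : R :=
  sup [set rnorm (f x) | x in [set: X]].

Let CbE (f : Cb) : (Cb_norm f)%:C%C = `|emb f|.
Proof. by []. Qed.

Let Cb_normD (f g : Cb) :
  (Cb_norm (f + g : Cb))%:C%C <= (Cb_norm f)%:C%C + (Cb_norm g)%:C%C :> R[i].
Proof.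
rewrite !CbE (_ : emb (f + g) = emb f + emb g); first exact: ler_normD.
exact/val_inj.
Qed.

Let Cb_normZ (l : R[i]) (f : Cb) :
  (Cb_norm (l *: f : Cb))%:C%C = `|l| * (Cb_norm f)%:C%C :> R[i].
Proof.
rewrite !CbE (_ : emb (l *: f) = l *: emb f); first exact: normrZ.
exact/val_inj.
Qed.

Let Cb_norm0_eq0 (f : Cb) : (Cb_norm f)%:C%C = 0 :> R[i] -> f = 0.
Proof.
rewrite CbE => /normr0_eq0 h; apply/val_inj.
by rewrite /= -[LHS]/(val (emb f)) h.
Qed.

HB.instance Definition _ := @Lmodule_isNormed.Build R[i] Cb
  (fun f => (Cb_norm f)%:C%C) Cb_normD Cb_normZ Cb_norm0_eq0.

End BoundedContinuous.

Section Multiplication.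
Variables (R : realType) (p : \bar R) (hp : ((p == 0) || (1 <= p))%E).
Variables (X : metricType R) (E : normedModType R[i]).

Definition mulfun (f : Cb X) (v : lspace hp X E) : lspace hp X E :=
  Lspace hp (asboolT (lspace_memM hp (CbP f).1 (CbP f).2 (lspaceP v))).

Let mulfun_bounded (f : Cb X) : `[< bounded_linear (mulfun f) >].
Proof.
apply/asboolP; split.
  move=> l u v; apply/val_inj/funext => x /=.
  rewrite scalerDr scalerA [f x * l]mulrC.
  by rewrite -[RHS]/(l *: (f x *: u x) + f x *: v x) scalerA.
have /bounded_fun_rnorm[M0 hM0] := (CbP f).2.
pose M := Num.max 0 M0; have M_ge0 : 0 <= M by rewrite le_max lexx.
have hM x : rnorm (f x) <= M by rewrite le_max hM0 orbT.
exists M => v.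
have Mv : 0 <= M * rnorm v by rewrite mulr_ge0// rnorm_ge0.
apply/(lspace_normP hp (lspaceP (mulfun f v)) Mv).
apply: (lspace_leM hp M_ge0 (rnorm_ge0 v) hM).
exact: (lspace_leN hp (lspaceP v)).
Qed.

Definition mulop (f : Cb X) : bop (lspace hp X E) := Bop (mulfun_bounded f).

End Multiplication.

Section MetricNotions.
Variables (R : realType) (X : metricType R).

(* [closed_ball] of the library is the closure of the open ball, hence the
   explicit set. *)
Definition bounded_geometry : Prop :=
  forall r : R, 0 <= r ->
    exists N : nat, forall x : X, ([set y | mdist x y <= r] #<= `I_N)%card.

Definition supp (V : nmodType) (f : X -> V) : set X :=
  closure [set x | f x != 0].

(* d(A, B), equal to +oo when A or B is empty *)
Definition set_dist (A B : set X) : \bar R :=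
  ereal_inf [set (mdist x y)%:E | x in A & y in B].

Definition C0 : set (Cb X) := [set f | vanishes_at_infty f].

Definition higson : set (Cb X) :=
  [set g | forall r e : R, 0 < r -> 0 < e -> exists2 A : set X, compact A &
    forall x y, ~ A x -> ~ A y -> mdist x y < r -> rnorm (g x - g y) < e].

Definition lipschitz_with (L : R) (f : X -> (R[i])^o) : Prop :=
  forall x y, rnorm (f x - f y) <= L * mdist x y.

Definition very_lipschitz (f : nat -> Cb X) : Prop :=
  bounded_fun f /\
  forall L : R, 0 < L ->
    exists n0 : nat, forall n, (n0 <= n)%N -> lipschitz_with L (f n).

Definition positive_contraction (e : Cb X) : Prop :=
  (forall x, 0 <= (e x : R[i])) /\ `|e| <= 1.

Definition metric_partition (q : R) (I : choiceType) (phi : I -> X -> R) :=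
  [/\ forall i x, 0 <= phi i x <= 1,
      exists D : R, forall i x y, supp (phi i) x -> supp (phi i) y ->
        mdist x y <= D,
      exists M : nat, forall x, ([set i | supp (phi i) x] #<= `I_M)%card &
      forall x, (\esum_(i in [set: I]) (phi i x `^ q)%:E = 1)%E].

Definition partition_variation (q : R) (I : choiceType) (phi : I -> X -> R)
    (r e : R) : Prop :=
  forall x y, mdist x y <= r ->
    (\esum_(i in [set: I]) (`|phi i x - phi i y| `^ q)%:E < (e `^ q)%:E)%E.

(* The notion does not depend on the exponent q in [1, +oo[. *)
Definition property_A : Prop :=
  exists2 q : R, 1 <= q &
    forall r e : R, 0 < r -> 0 < e ->
      exists (I : choiceType) (phi : I -> X -> R),
        metric_partition q phi /\ partition_variation q phi r e.

End MetricNotions.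

Arguments bounded_geometry {R} X.
Arguments property_A {R} X.
Arguments higson {R} X.
Arguments C0 {R} X.

(* the direction of finite subsets of J, ordered by inclusion *)
Definition finite_subsets {J : choiceType} : set_system {fset J} :=
  filter_from [set: {fset J}] (fun F0 => [set F : {fset J} | (F0 `<=` F)%fset]).

Section Operators.
Variables (R : realType) (p : \bar R) (hp : ((p == 0) || (1 <= p))%E).
Variables (X : metricType R) (E : normedModType R[i]).

Local Notation BL := (bop (lspace hp X E)).
Local Notation M := (@mulop R p hp X E).

Definition commutator (a c : BL) : BL := a * c - c * a.

(* a possibly non-unital, norm-closed subalgebra *)
Definition banach_subalgebra (B : set BL) : Prop :=
  [/\ B 0,
      forall (l : R[i]) a b, B a -> B b -> B (l *: a + b),
      forall a b, B a -> B b -> B (a * b) &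
      closed B].

(* the set of products D B D, for D a set of multiplication operators *)
Definition two_sided_products (D : set (Cb X)) (B : set BL) : set BL :=
  [set t | exists f a g, [/\ D f, B a, D g & t = M f * a * M g]].

Definition block_cutdown_limit (J : choiceType) (e : J -> Cb X) (a t : BL) :=
  let S (F : {fset J}) : BL := \sum_(j <- F) M (e j) * a * M (e j) in
  if p == +oo%E
  then forall v x, (fun F => S F v x) @ finite_subsets --> t v x
  else forall v, (fun F => S F v) @ finite_subsets --> t v.

(* As for [lim], the value 0 is used where there is no limit; this does not
   happen for positive contractions with pairwise disjoint supports. *)
Definition block_cutdown (J : choiceType) (e : J -> Cb X) (a : BL) : BL :=
  xget 0 [set t | block_cutdown_limit e a t].

Definition closed_under_block_cutdowns (B : set BL) : Prop :=
  forall (J : choiceType) (e : J -> Cb X),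
    (forall j, positive_contraction (e j)) ->
    trivIset [set: J] (fun j => supp (e j)) ->
    forall a, B a -> B (block_cutdown e a).

Definition propagation_le (a : BL) (r : R) : Prop :=
  forall f f' : Cb X, (r%:E < set_dist (supp f) (supp f'))%E ->
    M f * a * M f' = 0.

Definition finite_propagation (a : BL) : Prop :=
  exists2 r : R, 0 <= r & propagation_le a r.

Definition eps_propagation_le (e : R) (a : BL) (r : R) : Prop :=
  forall f f' : Cb X, `|f| <= 1 -> `|f'| <= 1 ->
    (r%:E < set_dist (supp f) (supp f'))%E ->
    `|M f * a * M f'| < e%:C%C.

Definition quasi_local (a : BL) : Prop :=
  forall e : R, 0 < e -> exists2 r : R, 0 <= r & eps_propagation_le e a r.

Definition Roe (B : set BL) : set BL :=
  closure [set a | B a /\ finite_propagation a].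

Definition compact_ideal (B : set BL) : set BL :=
  closure (two_sided_products (C0 X) B).

(* [b, f] = 0 for all f in VL_oo(X), the commutator being taken in the quotient
   of the bounded sequences of operators by the sequences tending to 0 *)
Definition commutes_with_VL (b : BL) : Prop :=
  forall f : nat -> Cb X, very_lipschitz f ->
    (fun n => commutator b (M (f n))) @ \oo --> (0 : BL).

Definition higson_commutators_compact (B : set BL) (b : BL) : Prop :=
  forall g : Cb X, higson X g -> compact_ideal B (commutator b (M g)).

End Operators.

(* Main.v *)
Require Import Defs.
From HB Require Import structures.
From mathcomp Require Import all_boot all_order all_algebra finmap.
From mathcomp Require Import all_classical all_reals all_analysis.
From mathcomp Require Import complex ring lra zify.

(** Bounded geometry makes [X] discrete with uniformly finite balls, so
operators behave like matrices indexed by [X], and quasi-locality says that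
corners between far away sets are small. The four conditions are compared with
quasi-locality, which is a statement about corners [proj A * b * proj B].

Commutation with very Lipschitz sequences implies quasi-locality because a
function with values 1 on [A] and 0 on [B] sees the corner in its commutator
with [b], and it can be chosen with a small Lipschitz constant if [A] and [B]
are far apart ([VL_quasi_local]). Conversely, if [f] varies slowly, cutting it
into level sets writes its commutator with [b] as the sum of a block tridiagonal
operator of small norm and of corners between far away level sets
([rnorm_commutator_levels]). The same estimate away from a compact set shows
that commutators with Higson functions are compact ([quasi_local_higson]). For
the converse, a failure of quasi-locality produces infinitely many large corners
which can be moved off to infinity, and a single Higson function sees all of
them ([higson_quasi_local]).

Limits of operators of finite propagation are quasi-local. To approximate a
quasi-local [b] by operators of finite propagation of [B], one forms sums over
[x] of [F x * b * G x], with [F x] and [G x] supported in a ball of fixed radius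
around [x]; colouring [X] by separated sets writes such a sum with finitely many
block cutdowns ([near_diagonal_sum]). For a supremum norm it is enough to
truncate rows, and for the sum norm columns. In between, [F x] and [G x] are
powers of a partition of unity given by Property A. Every corner of the averaged
operator is bounded by that of [b], so that its difference [D] with [b] is
quasi-local with a control that does not depend on the partition, while [D] is
small on sets of bounded diameter once the partition varies slowly. It remains
to bound [D] by its restrictions to bounded sets, which is operator norm
localization ([rnorm_localization]): by metric sparsification, itself a
consequence of Property A, most of the mass of a vector and of its image is
carried by bounded sets far apart ([property_A_sparsification]), and there [D]
is block diagonal up to a small error, whatever the number of blocks
([rnorm_separated_blocks]). *)

Set Implicit Arguments.
Unset Strict Implicit.
Unset Printing Implicit Defensive.

Import Order.TTheory GRing.Theory Num.Theory.
Import numFieldNormedType.Exports.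

Local Open Scope classical_set_scope.
Local Open Scope ring_scope.

(** * Spaces of bounded geometry are discrete *)

Section RealNormTopology.
Variables (R : realType) (V : normedModType R[i]).

Lemma closure_rnorm (A : set V) (a : V) :
  closure A a <-> forall e : R, 0 < e -> exists2 c, A c & rnorm (a - c) < e.
Proof.
split=> [h e e0|h U].
  have [|c [Ac]] := h [set c | rnorm (a - c) < e].
    apply/nbhs_ballP; exists e%:C%C => /=; first by rewrite ltcR.
    by move=> c; rewrite -ball_normE /= rnormE ltcR.
  by move=> /= ?; exists c.
move=> /nbhs_ballP[e /= e0 he].
have /h[c Ac hc] : 0 < complex.Re e.
  by move: e0; case: e {he} => u w; rewrite ltcE /= => /andP[].
exists c; split => //; apply: he; rewrite -ball_normE /= rnormE.
by move: e0 hc; case: e => u w; rewrite !ltcE /= => /andP[/eqP -> _ ->]; rewrite eqxx.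
Qed.

Lemma cvg_rnorm (T : Type) (F : set_system T) {FF : Filter F} (f : T -> V)
    (l : V) :
  f @ F --> l <-> forall e : R, 0 < e -> \forall t \near F, rnorm (l - f t) < e.
Proof.
split=> [/cvgrPdist_lt h e e0|h].
  have := h e%:C%C; rewrite ltcR => /(_ e0); apply: filterS => t.
  by rewrite rnormE ltcR.
apply/cvgrPdist_lt => e e0.
have /h : 0 < complex.Re e.
  by move: e0; case: e => u w; rewrite ltcE /= => /andP[].
apply: filterS => t; rewrite rnormE; move: e0; case: e => u w.
by rewrite !ltcE /= => /andP[/eqP -> _ ->]; rewrite eqxx.
Qed.

Lemma ler_rnormB (u v : V) : rnorm (u - v) <= rnorm u + rnorm v.
Proof. by rewrite (le_trans (ler_rnormD _ _))// rnormN. Qed.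

Lemma ler_rnorm_sum (I : Type) (s : seq I) (P : pred I) (f : I -> V) :
  rnorm (\sum_(i <- s | P i) f i) <= \sum_(i <- s | P i) rnorm (f i).
Proof.
elim/big_rec2: _ => [|i x y _ h]; first by rewrite rnorm0.
by rewrite (le_trans (ler_rnormD _ _))// lerD2l.
Qed.

End RealNormTopology.

Lemma rnorm_RtoC (R : realType) (c : R) : rnorm (c%:C%C : R[i]^o) = `|c|.
Proof.
apply/(@complexI R); rewrite -rnormE.
have := @normc_def R (c%:C%C); rewrite /= expr0n/= addr0 sqrtr_sqr.
by [].
Qed.

Section Discrete.
Variables (R : realType) (X : metricType R).
Implicit Types (x y z : X) (s : seq X).

Lemma bounded_geometry_seq : bounded_geometry X -> forall r : R, 0 <= r ->
  exists N : nat, forall x s, uniq s ->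
    (forall y, y \in s -> mdist x y <= r) -> (size s <= N)%N.
Proof.
move=> bg r r0; have [N hN] := bg r r0; exists N => x s us hs.
have fb : finite_set [set y | mdist x y <= r] by apply/finite_set_leP; exists N.
apply: leq_trans (geq_card_fset_set (hN x)).
apply: uniq_leq_size => // y ys; rewrite in_fset_set// inE; exact: hs.
Qed.

Hypothesis bg : bounded_geometry X.

Lemma ball_enum x (r : R) : 
  exists s, uniq s /\ forall y, (y \in s) = (mdist x y <= r).
Proof.
have [r0|r0] := leP 0 r; last first.
  by exists [::]; split => // y; rewrite leNgt (lt_le_trans r0)// mdist_ge0.
have [N hN] := bg r0.
have fb : finite_set [set y | mdist x y <= r] by apply/finite_set_leP; exists N.
exists (fset_set [set y | mdist x y <= r]); split; first exact: fset_uniq.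
by move=> y; rewrite in_fset_set//; apply/idP/idP; rewrite inE.
Qed.

(** The unit ball around [x] is finite, so its points other than [x] stay at a
positive distance from [x].  Hence every function on [X] is continuous, and
compact, finite and bounded sets coincide. *)
Lemma discrete_nbhs x : nbhs x [set x].
Proof.
have [s [_ hs]] := ball_enum x 1.
have [e e0 [e1 he]] : exists2 e : R, 0 < e &
    e <= 1 /\ forall y, y \in s -> y != x -> e <= mdist x y.
  elim: s {hs} => [|y s [e e0 [e1 he]]]; first by exists 1.
  have [->|yx] := eqVneq y x.
    exists e => //; split => // z; rewrite inE => /orP[/eqP->|]; first by rewrite eqxx.
    exact: he.
  exists (Num.min e (mdist x y)); first by rewrite lt_min e0 mdist_gt0 eq_sym.
  split; first by rewrite ge_min e1.
  move=> z; rewrite inE ge_min => /orP[/eqP->|zs zx]; first by rewrite lexx orbT.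
  by rewrite he.
apply/nbhs_ballP; exists e => //= y; rewrite ballEmdist/= => ye.
apply/eqP; apply/negPn/negP => yx; move: ye; apply/negP; rewrite -leNgt.
have [y1|/ltW] := leP (mdist x y) 1; last exact: le_trans e1.
by apply: he; rewrite ?hs.
Qed.

Lemma discrete_continuous (T : topologicalType) (f : X -> T) : continuous f.
Proof.
move=> x U /nbhs_singleton Ux; apply: filterS (discrete_nbhs x).
by move=> y ->.
Qed.

Lemma supp_discrete (V : nmodType) (f : X -> V) : supp f = [set x | f x != 0].
Proof.
rewrite /supp; apply/seteqP; split => x; last exact: subset_closure.
by move=> /(_ _ (discrete_nbhs x))[y [/= fy <-]].
Qed.

Lemma mdist_ball_compact x (r : R) : compact [set y | mdist x y <= r].
Proof.
apply: finite_compact; have [s [us hs]] := ball_enum x r.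
rewrite (_ : [set y | _] = [set` s]); first exact: finite_seq.
by apply/seteqP; split => y /=; rewrite hs.
Qed.

Lemma compact_ball (A : set X) x :
  compact A -> exists r : R, forall y, A y -> mdist x y <= r.
Proof.
move=> cA.
have cf : {within A, continuous (fun y => mdist x y : R^o)}.
  by apply: continuous_subspaceT; exact: discrete_continuous.
have [M [_ hM]] := compact_bounded (continuous_compact cf cA).
exists (M + 1) => y Ay; rewrite -[leLHS]ger0_norm ?mdist_ge0//.
by apply: hM; [rewrite ltrDl|exists y].
Qed.

Lemma compact_seq (A : set X) :
  compact A -> exists s, forall y, A y -> y \in s.
Proof.
have [->|/set0P[x _]] := eqVneq A set0; first by exists [::].
move=> /compact_ball - /(_ x)[r hr]; have [s [_ hs]] := ball_enum x r.
by exists s => y /hr; rewrite hs.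
Qed.

Lemma vanishes_seqP (V : normedModType R[i]) (f : X -> V) :
  vanishes_at_infty f <->
  forall e : R, 0 < e -> exists s, forall x, x \notin s -> rnorm (f x) < e.
Proof.
split=> h e e0.
  have [A /compact_seq[s hs] hA] := h _ e0.
  by exists s => x /negP xs; apply: hA => /hs.
have [s hs] := h _ e0; exists [set` s]; first exact/finite_compact/finite_seq.
by move=> x /= /negP; exact: hs.
Qed.

End Discrete.

(** * Norms of vectors and of operators *)

Section LspaceNorm.
Variables (R : realType) (p : \bar R) (hp : ((p == 0) || (1 <= p))%E).
Variables (X : metricType R) (E : normedModType R[i]).
Local Notation L := (lspace hp X E).
Implicit Types (f g : X -> E) (u v w : L) (s : seq X).

Lemma lspace_ext u v : (forall x, u x = v x) -> u = v.
Proof. by move=> h; apply/val_inj/funext. Qed.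

Lemma rnorm_lspace_leP v (M : R) : 0 <= M -> rnorm v <= M <-> lspace_le p v M.
Proof. by move=> M0; exact: (lspace_normP hp (lspaceP v) M0). Qed.

Lemma rnorm_lspace_le v : lspace_le p v (rnorm v).
Proof. exact: (lspace_leN hp (lspaceP v)). Qed.

(** The exponents 0 and [+oo] share the supremum norm, so that every norm
estimate splits into two cases only. *)
Lemma lspace_le_cases :
  [/\ forall r : R, p = r%:E -> r = 0 &
      forall f M, lspace_le p f M <-> forall x, rnorm (f x) <= M] \/
  exists r : R, [/\ 1 <= r, p = r%:E &
    forall f M, lspace_le p f M <->
      forall s, uniq s -> \sum_(x <- s) rnorm (f x) `^ r <= M `^ r].
Proof.
rewrite /lspace_le; move: hp => hp'; case: p hp' => [r| |] hr; [|by left..].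
have [->|r0] := eqVneq r 0; first by left; split=> [? [->]|].
by right; exists r; split => //; move: hr; rewrite eqe (negbTE r0)/= lee_fin.
Qed.

Lemma lspace_le_mono f g (M : R) :
  (forall x, rnorm (f x) <= rnorm (g x)) -> lspace_le p g M -> lspace_le p f M.
Proof.
move=> h; have [[_ lE]|[r [r1 _ lE]]] := lspace_le_cases.
  by move=> /lE k; apply/lE => x; exact: le_trans (h x) (k x).
move=> /lE k; apply/lE => s /k; apply: le_trans; apply: ler_sum => x _.
by apply: ge0_ler_powR; rewrite ?nnegrE ?rnorm_ge0// (le_trans _ r1).
Qed.

Lemma lspace_le_seq f (M : R) : 0 <= M ->
  (forall s, lspace_le p (fun x => if x \in s then f x else 0) M) ->
  lspace_le p f M.
Proof.
move=> M0; have [[_ lE]|[r [r1 _ lE]]] := lspace_le_cases.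
  by move=> h; apply/lE => x; have /lE/(_ x) := h [:: x]; rewrite inE eqxx.
move=> h; apply/lE => s us; have /lE/(_ s us) := h s; apply: le_trans.
by rewrite le_eqVlt; apply/orP; left; apply/eqP/eq_big_seq => x ->.
Qed.

Lemma rnorm_coord v x : rnorm (v x) <= rnorm v.
Proof.
by apply: (lspace_le_bounded hp (rnorm_ge0 v)); exact: rnorm_lspace_le.
Qed.

Lemma rnorm_lspace_mono u v :
  (forall x, rnorm (u x) <= rnorm (v x)) -> rnorm u <= rnorm v.
Proof.
move=> h; apply/(rnorm_lspace_leP _ (rnorm_ge0 v)).
exact: lspace_le_mono h (rnorm_lspace_le v).
Qed.

Lemma rnorm_lspace_scale (C : R) u v : 0 <= C ->
  (forall x, rnorm (u x) <= C * rnorm (v x)) -> rnorm u <= C * rnorm v.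
Proof.
move=> C0 h.
have hC (V : normedModType R[i]) (z : V) : C * rnorm z = rnorm (C%:C%C *: z).
  by rewrite rnormZ rnorm_RtoC ger0_norm.
by rewrite hC; apply: rnorm_lspace_mono => x; rewrite (le_trans (h x))// hC.
Qed.

(** The inequality is between finite sums of norms to the power [r], which
are sums over points; it thus reduces to one between the coordinates. *)
Lemma sum_rnorm_powR (r : R) (K : Type) (ks : seq K) (u : K -> L) (v : L) :
  1 <= r -> p = r%:E ->
  (forall x, \sum_(k <- ks) rnorm (u k x) `^ r <= rnorm (v x) `^ r) ->
  \sum_(k <- ks) rnorm (u k) `^ r <= rnorm v `^ r.
Proof.
move=> r1 pr h; have r0 : 0 < r by exact: lt_le_trans r1.
have nE' f : lspace_mem p f ->
    (lspace_norm p f `^ r)%:E = (\esum_(x in [set: X]) (rnorm (f x) `^ r)%:E)%E.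
  rewrite /lspace_norm /lspace_mem pr gt_eqF//.
  have : (0 <= \esum_(x in [set: X]) (rnorm (f x) `^ r)%:E)%E.
    by apply: esum_ge0 => x _; rewrite lee_fin powR_ge0.
  case: (\esum_(_ in _) _)%E => //= t t0 _.
  by rewrite -powRrM mulVf ?gt_eqF// powRr1// -lee_fin.
have nE (z : L) := nE' _ (lspaceP z).
rewrite -lee_fin -sumEFin nE; under eq_bigr do rewrite nE.
have -> : (\sum_(k <- ks) \esum_(x in [set: X]) (rnorm (u k x) `^ r)%:E =
   \esum_(x in [set: X]) (\sum_(k <- ks) rnorm (u k x) `^ r)%:E)%E.
  elim: ks {h} => [|k ks ih].
    by rewrite big_nil esum1// => x _; rewrite big_nil.
  rewrite big_cons ih -esumD; last 2 first.
    by move=> x _; rewrite lee_fin powR_ge0.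
    by move=> x _; rewrite lee_fin sumr_ge0// => *; exact: powR_ge0.
  by apply: eq_esum => x _; rewrite big_cons EFinD.
by apply: le_esum => x _; rewrite lee_fin.
Qed.

End LspaceNorm.

Section BopNorm.
Variables (R : realType) (V : normedModType R[i]).
Local Notation B := (bop V).
Implicit Types (a b c : B) (v : V).

Lemma bop_ext a b : (forall v, a v = b v) -> a = b.
Proof. by move=> h; apply/val_inj/funext. Qed.

Lemma rnorm_bop_leP a (M : R) : 0 <= M ->
  rnorm a <= M <-> forall v, rnorm (a v) <= M * rnorm v.
Proof. exact: opnorm_le. Qed.

Lemma rnorm_app_le a v : rnorm (a v) <= rnorm a * rnorm v.
Proof. exact: rnorm_bop. Qed.

Lemma rnorm_bopM a b : rnorm (a * b) <= rnorm a * rnorm b.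
Proof.
apply/rnorm_bop_leP => [|v]; first by rewrite mulr_ge0 ?rnorm_ge0.
rewrite (le_trans (rnorm_app_le a _))// -mulrA.
by rewrite ler_wpM2l ?rnorm_ge0// rnorm_app_le.
Qed.

Lemma bopDE a b v : (a + b) v = a v + b v. Proof. by []. Qed.
Lemma bopBE a b v : (a - b) v = a v - b v. Proof. by []. Qed.
Lemma bopME a b v : (a * b) v = a (b v). Proof. by []. Qed.
Lemma bopZE (l : R[i]) a v : (l *: a) v = l *: a v. Proof. by []. Qed.
Lemma bop_sumE (I : Type) (s : seq I) (P : pred I) (F : I -> B) v :
  (\sum_(i <- s | P i) F i) v = \sum_(i <- s | P i) F i v.
Proof. by elim/big_rec2: _ => // i x y _ <-. Qed.

Lemma rnorm_bop_lt a (M : R) : 0 <= M -> M < rnorm a ->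
  exists v, M * rnorm v < rnorm (a v).
Proof.
move=> M0; rewrite ltNge => /negP h; apply: contrapT => /forallNP k.
by apply: h; apply/rnorm_bop_leP => // v; rewrite leNgt; apply/negP/k.
Qed.

End BopNorm.

(** * Multiplication operators and block sums *)

Lemma sum_at_most_one (R : realType) (K : eqType) (D : pred K) (ks : seq K)
    (a : R) :
  uniq ks -> 0 <= a -> (forall k k', D k -> D k' -> k = k') ->
  \sum_(k <- ks) (if D k then a else 0) <= a.
Proof.
move=> uks a0 Dinj; have [/hasP[k kks Dk]|/hasPn nD] := boolP (has D ks).
  rewrite (bigD1_seq k)//= Dk big1 ?addr0// => k' k'k.
  by case: ifP => // /Dinj/(_ Dk)/eqP; rewrite (negbTE k'k).
by rewrite big_seq big1// => k /nD/negbTE ->.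
Qed.

Section Multipliers.
Variables (R : realType) (p : \bar R) (hp : ((p == 0) || (1 <= p))%E).
Variables (X : metricType R) (E : normedModType R[i]).
Hypothesis bg : bounded_geometry X.
Local Notation L := (lspace hp X E).
Local Notation BL := (bop L).
Implicit Types (f g : X -> R) (u v w : L) (a b c : BL) (A B F : set X).

Lemma CbR_mem f : (exists C, forall x, `|f x| <= C) ->
  Cb_mem (fun x => (f x)%:C%C : R[i]^o).
Proof.
move=> [C hC]; split; first exact: discrete_continuous.
by apply/bounded_fun_rnorm; exists C => x; rewrite rnorm_RtoC.
Qed.

(** Total in [f], so that boundedness is asked for only where values are
computed. *)
Definition CbR f : Cb X :=
  match pselect (exists C, forall x, `|f x| <= C) with
  | left h => MkCb (asboolT (CbR_mem h))
  | right _ => 0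
  end.

Lemma CbRE f x : (exists C, forall x, `|f x| <= C) -> CbR f x = (f x)%:C%C.
Proof. by move=> h; rewrite /CbR; case: pselect. Qed.

Definition mulR f : BL := mulop hp E (CbR f).

Lemma mulopE (f : Cb X) v x : mulop hp E f v x = f x *: v x.
Proof. by []. Qed.

Lemma mulRE f v x : (exists C, forall x, `|f x| <= C) ->
  mulR f v x = (f x)%:C%C *: v x.
Proof. by move=> h; rewrite mulopE CbRE. Qed.

Lemma rnorm_mulop_le (f : Cb X) (C : R) : 0 <= C ->
  (forall x, rnorm (f x) <= C) -> rnorm (mulop hp E f) <= C.
Proof.
move=> C0 h; apply/rnorm_bop_leP => // v.
apply: rnorm_lspace_scale => // x; rewrite mulopE rnormZ.
by rewrite ler_wpM2r ?rnorm_ge0.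
Qed.

Lemma rnorm_mulR_le f (C : R) : 0 <= C ->
  (forall x, `|f x| <= C) -> rnorm (mulR f) <= C.
Proof.
move=> C0 h; apply: rnorm_mulop_le => // x.
by rewrite CbRE ?rnorm_RtoC//; exists C.
Qed.

Lemma indic_bounded A : exists C : R, forall x, `|\1_A x| <= C.
Proof. by exists 1 => x; rewrite indicE; case: (x \in A); rewrite ?normr1 ?normr0. Qed.

Definition proj A : BL := mulR (\1_A).

Lemma projE A v x : proj A v x = if x \in A then v x else 0.
Proof.
rewrite mulRE; last exact: indic_bounded.
by rewrite indicE; case: (x \in A); rewrite ?scale1r ?scale0r.
Qed.

Lemma proj_in A v x : A x -> proj A v x = v x.
Proof. by move=> Ax; rewrite projE mem_set. Qed.

Lemma proj_out A v x : ~ A x -> proj A v x = 0.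
Proof. by move=> Ax; rewrite projE memNset. Qed.

Lemma projM A B : proj A * proj B = proj (A `&` B).
Proof.
apply: bop_ext => v; apply: lspace_ext => x.
by rewrite bopME !projE in_setI; case: (x \in A).
Qed.

Lemma projT : proj setT = 1.
Proof. by apply: bop_ext => v; apply: lspace_ext => x; rewrite proj_in. Qed.

Lemma proj0 : proj set0 = 0.
Proof. by apply: bop_ext => v; apply: lspace_ext => x; rewrite proj_out. Qed.

Lemma projID A F : proj A = proj (A `&` F) + proj (A `\` F).
Proof.
apply: bop_ext => v; apply: lspace_ext => x.
rewrite bopDE -[RHS]/(proj (A `&` F) v x + proj (A `\` F) v x) !projE.
by rewrite in_setI in_setD; case: (x \in A); case: (x \in F); rewrite /= ?addr0 ?add0r.
Qed.

Lemma projC A : proj (~` A) = 1 - proj A.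
Proof. by rewrite -projT (projID setT A) setTI setTD addrAC subrr add0r. Qed.

Lemma proj_ler A v : rnorm (proj A v) <= rnorm v.
Proof.
apply: rnorm_lspace_mono => x; rewrite projE.
by case: ifP => //; rewrite rnorm0 rnorm_ge0.
Qed.

Lemma rnorm_proj_le A : rnorm (proj A) <= 1.
Proof. by apply/rnorm_bop_leP => // v; rewrite mul1r proj_ler. Qed.

Lemma rnorm_projl A b : rnorm (proj A * b) <= rnorm b.
Proof.
apply/rnorm_bop_leP => [|v]; first exact: rnorm_ge0.
by rewrite bopME (le_trans (proj_ler _ _))// rnorm_app_le.
Qed.

Lemma rnorm_projr A b : rnorm (b * proj A) <= rnorm b.
Proof.
rewrite (le_trans (rnorm_bopM _ _))// -[leRHS]mulr1.
by rewrite ler_wpM2l ?rnorm_ge0 ?rnorm_proj_le.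
Qed.

Lemma rnorm_cut_mono A A' B B' b : A `<=` A' -> B `<=` B' ->
  rnorm (proj A * b * proj B) <= rnorm (proj A' * b * proj B').
Proof.
move=> AA BB; have -> : proj A * b * proj B =
    proj A * (proj A' * b * proj B') * proj B.
  have {1}-> : A = A `&` A' by apply/esym/setIidPl.
  have {1}-> : B = B' `&` B by apply/esym/setIidPr.
  by rewrite -!projM !mulrA.
by rewrite (le_trans (rnorm_projr _ _))// rnorm_projl.
Qed.

Lemma rnorm_proj_exhaust v (C : R) : 0 <= C ->
  (forall s : seq X, rnorm (proj [set` s] v) <= C) -> rnorm v <= C.
Proof.
move=> C0 h; apply/rnorm_lspace_leP => //; apply: (lspace_le_seq hp) => // s.
have /(rnorm_lspace_leP _ C0) := h s; apply: (lspace_le_mono hp) => x.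
rewrite projE; case: ifP => xs; last by rewrite rnorm0 rnorm_ge0.
by rewrite mem_set.
Qed.

(** An operator that is block diagonal, from a family of disjoint sets [Q k]
to the fibres of [kappa], has norm at most the supremum of the norms of its
blocks: for finite exponents both the source and the target norms to the power
[r] split as sums over the blocks. *)
Lemma block_le (K : choiceType) (kappa : X -> K) (Q : K -> set X) (T : K -> BL)
    (C : R) v (w : X -> E) : 0 <= C ->
  (forall k, rnorm (T k) <= C) -> trivIset setT Q ->
  (forall x, w x = T (kappa x) (proj (Q (kappa x)) v) x) ->
  lspace_le p w (C * rnorm v).
Proof.
move=> C0 hT tQ hw; have [[_ lE]|[r [r1 pr lE]]] := lspace_le_cases hp X E.
  apply/lE => x; rewrite hw; apply: le_trans (rnorm_coord _ _) _.
  rewrite (le_trans (rnorm_app_le _ _))// ler_pM ?rnorm_ge0//.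
  exact: proj_ler.
have r0 : 0 < r by exact: lt_le_trans r1.
apply/lE => s us; pose ks := undup (map kappa s).
have uks : uniq ks by exact: undup_uniq.
have -> : \sum_(x <- s) rnorm (w x) `^ r =
    \sum_(k <- ks) \sum_(x <- s | kappa x == k) rnorm (w x) `^ r.
  under [in RHS]eq_bigr do rewrite big_mkcond.
  rewrite exchange_big/= big_seq [RHS]big_seq; apply: eq_bigr => x xs.
  rewrite (bigD1_seq (kappa x))//=; last by rewrite mem_undup map_f.
  by rewrite eqxx big1 ?addr0// => k /negbTE; rewrite eq_sym => ->.
apply: (@le_trans _ _ (\sum_(k <- ks) C `^ r * rnorm (proj (Q k) v) `^ r)).
  apply: ler_sum => k _; rewrite -powRM ?rnorm_ge0//.
  apply: (@le_trans _ _ (\sum_(x <- s) rnorm (T k (proj (Q k) v) x) `^ r)).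
    rewrite big_mkcond; apply: ler_sum => x _; case: ifP => [/eqP kx|_].
      by rewrite hw kx.
    exact: powR_ge0.
  apply: (@le_trans _ _ (rnorm (T k (proj (Q k) v)) `^ r)).
    by have /lE/(_ s us) := rnorm_lspace_le (T k (proj (Q k) v)).
  apply: ge0_ler_powR; rewrite ?nnegrE ?mulr_ge0 ?rnorm_ge0 ?(ltW r0)//.
  by rewrite (le_trans (rnorm_app_le _ _))// ler_wpM2r ?rnorm_ge0.
rewrite -mulr_sumr powRM ?rnorm_ge0// ler_wpM2l ?powR_ge0//.
apply: (sum_rnorm_powR r1 pr) => x.
rewrite (eq_bigr (fun k => if x \in Q k then rnorm (v x) `^ r else 0)); last first.
  by move=> k _; rewrite projE; case: ifP => // _; rewrite rnorm0 powR0 ?gt_eqF.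
apply: sum_at_most_one => //; first exact: powR_ge0.
move=> k k'; rewrite !inE => kx k'x; apply: tQ => //.
by exists x.
Qed.

End Multipliers.

(** * Quasi-locality *)

Section Bump.
Variables (R : realType) (X : metricType R).
Implicit Types (W : set (X * R)) (x y a : X).

(** The upper envelope of the cones of height 1 and slope [l] at [a], for
[(a, l)] in [W], and of the function 0. *)
Definition bump W x : R :=
  sup [set t | t = 0 \/ exists2 al : X * R, W al & t = 1 - al.2 * mdist x al.1].

Variable W : set (X * R).
Hypothesis W_ge0 : forall a l, W (a, l) -> 0 <= l.

Let bump_ub x : has_ubound
  [set t | t = 0 \/ exists2 al : X * R, W al & t = 1 - al.2 * mdist x al.1].
Proof.
exists 1 => _ [->//|[[a l] Wal ->]]/=; rewrite gerBl.
by rewrite mulr_ge0 ?mdist_ge0//; exact: W_ge0 Wal.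
Qed.

Lemma bump_le x (M : R) : 0 <= M ->
  (forall a l, W (a, l) -> 1 - l * mdist x a <= M) -> bump W x <= M.
Proof.
move=> M0 h; apply: ge_sup; first by exists 0; left.
by move=> _ [->//|[[a l] Wal ->]]; exact: h.
Qed.

Lemma bump_ge0 x : 0 <= bump W x.
Proof. by apply: ub_le_sup; [exact: bump_ub|left]. Qed.

Lemma cone_le_bump x a l : W (a, l) -> 1 - l * mdist x a <= bump W x.
Proof. by move=> Wal; apply: ub_le_sup; [exact: bump_ub|right; exists (a, l)]. Qed.

Lemma bump_le1 x : bump W x <= 1.
Proof.
apply: bump_le => // a l Wal; rewrite gerBl.
by rewrite mulr_ge0 ?mdist_ge0//; exact: W_ge0 Wal.
Qed.

Lemma bump_norm_le1 x : `|bump W x| <= 1.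
Proof. by rewrite ger0_norm ?bump_ge0 ?bump_le1. Qed.

Lemma bump_center a l : W (a, l) -> bump W a = 1.
Proof.
move=> Wal; apply/eqP; rewrite eq_le bump_le1/=.
by have := cone_le_bump a Wal; rewrite mdistxx mulr0 subr0.
Qed.

Lemma bump_eq0 x : (forall a l, W (a, l) -> 1 <= l * mdist x a) -> bump W x = 0.
Proof.
move=> h; apply/eqP; rewrite eq_le bump_ge0 andbT.
by apply: bump_le => // a l /h; rewrite subr_le0.
Qed.

(** Only the cones that are positive at [x] or at [y] matter for the variation
of the envelope between [x] and [y]. *)
Lemma bump_variation x y (d : R) : 0 <= d ->
  (forall a l, W (a, l) -> l * mdist x a < 1 \/ l * mdist y a < 1 ->
     l * mdist x y <= d) -> `|bump W x - bump W y| <= d.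
Proof.
move=> d0 h.
suff k u v : (forall a l, W (a, l) -> l * mdist u a < 1 -> l * mdist u v <= d) ->
    bump W u <= bump W v + d.
  rewrite ler_distlC; apply/andP; split; rewrite ?lerBlDr k// => a l Wal hal.
    by apply: h Wal _; left.
  by rewrite metric_sym; apply: h Wal _; right.
move=> {}h; apply: bump_le => [|a l Wal]; first by rewrite addr_ge0 ?bump_ge0.
have [ua|ua] := ltP (l * mdist u a) 1; last first.
  by apply: (@le_trans _ _ 0); rewrite ?subr_le0// addr_ge0 ?bump_ge0.
apply: (@le_trans _ _ (1 - l * mdist v a + l * mdist u v)); last first.
  by rewrite lerD ?(cone_le_bump v Wal) ?(h a l).
have := ler_wpM2l (W_ge0 Wal) (metric_triangle v u a).
by rewrite mulrDr (metric_sym v u); lra.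
Qed.

End Bump.

Section QuasiLocal.
Variables (R : realType) (p : \bar R) (hp : ((p == 0) || (1 <= p))%E).
Variables (X : metricType R) (E : normedModType R[i]).
Hypothesis bg : bounded_geometry X.
Local Notation L := (lspace hp X E).
Local Notation BL := (bop L).
Local Notation proj := (proj hp E bg).
Implicit Types (a b c : BL) (A B F : set X).

Definition separated_by (r : R) A B := forall x y, A x -> B y -> r < mdist x y.

Lemma separated_by_le r r' A A' B B' : r <= r' -> A `<=` A' -> B `<=` B' ->
  separated_by r' A' B' -> separated_by r A B.
Proof. by move=> rr AA BB h x y /AA Ax /BB By; rewrite (le_lt_trans rr)// h. Qed.

Lemma set_dist_separated r A B :
  (r%:E < set_dist A B)%E -> separated_by r A B.
Proof.
move=> h x y Ax By; rewrite -lte_fin; apply: lt_le_trans h _.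
by apply: ereal_inf_lbound; exists x => //; exists y.
Qed.

Lemma separated_set_dist r r' A B : r < r' ->
  separated_by r' A B -> (r%:E < set_dist A B)%E.
Proof.
move=> rr h; apply: (@lt_le_trans _ _ r'%:E); first by rewrite lte_fin.
by apply: le_ereal_inf_tmp => _ [x Ax [y By <-]]; rewrite lee_fin ltW ?h.
Qed.

Lemma Cb_norm_leP (f : Cb X) (C : R) : 0 <= C ->
  rnorm f <= C <-> forall x, rnorm (f x) <= C.
Proof.
move=> C0; have /bounded_fun_rnorm[M hM] := (CbP f).2.
rewrite [rnorm f]/(Cb_norm f); split=> [h x|h].
  apply: le_trans h; apply: ub_le_sup; last by exists x.
  by exists M => _ [y _ <-].
have [->|/set0P ne] := eqVneq [set rnorm (f x) | x in [set: X]] set0.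
  by rewrite sup0.
by apply: ge_sup => // _ [x _ <-].
Qed.

Lemma Cb_contractionP (f : Cb X) : `|f| <= 1 <-> forall x, rnorm (f x) <= 1.
Proof. by rewrite rnormE (lecR _ 1); exact: Cb_norm_leP. Qed.

Lemma indic_contraction A : `|CbR bg (\1_A)| <= 1.
Proof.
apply/Cb_contractionP => x; rewrite CbRE ?rnorm_RtoC; last exact: indic_bounded.
by rewrite indicE; case: (x \in A); rewrite ?normr1 ?normr0.
Qed.

Lemma supp_indic A : supp (CbR bg (\1_A) : X -> R[i]^o) `<=` A.
Proof.
rewrite supp_discrete// => x /=; rewrite CbRE; last exact: indic_bounded.
by rewrite indicE; case: (boolP (x \in A)); rewrite ?inE// eqxx.
Qed.

Lemma mulop_projl (f : Cb X) A : supp f `<=` A ->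
  mulop hp E f * proj A = mulop hp E f.
Proof.
rewrite supp_discrete// => fA; apply: bop_ext => v; apply: lspace_ext => x.
rewrite bopME !(mulopE f); have [->|/fA Ax] := eqVneq (f x) 0; first by rewrite !scale0r.
by rewrite proj_in.
Qed.

Lemma mulop_projr (f : Cb X) A : supp f `<=` A ->
  proj A * mulop hp E f = mulop hp E f.
Proof.
rewrite supp_discrete// => fA; apply: bop_ext => v; apply: lspace_ext => x.
rewrite bopME projE (mulopE f); case: ifPn => //; rewrite notin_setE => xA.
by have [->|/fA//] := eqVneq (f x) 0; rewrite scale0r.
Qed.

Definition quasi_local_sets b := forall e : R, 0 < e -> exists2 r : R, 0 <= r &
  forall A B, separated_by r A B -> rnorm (proj A * b * proj B) < e.

Lemma quasi_localP b : quasi_local b <-> quasi_local_sets b.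
Proof.
split=> h e e0; have [r r0 hr] := h e e0.
  (* the distance between sets is an infimum, whence a margin of 1 *)
  exists (r + 1) => [|A B AB]; first by rewrite addr_ge0.
  rewrite -ltcR -rnormE.
  apply: hr; [exact: indic_contraction|exact: indic_contraction|].
  apply: (@separated_set_dist _ (r + 1)); first by rewrite ltrDl.
  by move=> x y /supp_indic Ax /supp_indic By; exact: AB.
exists r => // f f' /Cb_contractionP f1 /Cb_contractionP f'1 /set_dist_separated ff.
rewrite rnormE ltcR -(mulop_projl (f := f) (A := supp f))// -(mulop_projr (f := f') (A := supp f'))//.
rewrite !mulrA; apply: le_lt_trans (hr _ _ ff).
rewrite (le_trans (rnorm_bopM _ _))// -[leRHS]mulr1.
rewrite ler_pM ?rnorm_ge0 ?rnorm_mulop_le// -!mulrA.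
rewrite (le_trans (rnorm_bopM _ _))// -[leRHS]mul1r.
by rewrite ler_pM ?rnorm_ge0 ?rnorm_mulop_le.
Qed.

Lemma Roe_quasi_local (BB : set BL) b : Roe BB b -> quasi_local_sets b.
Proof.
move=> /closure_rnorm h e /h[a [_ [r r0 ar]] ba].
exists (r + 1) => [|A B AB]; first by rewrite addr_ge0.
apply: le_lt_trans ba.
have a0 : proj A * a * proj B = 0.
  apply: ar; apply: (@separated_set_dist _ (r + 1)); first by rewrite ltrDl.
  by move=> x y /supp_indic Ax /supp_indic By; exact: AB.
rewrite -[X in rnorm X]subr0 -a0 -mulrBl -mulrBr.
by rewrite (le_trans (rnorm_projr _ _ _))// rnorm_projl.
Qed.

(** Commutators detect corners: of the two terms of the commutator, only
[f * b] survives between [A] and [B]. *)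
Lemma commutator_corner b (f : Cb X) A B :
  (forall x, A x -> f x = 1) -> (forall x, B x -> f x = 0) ->
  proj A * commutator b (mulop hp E f) * proj B = - (proj A * b * proj B).
Proof.
move=> fA fB.
have f0 : mulop hp E f * proj B = 0.
  apply: bop_ext => v; apply: lspace_ext => x; rewrite bopME (mulopE f) projE.
  by case: ifPn; rewrite ?scaler0// inE => /fB ->; rewrite scale0r.
have f1 : proj A * mulop hp E f = proj A.
  apply: bop_ext => v; apply: lspace_ext => x; rewrite bopME !projE (mulopE f).
  by case: ifPn => //; rewrite inE => /fA ->; rewrite scale1r.
by rewrite /commutator mulrBr mulrBl -!mulrA f0 !mulr0 sub0r !mulrA f1.
Qed.

(** If quasi-locality failed, there would be corners of norm at least [e] between
sets [A n] and [B n] at distance more than [n + 1].  The cones of height 1 and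
slope [1 / (n + 1)] around [A n] vanish on [B n]; they form a very Lipschitz
sequence, and their commutators with [b] contain these corners. *)
Lemma VL_quasi_local b : commutes_with_VL b -> quasi_local_sets b.
Proof.
move=> bVL e e0; apply: contrapT => nql.
have /choice[AB hAB] (n : nat) : exists AB : set X * set X,
    separated_by n.+1%:R AB.1 AB.2 /\ e <= rnorm (proj AB.1 * b * proj AB.2).
  apply: contrapT => /forallNP h; apply: nql; exists n.+1%:R => // A B sAB.
  by rewrite ltNge; apply/negP => eAB; apply: (h (A, B)).
pose W n : set (X * R) := [set al | (AB n).1 al.1 /\ al.2 = n.+1%:R^-1].
have W0 n (z : X) l : W n (z, l) -> 0 <= l by move=> [_ /= ->].
pose f n := CbR bg (bump (W n)).
have fE n x : f n x = (bump (W n) x)%:C%C.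
  by rewrite CbRE//; exists 1 => y; exact/bump_norm_le1/W0.
have vlf : very_lipschitz f.
  split.
    apply/bounded_fun_rnorm; exists 1 => n; apply/Cb_norm_leP => // x.
    by rewrite fE rnorm_RtoC; exact/bump_norm_le1/W0.
  move=> l l0; exists (Num.truncn l^-1) => n ln x y.
  rewrite !fE -rmorphB/= rnorm_RtoC.
  apply: bump_variation => [||a k [_ /= ->] _]; first exact: W0.
    by rewrite mulr_ge0 ?mdist_ge0 ?ltW.
  rewrite ler_wpM2r ?mdist_ge0// invf_ple ?posrE//.
  apply/ltW/(lt_le_trans (truncnS_gt _)); by rewrite ler_nat.
have := bVL f vlf => /cvg_rnorm/(_ _ e0)[n _ /(_ n (leqnn n))] /=.
rewrite sub0r rnormN; apply/negP; rewrite -leNgt.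
have [sAB /le_trans] := hAB n; apply.
rewrite -rnormN -(@commutator_corner b (f n)).
- by rewrite (le_trans (rnorm_projr _ _ _))// rnorm_projl.
- by move=> x Ax; rewrite fE (bump_center (l := n.+1%:R^-1) (@W0 n)).
- move=> x Bx; rewrite fE bump_eq0//; first exact: W0.
  move=> a k [/= Aa ->]; rewrite mulrC ler_pdivlMr// mul1r metric_sym ltW//.
  exact: sAB.
Qed.

End QuasiLocal.

(** * Commutators with functions of small variation *)

Section Commutators.
Variables (R : realType) (p : \bar R) (hp : ((p == 0) || (1 <= p))%E).
Variables (X : metricType R) (E : normedModType R[i]).
Hypothesis bg : bounded_geometry X.
Local Notation L := (lspace hp X E).
Local Notation BL := (bop L).
Local Notation proj := (proj hp E bg).
Local Notation mulR := (mulR hp E bg).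
Local Notation mulop := (mulop hp E).
Implicit Types (a b c : BL) (A B F : set X) (v : L).

Lemma commutatorDr b a c : commutator b (a + c) = commutator b a + commutator b c.
Proof. by rewrite /commutator mulrDr mulrDl opprD addrACA. Qed.

Lemma commutator0r b : commutator b 0 = 0.
Proof. by rewrite /commutator mulr0 mul0r subrr. Qed.

Lemma commutatorZr b (l : R[i]) a : commutator b (l *: a) = l *: commutator b a.
Proof.
apply: bop_ext => v; rewrite /commutator !bopBE bopZE !bopBE !bopME bopZE.
by rewrite linearZ scalerBr.
Qed.

Lemma commutator_sumr b (I : Type) (s : seq I) (F : I -> BL) :
  commutator b (\sum_(i <- s) F i) = \sum_(i <- s) commutator b (F i).
Proof.
elim: s => [|i s ih]; first by rewrite !big_nil commutator0r.
by rewrite !big_cons commutatorDr ih.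
Qed.

Lemma rnorm_commutator b a : rnorm (commutator b a) <= 2 * (rnorm b * rnorm a).
Proof.
rewrite (le_trans (ler_rnormB _ _))// mulr_natl mulr2n lerD ?rnorm_bopM//.
by rewrite mulrC rnorm_bopM.
Qed.

Lemma rnorm_block_sum (n : nat) (P Q : nat -> set X) (T : nat -> BL) (C : R) :
  0 <= C -> (forall i, rnorm (T i) <= C) -> trivIset setT P -> trivIset setT Q ->
  rnorm (\sum_(i < n) proj (P i) * T i * proj (Q i)) <= C.
Proof.
move=> C0 hT tP tQ; apply/rnorm_bop_leP => // v.
apply/rnorm_lspace_leP; first by rewrite mulr_ge0 ?rnorm_ge0.
pose kappa x := find (fun i => x \in P i) (iota 0 n).
apply: (@block_le _ _ _ _ _ bg _ kappa Q (fun i => if (i < n)%N then T i else 0)).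
- by [].
- by move=> i; case: ifP; rewrite ?rnorm0.
- by [].
move=> x; rewrite bop_sumE.
have -> : (\sum_(i < n) (proj (P i) * T i * proj (Q i)) v) x =
    \sum_(i < n) (if x \in P i then T i (proj (Q i) v) x else 0).
  rewrite (big_morph (fun u : L => u x) (op1 := +%R) (id1 := 0))//.
  by apply: eq_bigr => i _; rewrite !bopME projE.
have [h|/hasPn h] := boolP (has (fun i => x \in P i) (iota 0 n)); last first.
  rewrite /kappa hasNfind; last exact/hasPn.
  rewrite size_iota ltnn big1// => i _; rewrite ifN//.
  by apply: h; rewrite mem_iota/=.
have kn : (kappa x < n)%N by move: h; rewrite has_find size_iota.
have kP : x \in P (kappa x).
  by have := nth_find 0%N h; rewrite nth_iota.
rewrite kn (bigD1 (Ordinal kn))//= kP big1 ?addr0// => i ik.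
case: ifPn => // xi; case/eqP: ik; apply/val_inj/(tP _ _ I I) => /=.
by exists x; split; rewrite -in_setE.
Qed.

(** For a function [k] with integer values, the commutator with [b] is the sum
of the commutators with the upper level sets.  Each of these is carried by
pairs of points on either side of the level; the pairs of points of consecutive
levels contribute two block sums, and all the others see only corners of [b]
between sets with levels at least 2 apart. *)
Lemma rnorm_commutator_levels b (k : X -> nat) (N : nat) (eta : R) :
  0 <= eta -> (forall x, (k x <= N)%N) ->
  (forall A B, (forall x y, A x -> B y -> (k x + 1 < k y)%N) ->
     rnorm (proj A * b * proj B) <= eta /\ rnorm (proj B * b * proj A) <= eta) ->
  rnorm (commutator b (mulR (fun x => (k x)%:R))) <=
    2 * rnorm b + N%:R * (4 * eta).
Proof.
move=> eta0 kN hb.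
pose U i := [set x | (i < k x)%N]; pose P i := [set x | k x = i].
have kE : mulR (fun x => (k x)%:R) = \sum_(i < N) proj (U i).
  apply: bop_ext => v; apply: lspace_ext => x; rewrite mulRE; last first.
    by exists N%:R => y; rewrite ger0_norm ?ler_nat.
  rewrite bop_sumE (big_morph (fun u : L => u x) (op1 := +%R) (id1 := 0))//.
  have UE i : (x \in U i) = (i < k x)%N by apply/idP/idP; rewrite inE.
  under eq_bigr do rewrite projE UE.
  rewrite -big_mkcond/= sumr_const rmorph_nat scaler_nat; congr (_ *+ _).
  by rewrite -sum1_card -(big_ord_widen N (fun=> 1%N) (kN x)) sum1_card card_ord.
have cU i : commutator b (proj (U i)) =
    (proj (P i) * b * proj (P i.+1) - proj (P i.+1) * b * proj (P i))
    + ((proj (P i) * b * proj (U i.+1) + proj (~` U i `\` P i) * b * proj (U i))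
    - (proj (U i.+1) * b * proj (P i) + proj (U i) * b * proj (~` U i `\` P i))).
  have UE : proj (U i) = proj (P i.+1) + proj (U i.+1).
    rewrite (projID _ _ _ (U i) (P i.+1)); congr (proj _ + proj _).
      by apply/seteqP; split => x /=; rewrite /U /P/=; lia.
    by apply/seteqP; split => x /=; rewrite /U /P/=; lia.
  have CE : proj (~` U i) = proj (P i) + proj (~` U i `\` P i).
    rewrite (projID _ _ _ (~` U i) (P i)); congr (proj _ + _).
    by apply/seteqP; split => x /=; rewrite /U /P/=; lia.
  have -> : commutator b (proj (U i)) =
      proj (~` U i) * b * proj (U i) - proj (U i) * b * proj (~` U i).
    by rewrite projC !(mulrBl, mulrBr, mulr1, mul1r) opprB addrA subrK.
  rewrite CE [in X in X - _]mulrDl [in X in X - _]mulrDl [in X in _ - X]mulrDr.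
  rewrite {1}UE {2}UE.
  rewrite [in X in X - _]mulrDr [in X in _ - X]mulrDl [in X in _ - X]mulrDl.
  by rewrite -[X in X - _]addrA -[X in _ - X]addrA opprD addrACA.
rewrite kE commutator_sumr; under eq_bigr do rewrite cU.
rewrite big_split/=.
rewrite sumrB; apply: le_trans (ler_rnormD _ _) _; apply: lerD.
  rewrite mulr_natl mulr2n; apply: le_trans (ler_rnormB _ _) _.
  have tP : trivIset setT P by move=> i j _ _ [x [/= <- <-]].
  have tP1 : trivIset setT (fun i => P i.+1) by move=> i j _ _ [x []]; rewrite /P/= => -> [].
  apply: lerD.
    exact: (@rnorm_block_sum N P (fun i => P i.+1) (fun=> b) _ (rnorm_ge0 b)).
  exact: (@rnorm_block_sum N (fun i => P i.+1) P (fun=> b) _ (rnorm_ge0 b)).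
apply: le_trans (ler_rnorm_sum _ _ _) _.
rewrite -[X in X%:R]card_ord -sumr_const mulr_suml.
apply: ler_sum => i _; rewrite mul1r.
have [h1 h2] : rnorm (proj (P i) * b * proj (U i.+1)) <= eta /\
    rnorm (proj (U i.+1) * b * proj (P i)) <= eta.
  by apply: hb => x y; rewrite /U /P/=; lia.
have [h3 h4] : rnorm (proj (~` U i `\` P i) * b * proj (U i)) <= eta /\
    rnorm (proj (U i) * b * proj (~` U i `\` P i)) <= eta.
  by apply: hb => x y; rewrite /U /P/=; lia.
apply: le_trans (ler_rnormB _ _) _.
have := ler_rnormD (proj (P i) * b * proj (U i.+1)) (proj (~` U i `\` P i) * b * proj (U i)).
have := ler_rnormD (proj (U i.+1) * b * proj (P i)) (proj (U i) * b * proj (~` U i `\` P i)).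
lra.
Qed.

Lemma proj_commute A (f : Cb X) : proj A * mulop f = mulop f * proj A.
Proof.
apply: bop_ext => v; apply: lspace_ext => x.
rewrite !bopME projE !(mulopE f) projE.
by case: ifP => _; rewrite ?scaler0.
Qed.

Lemma commutator_cut b (f : Cb X) A :
  proj A * commutator b (mulop f) * proj A =
  commutator (proj A * b * proj A) (mulop f).
Proof.
rewrite /commutator mulrBr mulrBl -!mulrA -[in LHS]proj_commute !mulrA.
by rewrite proj_commute.
Qed.

(** The function [f] is rounded down to a multiple of [1 / N], at the cost of
[2 * rnorm b / N]; the rounded function is [1 / N] times a function with integer
values.  Points of [Y] with levels at least 2 apart have values more than
[1 / N] apart, hence are at distance more than [r]. *)
Lemma commutator_mulR_small b (f : X -> R) (N : nat) (Y : set X) (r eta : R) :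
  (0 < N)%N -> 0 <= eta -> (forall x, 0 <= f x <= 1) ->
  (forall x y, Y x -> Y y -> mdist x y <= r -> `|f x - f y| <= N%:R^-1) ->
  (forall A B, separated_by r A B -> rnorm (proj A * b * proj B) <= eta) ->
  rnorm (commutator (proj Y * b * proj Y) (mulR f)) <=
    4 * rnorm b / N%:R + 4 * eta.
Proof.
move=> N0 eta0 f01 fY hb; set c := proj Y * b * proj Y.
have NR0 : 0 < N%:R :> R by rewrite ltr0n.
have cb : rnorm c <= rnorm b by rewrite (le_trans (rnorm_projr _ _ _))// rnorm_projl.
pose k x := Num.truncn (N%:R * f x).
have kle x : (k x)%:R <= N%:R * f x < (k x)%:R + 1.
  rewrite natr1; apply: truncn_itv; rewrite mulr_ge0 ?ler0n//.
  by case/andP: (f01 x).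
have kN x : (k x <= N)%N.
  rewrite -(ler_nat R); case/andP: (kle x) => /le_trans + _; apply.
  by rewrite ler_piMr ?ler0n//; case/andP: (f01 x).
pose h x := N%:R * f x - (k x)%:R.
have h1 x : `|h x| <= 1.
  by rewrite /h ger0_norm; have := kle x; [|move=> /andP[]]; lra.
have fE : mulR f = (N%:R^-1)%:C%C *: (mulR h + mulR (fun x => (k x)%:R)).
  apply: bop_ext => v; apply: lspace_ext => x.
  rewrite bopZE -[RHS]/((N%:R^-1)%:C%C *: (mulR h v x + mulR (fun x => (k x)%:R) v x)).
  rewrite !mulRE; last 3 first.
  - by exists N%:R => y; rewrite ger0_norm ?ler_nat.
  - by exists 1.
  - by exists 1 => y; case/andP: (f01 y) => ? ?; rewrite ger0_norm.
  rewrite -scalerDl scalerA -rmorphD -rmorphM /h subrK.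
  by rewrite mulrA mulVf ?mul1r// gt_eqF.
rewrite fE commutatorZr commutatorDr.
have lev : rnorm (commutator c (mulR (fun x => (k x)%:R))) <=
    2 * rnorm c + N%:R * (4 * eta).
  apply: rnorm_commutator_levels => // A B AB.
  have sAB x y : (A `&` Y) x -> (Y `&` B) y -> r < mdist x y.
    move=> [Ax Yx] [Yy By]; rewrite ltNge; apply/negP => /(fY _ _ Yx Yy).
    have : (k x)%:R + 2 <= (k y)%:R :> R.
      by rewrite -natrD ler_nat; have := AB _ _ Ax By; lia.
    have := kle x; have := kle y; move=> /andP[y1 y2] /andP[x1 x2] k2.
    rewrite ler_distlC => /andP[_]; rewrite -(ler_pM2l NR0) mulrDr mulfV ?gt_eqF//.
    lra.
  have cE A' B' : proj A' * c * proj B' = proj (A' `&` Y) * b * proj (Y `&` B').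
    by rewrite /c -!projM !mulrA.
  rewrite !cE; split; apply: hb => //.
  by move=> x y [Yx Bx] [Ay Yy]; rewrite metric_sym; apply: sAB; split.
have hh : rnorm (commutator c (mulR h)) <= 2 * rnorm c.
  rewrite (le_trans (rnorm_commutator _ _))// ler_wpM2l//.
  by rewrite -[leRHS]mulr1 ler_wpM2l ?rnorm_ge0// rnorm_mulR_le.
rewrite (@rnormZ R BL (N%:R^-1)%:C%C) rnorm_RtoC ger0_norm ?invr_ge0 ?ler0n//.
rewrite mulrC ler_pdivrMr// mulrDl divfK ?gt_eqF//.
by apply: le_trans (ler_rnormD _ _) _; lra.
Qed.

End Commutators.

Lemma corner_decomposition (T : pzRingType) (a q c : T) :
  c - (a * c * q + q * c * a - a * c * a) =
  a * c * (1 - q) + (1 - q) * c * a + (1 - a) * c * (1 - a).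
Proof.
have zm (V : zmodType) (x y z w k u : V) :
    k - (y + w - u) = x - y + (z - w) + (k - x - (z - u)).
  rewrite !opprB !opprD !addrA.
  by rewrite [RHS](ACl (1*6*3*8*5*7*2*4))/= subrr add0r subrr add0r.
rewrite (zm _ (a * c) _ (c * a)).
by rewrite !(mulrBl, mulrBr, mul1r, mulr1).
Qed.

Lemma Re_le_rnorm (R : realType) (z : R[i]^o) : `|complex.Re z| <= rnorm z.
Proof.
case: z => a b /=; rewrite /rnorm normc_def /= -sqrtr_sqr.
by rewrite ler_wsqrtr// lerDl sqr_ge0.
Qed.

Lemma Im_le_rnorm (R : realType) (z : R[i]^o) : `|complex.Im z| <= rnorm z.
Proof.
case: z => a b /=; rewrite /rnorm normc_def /= -sqrtr_sqr.
by rewrite ler_wsqrtr// lerDr sqr_ge0.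
Qed.

Section QuasiLocalCommutators.
Variables (R : realType) (p : \bar R) (hp : ((p == 0) || (1 <= p))%E).
Variables (X : metricType R) (E : normedModType R[i]).
Hypothesis bg : bounded_geometry X.
Local Notation L := (lspace hp X E).
Local Notation BL := (bop L).
Local Notation proj := (proj hp E bg).
Local Notation mulR := (mulR hp E bg).
Local Notation mulop := (mulop hp E).
Implicit Types (a b c : BL) (A F : set X) (v : L).

(** The real and imaginary parts of [f] are brought to values in [0, 1] by an
affine map, which changes commutators by a scalar factor only. *)
Lemma commutator_small b (C e : R) :
  quasi_local_sets bg b -> 0 < C -> 0 < e ->
  exists r d : R, [/\ 0 <= r, 0 < d & forall (Y : set X) (f : Cb X),
    (forall x, rnorm (f x) <= C) ->
    (forall x y, Y x -> Y y -> mdist x y <= r -> rnorm (f x - f y) <= d) ->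
    rnorm (proj Y * commutator b (mulop f) * proj Y) <= e].
Proof.
move=> bql C0 e0.
(* [eta] and [N] make each of the two terms of the bound for one real function
   at most [e / (8 * C)] *)
pose eta := e / (32 * C); have eta0 : 0 < eta by rewrite divr_gt0 ?mulr_gt0.
have [r r0 hr] := bql _ eta0.
pose N := (Num.truncn (32 * C * rnorm b / e)).+1.
have NR0 : 0 < N%:R :> R by rewrite ltr0n.
have hN : 32 * C * rnorm b / e <= N%:R by rewrite ltW// truncnS_gt.
have CC0 : 0 < 2 * C by rewrite mulr_gt0.
exists r, (2 * C / N%:R); split => //; first by rewrite divr_gt0.
move=> Y f fC fY.
pose u1 x := (complex.Re (f x) + C) / (2 * C).
pose u2 x := (complex.Im (f x) + C) / (2 * C).
have u1b x : 0 <= u1 x <= 1.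
  have /ler_normlP[] := le_trans (Re_le_rnorm (f x)) (fC x) => ? ?.
  by rewrite /u1 divr_ge0 ?(ltW CC0)//= ?ler_pdivrMr//; lra.
have u2b x : 0 <= u2 x <= 1.
  have /ler_normlP[] := le_trans (Im_le_rnorm (f x)) (fC x) => ? ?.
  by rewrite /u2 divr_ge0 ?(ltW CC0)//= ?ler_pdivrMr//; lra.
have fE : mulop f = (2 * C)%:C%C *: mulR u1 + ((2 * C)%:C%C * 'i%C) *: mulR u2
    - (C%:C%C * (1 + 'i%C)) *: (1 : BL).
  apply: bop_ext => v; apply: lspace_ext => x.
  rewrite bopBE bopDE !bopZE mulopE.
  rewrite -[RHS]/((2 * C)%:C%C *: mulR u1 v x + ((2 * C)%:C%C * 'i%C) *: mulR u2 v x
    - (C%:C%C * (1 + 'i%C)) *: v x).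
  rewrite !mulRE; last 2 first.
  - by exists 1 => y; case/andP: (u2b y) => ? ?; rewrite ger0_norm.
  - by exists 1 => y; case/andP: (u1b y) => ? ?; rewrite ger0_norm.
  rewrite !scalerA -scalerDl -scalerBl; congr (_ *: _).
  rewrite /u1 /u2; case: (f x) => s t /=; apply/eqP; rewrite eq_complex /=.
  by apply/andP; split; apply/eqP; field; rewrite gt_eqF.
have small (u : X -> R) : (forall x, 0 <= u x <= 1) ->
    (forall x y, `|u x - u y| <= rnorm (f x - f y) / (2 * C)) ->
    rnorm (commutator (proj Y * b * proj Y) (mulR u)) <= e / (4 * C).
  move=> u01 uf; apply: le_trans (@commutator_mulR_small _ _ _ _ _ bg b u N Y r eta _ _ u01 _ _) _.
  - by [].
  - exact: ltW.
  - move=> x y Yx Yy xy; apply: le_trans (uf _ _) _.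
    by rewrite ler_pdivrMr// mulrC; exact: fY.
  - by move=> A B /hr/ltW.
  have -> : e / (4 * C) = e / (8 * C) + e / (8 * C) by field; rewrite gt_eqF.
  rewrite lerD//; last by rewrite /eta le_eqVlt; apply/orP; left; apply/eqP; field; rewrite gt_eqF.
  rewrite ler_pdivrMr// mulrAC ler_pdivlMr ?mulr_gt0//.
  by move: hN; rewrite ler_pdivrMr//; lra.
have RB (x y : X) : `|u1 x - u1 y| <= rnorm (f x - f y) / (2 * C).
  rewrite /u1 -mulrBl normrM [X in _ * X]ger0_norm ?invr_ge0 ?(ltW CC0)//.
  rewrite ler_wpM2r ?invr_ge0 ?(ltW CC0)//.
  have -> : complex.Re (f x) + C - (complex.Re (f y) + C) = complex.Re (f x - f y).
    by case: (f x) (f y) => ? ? [? ?] /=; ring.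
  exact: Re_le_rnorm.
have IB (x y : X) : `|u2 x - u2 y| <= rnorm (f x - f y) / (2 * C).
  rewrite /u2 -mulrBl normrM [X in _ * X]ger0_norm ?invr_ge0 ?(ltW CC0)//.
  rewrite ler_wpM2r ?invr_ge0 ?(ltW CC0)//.
  have -> : complex.Im (f x) + C - (complex.Im (f y) + C) = complex.Im (f x - f y).
    by case: (f x) (f y) => ? ? [? ?] /=; ring.
  exact: Im_le_rnorm.
have := small _ u1b RB; have := small _ u2b IB.
rewrite commutator_cut; move: (proj Y * b * proj Y) => c s2 s1.
have -> : commutator c (mulop f) = (2 * C)%:C%C *: commutator c (mulR u1) +
    ((2 * C)%:C%C * 'i%C) *: commutator c (mulR u2).
  rewrite fE commutatorDr commutatorDr !commutatorZr -scaleNr commutatorZr.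
  by rewrite {3}/commutator mulr1 mul1r subrr scaler0 addr0.
apply: le_trans (ler_rnormD _ _) _.
rewrite (@rnormZ R BL (2 * C)%:C%C) (@rnormZ R BL ((2 * C)%:C%C * 'i%C)).
rewrite (@rnormZ R (R[i]^o) (2 * C)%:C%C 'i%C) rnorm_RtoC ger0_norm ?(ltW CC0)//.
have -> : rnorm ('i%C : R[i]^o) = 1.
  by rewrite /rnorm normc_def /= expr0n/= add0r expr1n sqrtr1.
have -> : e = 2 * C * (e / (4 * C)) + 2 * C * 1 * (e / (4 * C)).
  by field; rewrite gt_eqF.
by rewrite lerD// ler_wpM2l// ?mulr1 (ltW CC0).
Qed.

(** A function with a small Lipschitz constant varies little on the scale at
which [b] is quasi-local. *)
Lemma quasi_local_VL b : quasi_local_sets bg b -> commutes_with_VL b.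
Proof.
move=> bql f [/bounded_fun_rnorm[M hM] vl]; apply/cvg_rnorm => e e0.
pose C := Num.max 1 M; have C0 : 0 < C by rewrite lt_max ltr01.
have e2 : 0 < e / 2 by rewrite divr_gt0.
have [r [d [r0 d0 h]]] := commutator_small bql C0 e2.
have [n0 hn0] := vl (d / (r + 1)) (divr_gt0 d0 (ltr_wpDl r0 ltr01)).
exists n0 => // n /= n0n; rewrite sub0r rnormN.
have := h setT (f n); rewrite projT mul1r mulr1 => hf.
apply: le_lt_trans (hf _ _) _.
- by apply/Cb_norm_leP; [exact: ltW|rewrite (le_trans (hM n))// le_max lexx orbT].
- move=> x y _ _ xy; apply: le_trans (hn0 n n0n x y) _.
  rewrite mulrAC ler_pdivrMr ?ltr_wpDl// ler_pM2l//.
  by rewrite (le_trans xy)// lerDl.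
- by lra.
Qed.

Lemma compact_thickening (r : R) A : compact A ->
  exists F, [/\ compact F, A `<=` F, separated_by r A (~` F) &
    separated_by r (~` F) A].
Proof.
have [->|/set0P[x0 Ax0] cA] := eqVneq A set0.
  by exists set0; split => //; exact: compact0.
have [rho hrho] := compact_ball bg x0 cA.
have sep : separated_by r A (~` [set y | mdist x0 y <= rho + `|r|]).
  move=> x y /hrho xx0 /= /negP; rewrite -ltNge => y0.
  have := metric_triangle x0 x y; have := ler_norm r; lra.
exists [set y | mdist x0 y <= rho + `|r|]; split => //.
- exact: mdist_ball_compact.
- by move=> y /hrho /= /le_trans; apply; rewrite lerDl.
- by move=> y x Fy Ax; rewrite metric_sym; exact: sep.
Qed.

Lemma indic_C0 F : compact F -> C0 X (CbR bg (\1_F)).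
Proof.
move=> cF e e0; exists F => // x Fx; rewrite CbRE; last exact: indic_bounded.
by rewrite indicE memNset// rnorm_RtoC normr0.
Qed.

Section Subalgebra.
Variable B : set BL.
Hypothesis Balg : banach_subalgebra B.
Hypothesis Bmod : two_sided_products setT B = B.

Lemma subalgebraD a c : B a -> B c -> B (a + c).
Proof. by case: Balg => _ + _ _ => h Ba Bc; rewrite -(scale1r a); exact: h. Qed.

Lemma subalgebraN a : B a -> B (- a).
Proof. by case: Balg => + + _ _ => B0 h Ba; rewrite -scaleN1r -[X in B X]addr0; exact: h. Qed.

Lemma subalgebra_sum (I : Type) (s : seq I) (F : I -> BL) :
  (forall i, B (F i)) -> B (\sum_(i <- s) F i).
Proof.
move=> h; elim/big_rec: _ => [|i x _ Bx]; first by case: Balg.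
exact: subalgebraD.
Qed.

Lemma subalgebra_module (f g : Cb X) a : B a -> B (mulop f * a * mulop g).
Proof. by move=> Ba; rewrite -Bmod; exists f, a, g. Qed.

Lemma subalgebra_modulel (f : Cb X) a : B a -> B (mulop f * a).
Proof.
move=> Ba; rewrite -[X in B X]mulr1 -(projT hp E bg).
exact: subalgebra_module.
Qed.

Lemma subalgebra_moduler (f : Cb X) a : B a -> B (a * mulop f).
Proof.
move=> Ba; rewrite -[X in B (X * _)]mul1r -(projT hp E bg).
exact: subalgebra_module.
Qed.

(** Outside of a compact set [A] the function [g] varies little on the scale at
which [b] is quasi-local, so the part of the commutator carried by the complement
of [A] is small.  By quasi-locality again, the remaining rows and columns may be
cut down to a compact neighbourhood [F] of [A]. *)
Lemma quasi_local_higson b : B b -> quasi_local_sets bg b ->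
  higson_commutators_compact B b.
Proof.
move=> Bb bql g hg; apply/closure_rnorm => e e0.
set c := commutator b (mulop g).
have Bc : B c.
  by apply: subalgebraD; [|apply: subalgebraN]; [exact: subalgebra_moduler|exact: subalgebra_modulel].
pose C := rnorm g + 1; have C0 : 0 < C by rewrite ltr_wpDl ?rnorm_ge0.
have gC x : rnorm (g x) <= C.
  by move: x; apply/Cb_norm_leP; [exact: ltW|rewrite lerDl].
have e4 : 0 < e / 4 by rewrite divr_gt0.
have [r [d [r0 d0 hc]]] := commutator_small bql C0 e4.
have r10 : 0 < r + 1 by rewrite ltr_wpDl.
have [A cA hA] := hg _ _ r10 d0.
have eC : 0 < e / (8 * C) by rewrite divr_gt0 ?mulr_gt0.
have [r' _ hr'] := bql _ eC.
have [F [cF AF AFs FAs]] := compact_thickening r' cA.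
pose t := proj A * c * proj F + proj F * c * proj A - proj A * c * proj A.
have Bt : B t.
  by apply: subalgebraD; [apply: subalgebraD|apply: subalgebraN]; exact: subalgebra_module.
have gnorm : rnorm (mulop g) <= C by exact: rnorm_mulop_le (ltW C0) gC.
have corner A' B' : separated_by r' A' B' ->
    rnorm (proj A' * c * proj B') <= e / 4.
  move=> /hr' h; have -> : proj A' * c * proj B' =
      (proj A' * b * proj B') * mulop g - mulop g * (proj A' * b * proj B').
    rewrite /c /commutator mulrBr mulrBl; congr (_ - _).
      by rewrite -!mulrA proj_commute.
    by rewrite !mulrA proj_commute.
  have k : rnorm (proj A' * b * proj B') * rnorm (mulop g) <= e / 8.
    apply: le_trans (ler_pM (rnorm_ge0 _) (rnorm_ge0 _) (ltW h) gnorm) _.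
    by rewrite le_eqVlt; apply/orP; left; apply/eqP; field; rewrite gt_eqF.
  apply: le_trans (ler_rnormB _ _) _.
  have := rnorm_bopM (proj A' * b * proj B') (mulop g).
  have := rnorm_bopM (mulop g) (proj A' * b * proj B').
  rewrite (mulrC (rnorm (mulop g))); lra.
exists t; last first.
  rewrite /t corner_decomposition -!projC.
  apply: le_lt_trans (ler_rnormD _ _) _.
  have := ler_rnormD (proj A * c * proj (~` F)) (proj (~` F) * c * proj A).
  have := corner _ _ AFs; have := corner _ _ FAs.
  have := hc (~` A) g gC _; rewrite -/c => hcA.
  have : rnorm (proj (~` A) * c * proj (~` A)) <= e / 4.
    by apply: hcA => x y Ax Ay xy; apply/ltW/hA => //; rewrite (le_lt_trans xy)// ltrDl.
  lra.
exists (CbR bg (\1_F)), t, (CbR bg (\1_F)).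
split; [exact: indic_C0|by []|exact: indic_C0|].
rewrite -[mulop _]/(proj F) /t !(mulrBr, mulrDr, mulrBl, mulrDl).
have FA : proj F * proj A = proj A by rewrite projM (setIidr AF).
have AF' : proj A * proj F = proj A by rewrite projM (setIidl AF).
by rewrite !mulrA !FA projM setIid -!mulrA !AF' projM setIid.
Qed.

End Subalgebra.
End QuasiLocalCommutators.

(** * Higson functions *)

Section HigsonQuasiLocal.
Variables (R : realType) (p : \bar R) (hp : ((p == 0) || (1 <= p))%E).
Variables (X : metricType R) (E : normedModType R[i]).
Hypothesis bg : bounded_geometry X.
Local Notation L := (lspace hp X E).
Local Notation BL := (bop L).
Local Notation proj := (proj hp E bg).
Local Notation mulop := (mulop hp E).
Implicit Types (a b c t : BL) (A F : set X) (v : L).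

(** Functions of [C0 X] are small off a compact set. *)
Lemma compact_ideal_decay (B : set BL) t (e : R) : compact_ideal B t -> 0 < e ->
  exists2 F, compact F & forall A, A `&` F = set0 ->
    rnorm (proj A * t) < e /\ rnorm (t * proj A) < e.
Proof.
move=> /closure_rnorm h e0; have e2 : 0 < e / 2 by rewrite divr_gt0.
have [_ [f [a [g [f0 _ g0 ->]]]] ht] := h _ e2.
have pos (V : normedModType R[i]) (u : V) : 0 < rnorm u + 1.
  by rewrite ltr_wpDl ?rnorm_ge0.
pose K := (rnorm f + 1 + (rnorm g + 1)) * (rnorm a + 1).
have K0 : 0 < K by rewrite mulr_gt0 ?pos// addr_gt0 ?pos.
have eK : 0 < e / 2 / K by rewrite divr_gt0.
have [[A1 cA1 hA1] [A2 cA2 hA2]] := (f0 _ eK, g0 _ eK).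
have bnd (u : Cb X) : rnorm (mulop u) <= rnorm u.
  by apply: rnorm_mulop_le (rnorm_ge0 _) _; apply/Cb_norm_leP => //; rewrite rnorm_ge0.
have out (u : Cb X) A A0 : (forall x, ~ A0 x -> rnorm (u x) < e / 2 / K) ->
    A `&` A0 = set0 -> rnorm (proj A * mulop u) <= e / 2 / K.
  move=> hu AA; apply/rnorm_bop_leP => [|v]; first exact: ltW.
  apply: rnorm_lspace_scale => [|x]; first exact: ltW.
  rewrite bopME projE (mulopE u); case: ifPn => [|_].
    rewrite inE => Ax; rewrite rnormZ ler_wpM2r ?rnorm_ge0// ltW// hu// => A0x.
    by have : (A `&` A0) x by []; rewrite AA.
  by rewrite rnorm0 mulr_ge0 ?rnorm_ge0// ltW.
exists (A1 `|` A2); first exact: compactU.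
move=> A; rewrite setIUr setU_eq0 => -[AA1 AA2].
have key (x y z : R) : 0 <= x -> 0 <= y -> 0 <= z -> x <= e / 2 / K ->
    y <= rnorm a -> z <= rnorm f + 1 + (rnorm g + 1) -> x * (y * z) <= e / 2.
  move=> x0 y0 z0 xe ya zC; rewrite -[leRHS](@divfK _ K) ?gt_eqF//.
  rewrite ler_pM ?mulr_ge0// /K mulrC ler_pM// (le_trans ya)// lerDl//.
split.
  have -> : proj A * t = proj A * (t - mulop f * a * mulop g) + proj A * mulop f * (a * mulop g).
    by rewrite mulrBr !mulrA subrK.
  rewrite (le_lt_trans (ler_rnormD _ _))// (splitr e) ltr_leD//.
    by rewrite (le_lt_trans (rnorm_projl _ _ _))//.
  apply: le_trans (rnorm_bopM _ _) _.
  apply: le_trans (ler_wpM2l (rnorm_ge0 _) (rnorm_bopM _ _)) _.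
  apply: key; rewrite ?rnorm_ge0//; first exact: out AA1.
  by rewrite (le_trans (bnd g))//; have := rnorm_ge0 f; lra.
have -> : t * proj A = (t - mulop f * a * mulop g) * proj A + mulop f * a * (proj A * mulop g).
  by rewrite proj_commute mulrBl !mulrA subrK.
rewrite (le_lt_trans (ler_rnormD _ _))// (splitr e) ltr_leD//.
  by rewrite (le_lt_trans (rnorm_projr _ _ _))//.
apply: le_trans (rnorm_bopM _ _) _; rewrite mulrC.
apply: le_trans (ler_wpM2l (rnorm_ge0 _) (rnorm_bopM _ _)) _.
rewrite [X in _ * X]mulrC.
apply: key; rewrite ?rnorm_ge0//; first exact: out AA2.
by rewrite (le_trans (bnd f))//; have := rnorm_ge0 g; lra.
Qed.

Lemma C0_higson (g : Cb X) : C0 X g -> higson X g.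
Proof.
move=> g0 r e _ e0; have e2 : 0 < e / 2 by rewrite divr_gt0.
have [A cA hA] := g0 _ e2; exists A => // x y Ax Ay _.
by rewrite (le_lt_trans (ler_rnormB _ _))// (splitr e) ltrD ?hA.
Qed.

(** The indicator function of a compact set is a Higson function, and its
commutator with [b] contains the rows and columns of [b] through that set. *)
Lemma higson_corner_decay (B : set BL) b F (e : R) :
  higson_commutators_compact B b -> compact F -> 0 < e ->
  exists F', [/\ compact F', F `<=` F' & forall A, A `&` F' = set0 ->
    rnorm (proj F * b * proj A) < e /\ rnorm (proj A * b * proj F) < e].
Proof.
move=> bh cF e0; have := bh _ (C0_higson (indic_C0 bg cF)).
move=> /compact_ideal_decay - /(_ _ e0)[F1 cF1 hF1].
exists (F `|` F1); split; [exact: compactU|by left|].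
move=> A; rewrite setIUr setU_eq0 => -[AF AF1].
have [h1 h2] := hF1 _ AF1.
have fF x : F x -> CbR bg (\1_F) x = 1.
  by move=> Fx; rewrite CbRE ?indicE ?mem_set//; exact: indic_bounded.
have fA x : A x -> CbR bg (\1_F) x = 0.
  move=> Ax; rewrite CbRE ?indicE ?memNset//; last exact: indic_bounded.
  by move=> Fx; have : (A `&` F) x by []; rewrite AF.
split.
  rewrite -rnormN -(@commutator_corner _ _ _ _ _ bg b (CbR bg (\1_F)))//.
  by apply: le_lt_trans h2; rewrite -mulrA rnorm_projl.
have -> : proj A * b * proj F =
    proj A * commutator b (mulop (CbR bg (\1_F))) * proj F.
  rewrite /commutator mulrBr mulrBl -[mulop _]/(proj F) !mulrA.
  have -> : proj A * proj F = 0 by rewrite projM AF proj0.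
  by rewrite !mul0r subr0 -[RHS]mulrA projM setIid.
by apply: le_lt_trans h1; rewrite rnorm_projr.
Qed.

(** The large corners that witness a failure of quasi-locality can be chosen far
away and bounded.  Deleting the ball [F] of radius [rho] costs little: one of the
two sets misses a neighbourhood [F'] of [F], and rows and columns of [b] through
[F] vanish off [F'].  The set of rows may then be made finite, since norms of
vectors are approximated on finite sets, and after it the set of columns, since
finitely many rows vanish at infinity. *)
Lemma far_corner (B : set BL) b (e : R) (x0 : X) (rho : R) (n : nat) :
  higson_commutators_compact B b -> 0 < e ->
  (forall r : R, 0 <= r -> exists A A', separated_by r A A' /\
     e <= rnorm (proj A * b * proj A')) ->
  exists AAr : set X * set X * R,
    [/\ rho <= AAr.2,
        forall x, AAr.1.1 x \/ AAr.1.2 x -> rho < mdist x0 x <= AAr.2,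
        separated_by n%:R AAr.1.1 AAr.1.2 &
        e / 4 <= rnorm (proj AAr.1.1 * b * proj AAr.1.2)].
Proof.
move=> bh e0 nql; have e4 : 0 < e / 4 by rewrite divr_gt0.
pose F := [set x | mdist x0 x <= rho].
have [F' [cF' FF' hF']] := higson_corner_decay bh (@mdist_ball_compact _ _ bg x0 rho) e4.
have [r1 hr1] := compact_ball bg x0 cF'.
have [|A [A' [sA eA]]] := nql (n%:R + 2 * `|r1|).
  by rewrite addr_ge0 ?ler0n ?mulr_ge0.
have split3 : proj A * b * proj A' =
    proj (A `\` F) * b * proj (A' `\` F) + proj (A `&` F) * b * proj A' +
    proj (A `\` F) * b * proj (A' `&` F).
  rewrite {1}(projID _ _ _ A F) !mulrDl.
  rewrite [in X in _ + X](projID _ _ _ A' F) mulrDr addrA.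
  by rewrite [RHS](ACl (2*3*1)).
have AF'0 : A `&` F' = set0 \/ A' `&` F' = set0.
  apply: contrapT => /not_orP[/eqP/set0P[x [Ax Fx]] /eqP/set0P[y [Ay Fy]]].
  have := sA x y Ax Ay; apply/negP; rewrite -leNgt.
  apply: le_trans (metric_triangle x x0 y) _; rewrite (metric_sym x).
  have := hr1 x Fx; have := hr1 y Fy; have := ler_norm r1.
  have := ler0n R n; lra.
have eA2 : 3 * (e / 4) < rnorm (proj (A `\` F) * b * proj (A' `\` F)).
  have sub (S : set X) : S `&` F' = set0 -> S `&` F = set0.
    by move=> S0; rewrite -subset0 => x [Sx /FF' Fx]; rewrite -S0.
  have := ler_rnormD (proj (A `\` F) * b * proj (A' `\` F) + proj (A `&` F) * b * proj A')
    (proj (A `\` F) * b * proj (A' `&` F)).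
  have := ler_rnormD (proj (A `\` F) * b * proj (A' `\` F)) (proj (A `&` F) * b * proj A').
  rewrite -split3; move: eA.
  case: AF'0 => /[dup] /hF'[h1 h2] /sub ->.
    rewrite proj0 !mul0r rnorm0.
    have := @rnorm_cut_mono _ _ hp _ E bg (A `\` F) A (A' `&` F) F b (@subDsetl _ _ _) (@subIsetr _ _ _).
    lra.
  rewrite proj0 !mulr0 rnorm0.
  have := @rnorm_cut_mono _ _ hp _ E bg (A `&` F) F A' A' b (@subIsetr _ _ _) (@subset_refl _ _).
  lra.
have [v hv] := rnorm_bop_lt (mulr_ge0 (ler0n R 3) (ltW e4)) eA2.
have [s hs] : exists s : seq X, 3 * (e / 4) * rnorm v <
    rnorm (proj [set` s] ((proj (A `\` F) * b * proj (A' `\` F)) v)).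
  apply: contrapT => /forallNP h; move: hv; apply/negP; rewrite -leNgt.
  apply: rnorm_proj_exhaust => [|s]; first by rewrite !mulr_ge0 ?rnorm_ge0 ?ltW.
  by rewrite leNgt; apply/negP/h.
have fs : compact [set` s] by exact/finite_compact/finite_seq.
have [F2 [cF2 _ hF2]] := higson_corner_decay bh fs e4.
have [r2 hr2] := compact_ball bg x0 (compactU fs cF2).
pose A1 := [set` s] `&` (A `\` F); pose A2 := F2 `&` (A' `\` F).
exists (A1, A2, Num.max rho r2); split => /=.
- by rewrite le_max lexx.
- move=> x [[xs [_ /negP]]|[xF [_ /negP]]]; rewrite -ltNge => -> /=.
    by rewrite le_max hr2 ?orbT//; left.
  by rewrite le_max hr2 ?orbT//; right.
- apply: separated_by_le sA; first by rewrite lerDl mulr_ge0.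
    by move=> x [_ []].
  by move=> x [_ []].
- have : 3 * (e / 4) < rnorm (proj A1 * b * proj (A' `\` F)).
    rewrite ltNge; apply/negP => h; move: hs; apply/negP; rewrite -leNgt.
    have -> : proj [set` s] ((proj (A `\` F) * b * proj (A' `\` F)) v) =
        (proj A1 * b * proj (A' `\` F)) v by rewrite -bopME !mulrA projM.
    apply: le_trans (rnorm_app_le _ _) _.
    by rewrite ler_wpM2r ?rnorm_ge0.
  have : rnorm (proj A1 * b * proj ((A' `\` F) `\` F2)) < e / 4.
    have [|h _] := hF2 ((A' `\` F) `\` F2); first by rewrite setDE -setIA setICl setI0.
    by apply: le_lt_trans h; apply: rnorm_cut_mono => // x [].
  rewrite (projID _ _ _ (A' `\` F) F2) mulrDr [(A' `\` F) `&` F2]setIC -/A2.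
  have := ler_rnormD (proj A1 * b * proj A2) (proj A1 * b * proj (A' `\` F `\` F2)).
  lra.
Qed.

(** A gliding hump: far corners are chosen one after the other, the next one
beyond a ball that contains all the previous ones, with a margin.  The envelope
of cones of smaller and smaller slope around the row sets is a Higson function,
equal to 1 on the rows and to 0 on the columns of all these corners.  They all
appear in its commutator with [b], which therefore does not vanish at
infinity. *)
Lemma higson_quasi_local (B : set BL) b :
  higson_commutators_compact B b -> quasi_local_sets bg b.
Proof.
move=> bh e e0; apply: contrapT => nql0.
have nql r : 0 <= r -> exists A A', separated_by r A A' /\
     e <= rnorm (proj A * b * proj A').
  move=> r0; apply: contrapT => h; apply: nql0; exists r => // A A' sA.
  by rewrite ltNge; apply/negP => eA; apply: h; exists A, A'.
have [x0 _] : exists x0 : X, True.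
  have [A [A' [_ eA]]] := nql 0 (lexx 0).
  have [A0|/set0P[x0 _]] := eqVneq A set0; last by exists x0.
  by move: eA; rewrite A0 proj0 !mul0r rnorm0 leNgt e0.
have /choice[step hstep] (rn : R * nat) := far_corner x0 rn.1 rn.2 bh e0 nql.
(* the radius [rho k] encloses the first [k] corners *)
pose st := fix st k : set X * set X * R := if k is k'.+1
  then step ((st k').2 + k'.+1%:R, k'.+1) else (set0, set0, 0).
pose rho k := (st k).2; pose A k := (st k.+1).1.1; pose A' k := (st k.+1).1.2.
have rhoS k : rho k + k.+1%:R <= rho k.+1.
  by have [] := hstep (rho k + k.+1%:R, k.+1).
have rho_mono j k : (j <= k)%N -> rho j <= rho k.
  move: j k; apply: (@homo_leq _ rho (fun x y => x <= y)) => [x|y x z|i]; rewrite ?lexx//.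
    exact: le_trans.
  by rewrite (le_trans _ (rhoS i))// lerDl.
have rho_ge k : k%:R <= rho k.
  elim: k => [|k ih]; first exact: lexx.
  rewrite (le_trans _ (rhoS k))// lerDr; apply: le_trans ih.
  exact: ler0n.
have Ain k x : A k x \/ A' k x -> rho k + k.+1%:R < mdist x0 x <= rho k.+1.
  by have [_ h _ _] := hstep (rho k + k.+1%:R, k.+1); exact: h.
have Asep k : separated_by k.+1%:R (A k) (A' k).
  by have [] := hstep (rho k + k.+1%:R, k.+1).
have Anorm k : e / 4 <= rnorm (proj (A k) * b * proj (A' k)).
  by have [] := hstep (rho k + k.+1%:R, k.+1).
pose W : set (X * R) := [set al | exists2 k, A k al.1 & al.2 = k.+1%:R^-1].
have W0 (z : X) l : W (z, l) -> 0 <= l by move=> [k _ /= ->].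
have gb x : `|bump W x| <= 1 by exact: bump_norm_le1.
have gE x : CbR bg (bump W) x = (bump W x)%:C%C by rewrite CbRE//; exists 1.
have g1 k x : A k x -> CbR bg (bump W) x = 1.
  by move=> Ax; rewrite gE (bump_center W0 (l := k.+1%:R^-1))//; exists k.
have g0 k x : A' k x -> CbR bg (bump W) x = 0.
  move=> Ax; rewrite gE bump_eq0// => z l [j Az /= ->].
  rewrite mulrC ler_pdivlMr// mul1r ltW//.
  have [jk|kj|jk] := ltngtP j k.
  - have := Ain j z (or_introl Az); have := Ain k x (or_intror Ax).
    have := rho_mono _ _ jk; have := metric_triangle x0 z x.
    have : j.+1%:R <= k.+1%:R :> R by rewrite ler_nat ltnS ltnW.
    by rewrite (metric_sym z x) => ? ? ? /andP[? ?] /andP[? ?]; lra.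
  - have := Ain j z (or_introl Az); have := Ain k x (or_intror Ax).
    have := rho_mono _ _ kj; have := metric_triangle x0 x z.
    by move=> ? ? /andP[? ?] /andP[? ?]; lra.
  - by rewrite metric_sym; move: Az; rewrite jk => Az; exact: Asep.
have gh : higson X (CbR bg (bump W)).
  move=> r d r0 d0; pose K := Num.truncn (r / d).
  exists [set x | mdist x0 x <= rho K + K%:R]; first exact: mdist_ball_compact.
  have out j z x : (j < K)%N -> A j z -> ~ mdist x0 x <= rho K + K%:R ->
      1 <= j.+1%:R^-1 * mdist x z.
    move=> jK Az /negP; rewrite -ltNge => xK; rewrite mulrC ler_pdivlMr// mul1r.
    have := Ain j z (or_introl Az); have := rho_mono _ _ jK.
    have := metric_triangle x0 z x; rewrite (metric_sym z x).
    have : j.+1%:R <= K%:R :> R by rewrite ler_nat.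
    by move=> ? ? ? /andP[? ?]; lra.
  move=> x y Kx Ky xy; rewrite !gE -rmorphB/= rnorm_RtoC.
  apply: (@le_lt_trans _ _ (K.+1%:R^-1 * r)); last first.
    by rewrite mulrC ltr_pdivrMr// mulrC -ltr_pdivrMr// truncnS_gt.
  apply: bump_variation => //; first by rewrite mulr_ge0 ?ltW.
  move=> z l [j Az /= ->]; have [jK|Kj _] := ltnP j K.
    by case; rewrite ltNge (out j).
  by rewrite ler_pM ?mdist_ge0 ?(ltW xy)// lef_pV2 ?posrE// ler_nat.
have e4 : 0 < e / 4 by rewrite divr_gt0.
have [F cF hF] := compact_ideal_decay (bh _ gh) e4.
have [r2 hr2] := compact_ball bg x0 cF.
pose k := (Num.truncn r2).+1.
have [|+ _] := hF (A k).
  rewrite -subset0 => x [Ax /hr2]; have := Ain k x (or_introl Ax).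
  have := rho_ge k; have := truncnS_gt r2; have := ler0n R k.+1; rewrite -/k.
  by move=> ? ? ? /andP[? ?] ?; exfalso; lra.
apply/negP; rewrite -leNgt; apply: le_trans (Anorm k) _.
rewrite -rnormN -(@commutator_corner _ _ _ _ _ bg b (CbR bg (bump W)) _ _ (g1 k) (g0 k)).
by rewrite rnorm_projr.
Qed.

End HigsonQuasiLocal.

(** * Colourings by separated sets *)

Section Coloring.
Variables (R : realType) (X : metricType R).
Implicit Types (Y C : set X) (r : R).

Lemma maximal_separated_subset r Y : 0 <= r -> exists C,
  [/\ C `<=` Y, forall x y, C x -> C y -> x != y -> r < mdist x y &
      forall y, Y y -> exists2 x, C x & mdist x y <= r].
Proof.
move=> r0.
pose P := [set C | C `<=` Y /\ forall x y, C x -> C y -> x != y -> r < mdist x y].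
have [F FP tF|C [[CY Cs] Cmax]] := @Zorn_bigcup _ P.
  split=> [x [C FC Cx]|x y [C FC Cx] [D FD Dy]]; first by have [h _] := FP _ FC; exact: h.
  have [CD|DC] := tF _ _ FC FD.
    by have [_ h] := FP _ FD; apply: h => //; exact: CD.
  by have [_ h] := FP _ FC; apply: h => //; exact: DC.
exists C; split => // y Yy; apply: contrapT => h.
have far x : C x -> r < mdist x y.
  by move=> Cx; rewrite ltNge; apply/negP => xy; apply: h; exists x.
apply: (Cmax (y |` C)).
  split; first by move=> x Cx; right.
  by move=> /(_ y (or_introl erefl)) /far; rewrite mdistxx ltNge r0.
split; first by move=> x [->//|/CY].
move=> x z [->|Cx] [->|Cz]; rewrite ?eqxx// => xz.
- by rewrite metric_sym far.
- exact: far.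
- exact: Cs.
Qed.

(** A maximal [r]-separated subset meets every ball; removing it lowers the
cardinality of the balls, so that finitely many such steps exhaust [Y]. *)
Lemma separated_coloring_in r (n : nat) Y : 0 <= r ->
  (forall y (s : seq X), Y y -> uniq s ->
     (forall x, x \in s -> Y x /\ mdist x y <= r) -> (size s <= n)%N) ->
  exists col : X -> nat, (forall y, Y y -> (col y < n)%N) /\
    forall x y, Y x -> Y y -> x != y -> col x = col y -> r < mdist x y.
Proof.
move=> r0; elim: n Y => [|n ih] Y hY.
  exists (fun=> 0%N); suff Y0 y : ~ Y y by split=> [y /Y0|x y /Y0].
  move=> Yy; suff: (size [:: y] <= 0)%N by [].
  apply: (hY y) => // x; rewrite inE => /eqP ->; split => //.
  by rewrite mdistxx.
have [C [CY Cs Cmax]] := maximal_separated_subset Y r0.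
have [y s [Yy nCy] us hs|col [coln cols]] := ih (Y `\` C).
  have [x Cx xy] := Cmax y Yy.
  have xs : x \notin s by apply/negP => /hs[[_]].
  suff: (size (x :: s) <= n.+1)%N by [].
  apply: (hY y) => //=; first by rewrite xs us.
  move=> z; rewrite inE => /orP[/eqP ->|/hs[[]]//].
  by split; [exact: CY|].
exists (fun x => if x \in C then n else col x); split=> [y Yy|x y Yx Yy xy].
  by case: ifPn; rewrite ?notin_setE// => nCy; rewrite ltnS ltnW// coln.
case: ifPn; case: ifPn; rewrite ?inE ?notin_setE => Cy Cx.
- by move=> _; exact: Cs.
- by move=> e; have := coln y (conj Yy Cy); rewrite -e ltnn.
- by move=> e; have := coln x (conj Yx Cx); rewrite e ltnn.
- by apply: cols.
Qed.

Lemma separated_coloring r : bounded_geometry X -> 0 <= r ->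
  exists (n : nat) (col : X -> nat), (forall x, (col x < n)%N) /\
    forall x y, x != y -> col x = col y -> r < mdist x y.
Proof.
move=> bg r0; have [n hn] := bounded_geometry_seq bg r0.
have [|col [h1 h2]] := @separated_coloring_in r n setT r0.
  move=> y s _ us hs; apply: (hn y s us) => x /hs[_].
  by rewrite metric_sym.
by exists n, col; split=> [x|x y]; [exact: h1|exact: h2].
Qed.

End Coloring.

(** * Block cutdowns *)

Section Tails.
Variables (R : realType) (p : \bar R) (hp : ((p == 0) || (1 <= p))%E).
Variables (X : metricType R) (E : normedModType R[i]).
Hypothesis bg : bounded_geometry X.
Local Notation L := (lspace hp X E).

(** For a finite exponent, a finite partial sum of the powers of the norms is
close to the total, and what it leaves out is the tail. *)
Lemma lspace_mem_tail (f : X -> E) (e : R) : p != +oo%E -> lspace_mem p f ->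
  0 < e -> exists s : seq X,
    lspace_le p (fun x => if x \in s then 0 else f x) e.
Proof.
move=> poo mf e0; have [[p0 lE]|[r [r1 pr lE]]] := lspace_le_cases hp X E.
  have {}p0 : p == 0%E.
    move: hp poo p0; case: p => // t _ _ /(_ _ erefl) ->; exact: eqxx.
  have [_ /vanishes_seqP - /(_ bg _ e0)[s hs]] := lspace_mem0 p0 mf.
  exists s; apply/lE => x; case: ifPn => [_|/hs/ltW//].
  by rewrite rnorm0 ltW.
have r0 : 0 < r by exact: lt_le_trans r1.
have {}mf : (\esum_(x in [set: X]) (rnorm (f x) `^ r)%:E < +oo)%E.
  by move: mf; rewrite /lspace_mem pr gt_eqF.
have er0 : 0 < e `^ r by rewrite powR_gt0.
have ge0 x : 0 <= rnorm (f x) `^ r by exact: powR_ge0.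
have fin : (\esum_(x in [set: X]) (rnorm (f x) `^ r)%:E)%E \is a fin_num.
  by rewrite ge0_fin_numE//; apply: esum_ge0 => x _; rewrite lee_fin.
have [_ [A [fA _] <-]] := ub_ereal_sup_adherent er0 fin.
rewrite fsbig_finite// sumEFin -/(esum _ _).
have := fineK fin; set M := fine _ => ME.
have /(esum_EFin_leP M ge0) hM : (\esum_(x in [set: X]) (rnorm (f x) `^ r)%:E <= M%:E)%E.
  by rewrite ME.
rewrite -ME -EFinB lte_fin => hA.
exists (fset_set A); apply/lE => u uu.
pose u' := [seq x <- u | x \notin fset_set A].
have -> : \sum_(x <- u) rnorm (if x \in fset_set A then 0 else f x) `^ r =
    \sum_(x <- u') rnorm (f x) `^ r.
  rewrite big_filter [RHS]big_mkcond; apply: eq_bigr => x _.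
  by case: ifP => //= _; rewrite rnorm0 powR0 ?gt_eqF.
have := hM (fset_set A ++ u'); rewrite big_cat/= => h.
have : \sum_(i <- fset_set A) rnorm (f i) `^ r + \sum_(i <- u') rnorm (f i) `^ r <= M.
  apply: h; rewrite cat_uniq fset_uniq filter_uniq//= andbT.
  by apply/hasPn => x; rewrite mem_filter => /andP[].
lra.
Qed.

Lemma lspace_tail (v : L) (e : R) : p != +oo%E -> 0 < e ->
  exists s : seq X, rnorm (v - proj hp E bg [set` s] v) <= e.
Proof.
move=> poo e0; have [s hs] := lspace_mem_tail poo (lspaceP v) e0.
exists s; apply/rnorm_lspace_leP; first exact: ltW.
apply: (lspace_le_mono hp) hs => x.
rewrite -[X in rnorm X <= _]/(v x - proj hp E bg [set` s] v x) projE.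
rewrite (_ : (x \in [set` s]) = (x \in s)); last by apply/idP/idP; rewrite inE.
by case: (x \in s); rewrite ?subrr ?subr0.
Qed.

End Tails.

Global Instance finite_subsets_filter (J : choiceType) :
  ProperFilter (@finite_subsets J).
Proof.
apply: filter_from_proper; last by move=> F _; exists F => /=.
apply: filter_from_filter; first by exists fset0.
move=> F G _ _; exists (F `|` G)%fset => // H /= FGH.
by split; apply: fsubset_trans FGH; [exact: fsubsetUl|exact: fsubsetUr].
Qed.

Lemma bop0E (R : realType) (V : normedModType R[i]) (v : V) : (0 : bop V) v = 0.
Proof. by []. Qed.

Section BlockCutdown.
Variables (R : realType) (p : \bar R) (hp : ((p == 0) || (1 <= p))%E).
Variables (X : metricType R) (E : normedModType R[i]).
Hypothesis bg : bounded_geometry X.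
Local Notation L := (lspace hp X E).
Local Notation BL := (bop L).
Local Notation proj := (proj hp E bg).
Variables (J : choiceType) (Q : J -> set X).
Hypothesis tQ : trivIset setT Q.
Variable a : BL.

Let block y : option J :=
  if pselect (exists j, Q j y) is left h then Some (projT1 (cid h)) else None.

Let block_some y j : Q j y -> block y = Some j.
Proof.
move=> Qy; rewrite /block; case: pselect => [h|[]]; last by exists j.
congr Some; case: (cid h) => j' /= Q'; apply: tQ => //; by exists y.
Qed.

Let blockP y j : block y = Some j -> Q j y.
Proof. by rewrite /block; case: pselect => // h [<-]; case: (cid h). Qed.

Let cutfun (v : L) (y : X) : E :=
  if block y is Some j then a (proj (Q j) v) y else 0.

Let cutfun_le v : lspace_le p (cutfun v) (rnorm a * rnorm v).
Proof.
apply: (@block_le _ _ hp _ _ bg (option J) block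
  (fun oj => if oj is Some j then Q j else set0) (fun=> a)) => //.
- exact: rnorm_ge0.
- move=> [j|] [j'|] _ _ //=; rewrite ?set0I ?setI0 => -[x] //=.
  by move=> [Qx Q'x]; congr Some; apply: tQ => //; exists x.
- by move=> x; rewrite /cutfun; case: (block x) => [//|]; rewrite proj0 bop0E linear0.
Qed.

(** For the exponent 0, only finitely many blocks meet the finite set off which
[v] is small, and in each of them the image vanishes at infinity. *)
Let cutfun_mem v : lspace_mem p (cutfun v).
Proof.
apply: lspace_mem_of_le (cutfun_le v) => p0; split; first exact: discrete_continuous.
apply/vanishes_seqP => // e e0.
have supE : forall (f : X -> E) M, lspace_le p f M <-> forall x, rnorm (f x) <= M.
  have [[_]//|[r [r1 pr _]]] := lspace_le_cases hp X E.
  by move: p0 r1; rewrite pr eqe => /eqP ->; rewrite ler10.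
have vanish (u : L) d : 0 < d -> exists s : seq X, forall x, x \notin s -> rnorm (u x) < d.
  have [_ /vanishes_seqP h] := lspace_mem0 p0 (lspaceP u).
  exact: h.
have a1 : 0 < rnorm a + 1 by rewrite ltr_wpDl ?rnorm_ge0.
have ea : 0 < e / (rnorm a + 1) by rewrite divr_gt0.
have [s hs] := vanish v _ ea.
have /choice[sj hsj] (j : J) := vanish (a (proj (Q j) v)) e e0.
exists (flatten (map sj (pmap block s))) => x xs.
rewrite /cutfun; case bx : (block x) => [j|]; last by rewrite rnorm0.
have [js|js] := boolP (j \in pmap block s).
  by apply: hsj; apply: contra xs => xj; apply/flatten_mapP; exists j.
apply: le_lt_trans (rnorm_coord _ _) _; apply: le_lt_trans (rnorm_app_le _ _) _.
apply: (@le_lt_trans _ _ (rnorm a * (e / (rnorm a + 1)))); last first.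
  by rewrite mulrCA gtr_pMr// ltr_pdivrMr// mul1r ltrDl.
rewrite ler_wpM2l ?rnorm_ge0//; apply/rnorm_lspace_leP; first exact: ltW.
apply/supE => y; rewrite projE; case: ifPn; last by rewrite rnorm0 ltW.
rewrite inE => Qy; apply/ltW/hs; apply: contra js => ys.
by rewrite mem_pmap -(block_some Qy); apply/mapP; exists y.
Qed.

Let cut (v : L) : L := Defs.Lspace hp (asboolT (cutfun_mem v)).

Let cut_bounded : `[< bounded_linear cut >].
Proof.
apply/asboolP; split.
  move=> l u v; apply: lspace_ext => x /=; rewrite /cutfun.
  rewrite -[RHS]/(l *: cutfun u x + cutfun v x) /cutfun.
  by case: (block x) => [j|]; [rewrite !linearP|rewrite scaler0 addr0].
exists (rnorm a) => v; apply/rnorm_lspace_leP; last exact: cutfun_le.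
by rewrite mulr_ge0 ?rnorm_ge0.
Qed.

Let cutop : BL := Bop cut_bounded.

Let e (j : J) : Cb X := CbR bg (\1_(Q j)).

Let S (F : {fset J}) : BL :=
  \sum_(j <- F) mulop hp E (e j) * a * mulop hp E (e j).

Let partial_sumE (F : {fset J}) (v : L) y :
  S F v y =
  if block y is Some j then if j \in F then a (proj (Q j) v) y else 0 else 0.
Proof.
rewrite /S bop_sumE (big_morph (fun u : L => u y) (op1 := +%R) (id1 := 0))//.
have tE j : (mulop hp E (e j) * a * mulop hp E (e j)) v y =
    if y \in Q j then a (proj (Q j) v) y else 0.
  by rewrite -[mulop hp E (e j)]/(proj (Q j)) !bopME projE.
under eq_bigr do rewrite tE.
case by_ : (block y) => [j|]; last first.
  rewrite big1// => j _; case: ifPn => //; rewrite inE => /block_some.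
  by rewrite by_.
have nj k : k != j -> (y \in Q k) = false.
  move=> kj; apply: contra_neqF kj; rewrite inE => /block_some.
  by rewrite by_ => -[].
case: ifPn => jF.
  rewrite (bigD1_seq j) ?fset_uniq//= mem_set ?big1 ?addr0//; last exact: blockP.
  by move=> k /nj ->.
rewrite big_seq big1// => k kF; rewrite nj//.
by apply: contraNneq jF => <-.
Qed.

Let eventually_coord (v : L) y : \forall F \near finite_subsets,
  S F v y = cutfun v y.
Proof.
rewrite /cutfun; case by_ : (block y) => [j|].
  exists [fset j]%fset => // F /=; rewrite fsub1set => jF.
  by rewrite partial_sumE by_ jF.
by exists fset0 => // F _ /=; rewrite partial_sumE by_.
Qed.

(** The difference between the block cutdown and one of its partial sums
is supported off the blocks of that sum, so it is dominated by a tail. *)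
Let cutop_limit : block_cutdown_limit e a cutop.
Proof.
rewrite /block_cutdown_limit; case: eqVneq => poo.
  move=> v y; apply/cvg_rnorm => d d0; apply: filterS (eventually_coord v y) => F ->.
  by rewrite subrr rnorm0.
move=> v; apply/cvg_rnorm => d d0; have d2 : 0 < d / 2 by rewrite divr_gt0.
have [s hs] := lspace_tail bg (cut v) poo d2.
exists [fset j in pmap block s]%fset => // F sF.
apply: (@le_lt_trans _ _ (d / 2)); last by lra.
apply: le_trans hs; apply: rnorm_lspace_mono => y.
rewrite -[X in rnorm X <= _]/(cutfun v y - S F v y).
rewrite -[X in _ <= rnorm X]/(cutfun v y - proj [set` s] (cut v) y).
rewrite partial_sumE projE -[cut v y]/(cutfun v y).
rewrite {1 2}/cutfun; case by_ : (block y) => [j|]; last by rewrite subrr rnorm0 rnorm_ge0.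
case: ifPn => jF; first by rewrite subrr rnorm0 rnorm_ge0.
rewrite ifN// notin_setE /= => ys; case/negP: jF.
apply: (fsubsetP sF); rewrite inE mem_pmap -by_.
by apply/mapP; exists y.
Qed.

(** Either notion of limit implies convergence of coordinates, where the partial
sums are eventually constant. *)
Let block_cutdown_coord (v : L) y : block_cutdown e a v y = cutfun v y.
Proof.
have lim : block_cutdown_limit e a (block_cutdown e a).
  apply: (@xgetPex _ 0 [set t | block_cutdown_limit e a t]).
  by exists cutop; exact: cutop_limit.
apply/eqP; rewrite -subr_eq0; apply/eqP/rnorm0_eq0/eqP.
rewrite eq_le rnorm_ge0 andbT; apply/ler_addgt0Pl => d d0; rewrite addr0.
have near_d : \forall F \near finite_subsets, rnorm (block_cutdown e a v y -
    S F v y) < d.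
  move: lim; rewrite /block_cutdown_limit; case: eqVneq => _ lim.
    by have /cvg_rnorm/(_ _ d0) := lim v y.
  have /cvg_rnorm/(_ _ d0) := lim v; apply: filterS => F.
  exact: le_lt_trans (rnorm_coord _ y).
have [F [/ltW h hF]] := filter_ex (filterI near_d (eventually_coord v y)).
by move: h; rewrite hF.
Qed.

Lemma block_cutdown_in (v : L) y j : Q j y ->
  block_cutdown (fun j => CbR bg (\1_(Q j))) a v y = a (proj (Q j) v) y.
Proof. by move=> Qy; rewrite block_cutdown_coord /cutfun (block_some Qy). Qed.

End BlockCutdown.

(** * Sums concentrated near the diagonal *)

Section Assembly.
Variables (R : realType) (p : \bar R) (hp : ((p == 0) || (1 <= p))%E).
Variables (X : metricType R) (E : normedModType R[i]).
Hypothesis bg : bounded_geometry X.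
Local Notation L := (lspace hp X E).
Local Notation BL := (bop L).
Local Notation proj := (proj hp E bg).
Local Notation mulR := (mulR hp E bg).
Local Notation mulop := (mulop hp E).
Variable B : set BL.
Hypothesis Balg : banach_subalgebra B.
Hypothesis Bmod : two_sided_products setT B = B.
Hypothesis Bcut : closed_under_block_cutdowns B.

Lemma block_cutdown_closed (J : choiceType) (Q : J -> set X) a :
  trivIset setT Q -> B a -> B (block_cutdown (fun j => CbR bg (\1_(Q j))) a).
Proof.
move=> tQ Ba; apply: Bcut => //.
  move=> j; split=> [x|].
    rewrite CbRE; last exact: indic_bounded.
    by rewrite lecR indicE; case: (x \in Q j).
  exact: indic_contraction.
move=> i j _ _ [y [/supp_indic Qi /supp_indic Qj]]; apply: tQ => //.
by exists y.
Qed.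

(** For [F] and [G] supported near the diagonal, the sum over [x] of the
operators [F x * b * G x] is obtained with finitely many block cutdowns, one for
each class of a colouring of [X] in which points of the same colour are far
apart: within a class, the blocks of [F x] and of [G x] are disjoint. *)
Lemma near_diagonal_sum (S : R) (F G : X -> X -> R) b : 0 <= S -> B b ->
  (forall x y, 0 <= F x y <= 1) -> (forall x y, 0 <= G x y <= 1) ->
  (forall x y, S < mdist x y -> F x y = 0) ->
  (forall x y, S < mdist x y -> G x y = 0) ->
  exists b' : BL, [/\ B b', finite_propagation b' &
    forall v y (s : seq X), uniq s -> (forall x, mdist x y <= S -> x \in s) ->
      b' v y = \sum_(x <- s) (F x y)%:C%C *: b (mulR (G x) v) y].
Proof.
move=> S0 Bb F01 G01 FS GS.
have [|n [col [coln cols]]] := @separated_coloring _ X (2 * S) bg.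
  by rewrite mulr_ge0.
pose Q k x := [set y | col x = k /\ mdist x y <= S].
have Qinj k x x' y : Q k x y -> Q k x' y -> x = x'.
  move=> [cx xy] [cx' x'y]; apply/eqP; apply/negPn/negP => xx'.
  have := cols _ _ xx' (etrans cx (esym cx')); apply/negP; rewrite -leNgt.
  by have := metric_triangle x y x'; rewrite (metric_sym y x'); lra.
have tQ k : trivIset setT (Q k).
  by move=> x x' _ _ [y [Qx Qx']]; exact: Qinj Qx Qx'.
pose cen k y : option X :=
  if pselect (exists x, Q k x y) is left h then Some (projT1 (cid h)) else None.
have cen_some k x y : Q k x y -> cen k y = Some x.
  move=> Qy; rewrite /cen; case: pselect => [h|[]]; last by exists x.
  by congr Some; case: (cid h) => x' /= Q'; exact: Qinj Q' Qy.
have cenP k x y : cen k y = Some x -> Q k x y.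
  by rewrite /cen; case: pselect => // h [<-]; case: (cid h).
pose diag (H : X -> X -> R) k y : R := if cen k y is Some x then H x y else 0.
have diag_bd (H : X -> X -> R) k : (forall x y, 0 <= H x y <= 1) ->
    exists C, forall y, `|diag H k y| <= C.
  move=> H01; exists 1 => y; rewrite /diag; case: (cen k y) => [x|].
    by case/andP: (H01 x y) => ? ?; rewrite ger0_norm.
  by rewrite normr0.
have G_bd x : exists C : R, forall y, `|G x y| <= C.
  by exists 1 => y; case/andP: (G01 x y) => ? ?; rewrite ger0_norm.
pose theta k := block_cutdown (fun x => CbR bg (\1_(Q k x))) b.
pose b' := \sum_(k < n) mulR (diag F k) * theta k * mulR (diag G k).
have b'E v y (s : seq X) : uniq s -> (forall x, mdist x y <= S -> x \in s) ->
    b' v y = \sum_(x <- s) (F x y)%:C%C *: b (mulR (G x) v) y.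
  move=> us hs; rewrite /b' bop_sumE.
  rewrite (big_morph (fun u : L => u y) (op1 := +%R) (id1 := 0))//.
  have -> : \sum_(x <- s) (F x y)%:C%C *: b (mulR (G x) v) y =
      \sum_(k < n) \sum_(x <- s | col x == k) (F x y)%:C%C *: b (mulR (G x) v) y.
    under [RHS]eq_bigr do rewrite big_mkcond.
    rewrite exchange_big; apply: eq_bigr => x _.
    rewrite (bigD1 (Ordinal (coln x)))//= eqxx big1 ?addr0// => k.
    by rewrite -val_eqE/= eq_sym => /negbTE ->.
  apply: eq_bigr => k _; rewrite !bopME mulRE; last exact: diag_bd.
  rewrite /diag; case ck : (cen k y) => [x0|]; last first.
    rewrite scale0r big1// => x /eqP cx; rewrite FS ?scale0r// ltNge.
    by apply/negP => xy; have := cen_some k x y (conj cx xy); rewrite ck.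
  have Qx0 := cenP _ _ _ ck; have [c0 x0y] := Qx0.
  rewrite /theta (block_cutdown_in bg (tQ k) _ _ Qx0).
  have -> : proj (Q k x0) (mulR (diag G k) v) = mulR (G x0) v.
    apply: lspace_ext => z; rewrite projE mulRE; last exact: diag_bd.
    rewrite mulRE//; case: ifPn; first by rewrite inE /diag => /cen_some ->.
    rewrite notin_setE => Qz; rewrite GS ?scale0r// ltNge.
    by apply/negP => x0z; apply: Qz.
  rewrite big_mkcond (bigD1_seq x0) ?hs//= c0 eqxx big1 ?addr0// => x xx0.
  case: eqP => // cx; rewrite FS ?scale0r// ltNge; apply/negP => xy.
  have := cen_some k x y (conj cx xy); rewrite ck => -[e].
  by move: xx0; rewrite e eqxx.
exists b'; split => //.
  apply: (@subalgebra_sum _ _ _ _ _ _ Balg) => k.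
  apply: (@subalgebra_module _ _ _ _ _ _ Bmod); exact: block_cutdown_closed.
exists (2 * S) => [|f f' /set_dist_separated ff]; first by rewrite mulr_ge0.
apply: bop_ext => v; apply: lspace_ext => y; rewrite !bopME (mulopE f).
have [s [us hs]] := ball_enum bg y S.
rewrite (b'E _ _ s)//; last by move=> x; rewrite hs metric_sym.
have [->|fy] := eqVneq (f y) 0; first by rewrite scale0r.
rewrite big1 ?scaler0// => x _.
have [xy|xy] := leP (mdist x y) S; last by rewrite FS ?scale0r.
have -> : mulR (G x) (mulop f' v) = 0.
  apply: lspace_ext => z; rewrite mulRE// (mulopE f').
  have [->|f'z] := eqVneq (f' z) 0; first by rewrite scale0r scaler0.
  rewrite GS ?scale0r// ltNge; apply/negP => xz.
  have := ff y z; rewrite !supp_discrete// => /(_ fy f'z).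
  have := metric_triangle y x z; rewrite (metric_sym y x); lra.
by rewrite linear0 scaler0.
Qed.

End Assembly.

(** * Approximation for the supremum and the sum norms *)

Section QuasiLocalRoe.
Variables (R : realType) (p : \bar R) (hp : ((p == 0) || (1 <= p))%E).
Variables (X : metricType R) (E : normedModType R[i]).
Hypothesis bg : bounded_geometry X.
Local Notation L := (lspace hp X E).
Local Notation BL := (bop L).
Local Notation proj := (proj hp E bg).
Local Notation mulR := (mulR hp E bg).

(** Finitely supported vectors are dense, except for bounded functions. *)
Lemma rnorm_le_finite_support (c : BL) (K : R) : p != +oo%E -> 0 <= K ->
  (forall v (t : seq X), rnorm (c (proj [set` t] v)) <= K * rnorm v) ->
  rnorm c <= K.
Proof.
move=> poo K0 h; apply/rnorm_bop_leP => // v; apply/ler_addgt0Pl => e e0.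
have c1 : 0 < rnorm c + 1 by rewrite ltr_wpDl ?rnorm_ge0.
have [t ht] := lspace_tail bg v poo (divr_gt0 e0 c1).
rewrite -[X in c X](subrK (proj [set` t] v)) linearD.
apply: le_trans (ler_rnormD _ _) _; apply: lerD; last exact: h.
apply: le_trans (rnorm_app_le _ _) _.
apply: le_trans (ler_wpM2l (rnorm_ge0 _) ht) _.
by rewrite mulrCA ger_pMr// ler_pdivrMr// mul1r lerDl.
Qed.

Variable B : set BL.
Hypothesis Balg : banach_subalgebra B.
Hypothesis Bmod : two_sided_products setT B = B.
Hypothesis Bcut : closed_under_block_cutdowns B.

Let ind01 (P : bool) : 0 <= (P%:R : R) <= 1.
Proof. by case: P; rewrite ?lexx ?ler01. Qed.

(** For a supremum norm the distance between two operators is the supremum of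
the norms of the rows of their difference, so it suffices to truncate each row
of [b] to a ball. *)
Lemma quasi_local_Roe_sup b :
  (forall (f : X -> E) M, lspace_le p f M <-> forall x, rnorm (f x) <= M) ->
  B b -> quasi_local_sets bg b -> Roe B b.
Proof.
move=> supE Bb bql; apply/closure_rnorm => e e0.
have [r r0 hr] := bql _ (divr_gt0 e0 (ltr0n R 2)).
have [||||b' [Bb' fb' b'E]] := near_diagonal_sum bg Balg Bmod Bcut
  (F := fun x y => (x == y)%:R) (G := fun x y => (mdist x y <= r)%R%:R) r0 Bb.
- by move=> x y; exact: ind01.
- by move=> x y; exact: ind01.
- by move=> x y; case: eqVneq => // ->; rewrite mdistxx ltNge r0.
- by move=> x y; rewrite ltNge => /negbTE ->.
exists b' => //; apply: (@le_lt_trans _ _ (e / 2)); last by lra.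
apply/rnorm_bop_leP => [|v]; first by rewrite divr_ge0 ?ltW.
apply/rnorm_lspace_leP; first by rewrite mulr_ge0 ?divr_ge0 ?rnorm_ge0 ?ltW.
apply/supE => y; rewrite bopBE -[X in rnorm X]/(b v y - b' v y).
have [s [us hs]] := ball_enum bg y r.
rewrite (b'E v y s)//; last by move=> x; rewrite hs metric_sym.
rewrite (bigD1_seq y) ?hs ?mdistxx// eqxx scale1r big1 ?Monoid.mulm1; last first.
  by move=> x /negbTE ->; rewrite scale0r.
rewrite (_ : mulR _ v = proj [set z | mdist y z <= r] v); last first.
  apply: lspace_ext => z; rewrite mulRE; last first.
    by exists 1 => x; case: (mdist _ _ <= _); rewrite ?normr0 ?normr1.
  rewrite projE (_ : (z \in _) = (mdist y z <= r)); last by apply/idP/idP; rewrite inE.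
  by case: ifP; rewrite ?scale1r ?scale0r.
rewrite -[X in rnorm X]/((b v - b (proj [set z | mdist y z <= r] v)) y).
rewrite -linearB.
have -> : v - proj [set z | mdist y z <= r] v = proj (~` [set z | mdist y z <= r]) v.
  by rewrite projC.
rewrite -(@proj_in _ _ hp _ _ bg [set y])//.
apply: le_trans (rnorm_coord _ _) _.
rewrite -!bopME; apply: le_trans (rnorm_app_le _ _) _.
rewrite ler_wpM2r ?rnorm_ge0// ltW// hr// => x z -> /= /negP.
by rewrite -ltNge.
Qed.

(** For the sum norm the distance between two operators is the supremum of the
norms of the columns of their difference. *)
Lemma quasi_local_Roe1 b : p = 1%E -> B b -> quasi_local_sets bg b -> Roe B b.
Proof.
move=> p1 Bb bql; apply/closure_rnorm => e e0.
have [r r0 hr] := bql _ (divr_gt0 e0 (ltr0n R 2)).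
have [||||b' [Bb' fb' b'E]] := near_diagonal_sum bg Balg Bmod Bcut
  (F := fun x y => (mdist x y <= r)%R%:R) (G := fun x y => (x == y)%:R) r0 Bb.
- by move=> x y; exact: ind01.
- by move=> x y; exact: ind01.
- by move=> x y; rewrite ltNge => /negbTE ->.
- by move=> x y; case: eqVneq => // ->; rewrite mdistxx ltNge r0.
exists b' => //; apply: (@le_lt_trans _ _ (e / 2)); last by lra.
have e2 : 0 <= e / 2 by rewrite divr_ge0 ?ltW.
have mE x v : mulR (fun y => (x == y)%:R) v = proj [set x] v.
  apply: lspace_ext => z; rewrite mulRE; last first.
    by exists 1 => y; case: (x == y); rewrite ?normr0 ?normr1.
  rewrite projE (_ : (z \in _) = (x == z)); last first.
    by apply/idP/eqP; rewrite inE/= => ->.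
  by case: ifP; rewrite ?scale1r ?scale0r.
have column x v : rnorm ((b - b') (proj [set x] v)) <= e / 2 * rnorm (proj [set x] v).
  have -> : (b - b') (proj [set x] v) =
      (proj (~` [set y | mdist x y <= r]) * b * proj [set x]) (proj [set x] v).
    apply: lspace_ext => y; rewrite bopBE.
    rewrite -[LHS]/(b (proj [set x] v) y - b' (proj [set x] v) y) bopME bopME.
    rewrite -[proj [set x] (proj _ _)]bopME projM setIid projE.
    rewrite (_ : (y \in _) = ~~ (mdist x y <= r)); last first.
      by apply/idP/negP; rewrite inE.
    have [s [us hs]] := ball_enum bg y r.
    rewrite (b'E _ y s)//; last by move=> z; rewrite hs metric_sym.
    under eq_bigr do rewrite mE -bopME projM.
    have out z : z != x -> b (proj ([set z] `&` [set x]) v) y = 0.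
      move=> zx; rewrite (_ : _ `&` _ = set0) ?proj0 ?bop0E ?linear0//.
      by rewrite -subset0 => w [/= -> wx]; move: zx; rewrite wx eqxx.
    case: (boolP (mdist x y <= r)) => xy /=.
      have xs : x \in s by rewrite hs metric_sym.
      rewrite (bigD1_seq x xs us).
      rewrite setIid xy scale1r big1 ?Monoid.mulm1 ?subrr// => z zx.
      by rewrite out ?scaler0.
    rewrite big_seq big1 ?subr0// => z zs; rewrite out ?scaler0//.
    apply/eqP => zx; move: zs xy; rewrite hs zx metric_sym => ->.
    by [].
  apply: le_trans (rnorm_app_le _ _) _; rewrite ler_wpM2r ?rnorm_ge0//.
  by apply/ltW/hr => y z /= /negP + ->; rewrite -ltNge metric_sym.
apply: rnorm_le_finite_support => //; first by rewrite p1.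
move=> v t; have -> : proj [set` t] v = \sum_(x <- undup t) proj [set x] v.
  apply: lspace_ext => z.
  rewrite (big_morph (fun u : L => u z) (op1 := +%R) (id1 := 0))// projE.
  under eq_bigr do rewrite projE.
  have xE x : (z \in [set x]) = (x == z).
    by apply/idP/eqP; rewrite inE/= => ->.
  under eq_bigr do rewrite xE.
  rewrite (_ : (z \in [set` t]) = (z \in undup t)); last first.
    by rewrite mem_undup; apply/idP/idP; rewrite inE.
  case: ifPn => zt.
    rewrite (bigD1_seq z) ?undup_uniq//= eqxx big1 ?addr0// => x /negbTE.
    by move=> ->.
  by rewrite big_seq big1// => x xt; case: eqP => // xz; rewrite -xz xt in zt.
rewrite linear_sum; apply: le_trans (ler_rnorm_sum _ _ _) _.
apply: (@le_trans _ _ (\sum_(x <- undup t) e / 2 * rnorm (proj [set x] v))).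
  by apply: ler_sum => x _; exact: column.
rewrite -mulr_sumr ler_wpM2l//.
have := @sum_rnorm_powR _ _ hp _ E 1 _ (undup t) (fun x => proj [set x] v) v (lexx 1) p1.
rewrite powRr1 ?rnorm_ge0//; under eq_bigr do rewrite powRr1 ?rnorm_ge0//.
apply=> z; rewrite powRr1 ?rnorm_ge0//.
rewrite (eq_bigr (fun x => if x == z then rnorm (v z) else 0)).
  apply: sum_at_most_one; rewrite ?undup_uniq ?rnorm_ge0// => x y.
  by move=> /eqP -> /eqP ->.
move=> x _; rewrite powRr1 ?rnorm_ge0// projE.
rewrite (_ : (z \in [set x]) = (x == z)); last by apply/idP/eqP; rewrite inE/= => ->.
by case: ifP => //; rewrite rnorm0.
Qed.

End QuasiLocalRoe.

(** * Inequalities for powers *)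

Section PowerSums.
Variable R : realType.
Implicit Types (a b q r : R).

Lemma sum_powR_eq0 (T : eqType) (s : seq T) (f : T -> R) r :
  (forall x, 0 <= f x) -> \sum_(x <- s) f x `^ r <= 0 ->
  forall x, x \in s -> f x = 0.
Proof.
move=> f0; elim: s => [//|y s ih]; rewrite big_cons => h x.
have s0 : 0 <= \sum_(x <- s) f x `^ r by apply: sumr_ge0 => *; exact: powR_ge0.
have y0 : 0 <= f y `^ r by exact: powR_ge0.
rewrite inE => /orP[/eqP ->|xs]; last by apply: ih => //; lra.
by apply: (@powR_eq0_eq0 _ (f y) r); apply/eqP; rewrite eq_le y0 andbT; lra.
Qed.

(** Hoelder's inequality for weights of total mass at most 1: after division by
[M], Young's inequality is applied to each term. *)
Lemma sum_holder_le (T : eqType) (s : seq T) (w f : T -> R) r (M : R) :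
  1 <= r -> 0 <= M -> (forall x, 0 <= w x) -> (forall x, 0 <= f x) ->
  \sum_(x <- s) w x <= 1 -> \sum_(x <- s) f x `^ r <= M `^ r ->
  \sum_(x <- s) w x `^ (1 - r^-1) * f x <= M.
Proof.
move=> r1 M0 w0 f0 ws fs; have r0 : 0 < r by exact: lt_le_trans r1.
move: M0; rewrite le_eqVlt => /orP[/eqP M0|M0].
  move: fs; rewrite -M0 powR0 ?gt_eqF// => /(sum_powR_eq0 f0) fs.
  by rewrite big_seq big1// => x /fs ->; rewrite mulr0.
suff : \sum_(x <- s) w x `^ (1 - r^-1) * (f x / M) <= 1.
  under eq_bigr do rewrite mulrA.
  by rewrite -mulr_suml ler_pdivrMr// mul1r.
have fM : \sum_(x <- s) (f x / M) `^ r <= 1.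
  under eq_bigr do rewrite powRM ?invr_ge0 ?(ltW M0)//.
  rewrite -mulr_suml -powR_inv1 ?(ltW M0)// -powRrM mulN1r powRN.
  by rewrite ler_pdivrMr ?powR_gt0// mul1r.
have [r1'|r1'] := eqVneq r 1.
  apply: le_trans fM; apply: ler_sum => x _.
  by rewrite r1' invr1 subrr powRr0 mul1r powRr1 ?divr_ge0 ?(ltW M0).
have {}r1 : 1 < r by rewrite lt_neqAle eq_sym r1'.
have q0 : 0 < 1 - r^-1 by rewrite subr_gt0 invf_lt1.
have step x : w x `^ (1 - r^-1) * (f x / M) <= w x * (1 - r^-1) + (f x / M) `^ r / r.
  have := @conjugate_powR R (w x `^ (1 - r^-1)) (f x / M) (1 - r^-1)^-1 r.
  rewrite -powRrM mulfV ?gt_eqF// powRr1// invrK; apply.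
  - exact: powR_ge0.
  - by rewrite divr_ge0// ltW.
  - by rewrite invr_gt0.
  - by [].
  - by rewrite subrK.
apply: le_trans (ler_sum _ (fun x _ => step x)) _.
rewrite big_split/= -!mulr_suml.
have h1 : (\sum_(x <- s) w x) * (1 - r^-1) <= 1 * (1 - r^-1) by rewrite ler_wpM2r// ltW.
have h2 : (\sum_(x <- s) (f x / M) `^ r) / r <= 1 / r.
  by rewrite ler_wpM2r// invr_ge0 ltW.
lra.
Qed.

Lemma powR_superadditive a b r : 0 <= a -> 0 <= b -> 1 <= r ->
  a `^ r + b `^ r <= (a + b) `^ r.
Proof.
move=> a0 b0 r1; have r0 : 0 < r by exact: lt_le_trans r1.
rewrite -!(mulr_powRB1 _ r0) ?addr_ge0// mulrDl.
by rewrite lerD// ler_wpM2l// ge0_ler_powR ?nnegrE ?subr_ge0 ?addr_ge0// ?lerDl ?lerDr.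
Qed.

(** Superadditivity of the power [r], applied to the difference of the roots and
the smaller root. *)
Lemma powR_root_dist a b r : 0 <= a -> 0 <= b -> 1 <= r ->
  `|a `^ r^-1 - b `^ r^-1| `^ r <= `|a - b|.
Proof.
have main x y : 0 <= y -> y <= x -> 1 <= r ->
    (x `^ r^-1 - y `^ r^-1) `^ r <= x - y.
  move=> y0 yx r1; have r0 : 0 < r by exact: lt_le_trans r1.
  have x0 : 0 <= x by exact: le_trans yx.
  have root z : 0 <= z -> (z `^ r^-1) `^ r = z.
    by move=> z0; rewrite -powRrM mulVf ?gt_eqF// powRr1.
  have le : y `^ r^-1 <= x `^ r^-1.
    by rewrite ge0_ler_powR ?nnegrE ?invr_ge0// ltW.
  have := @powR_superadditive (x `^ r^-1 - y `^ r^-1) (y `^ r^-1) r.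
  rewrite subrK !root// => h.
  by rewrite lerBrDr h ?subr_ge0 ?powR_ge0.
move=> a0 b0 r1; have r0 : 0 < r by exact: lt_le_trans r1.
have [ab|ba] := leP a b.
  rewrite distrC ger0_norm ?subr_ge0 ?ge0_ler_powR ?nnegrE ?invr_ge0 ?(ltW r0)//.
  by rewrite distrC ger0_norm ?subr_ge0// main.
rewrite ger0_norm ?subr_ge0 ?ge0_ler_powR ?nnegrE ?invr_ge0 ?(ltW r0) ?(ltW ba)//.
by rewrite ger0_norm ?subr_ge0 ?(ltW ba)// main ?(ltW ba).
Qed.

(** The tangent line inequality for a power function, from Young's inequality. *)
Lemma powR_dist_le a b q : 0 <= a -> 0 <= b -> 1 <= q ->
  `|a `^ q - b `^ q| <= q * (Num.max a b `^ (q - 1) * `|a - b|).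
Proof.
have main x y : 0 <= y -> y <= x -> 1 <= q ->
    x `^ q - y `^ q <= q * (x `^ (q - 1) * (x - y)).
  move=> y0 yx q1; have x0 : 0 <= x by exact: le_trans yx.
  have [->|q1'] := eqVneq q 1; first by rewrite subrr powRr0 !powRr1// !mul1r.
  have {q1 q1'} q1 : 1 < q by rewrite lt_neqAle eq_sym q1'.
  have q0 : 0 < q by exact: lt_trans q1.
  have q1p : 0 < q - 1 by rewrite subr_gt0.
  have := @conjugate_powR R (x `^ (q - 1)) y (q / (q - 1)) q (powR_ge0 _ _) y0
    (divr_gt0 q0 q1p) q0.
  rewrite -powRrM mulrCA mulfV ?gt_eqF// mulr1 => h.
  have {h} : x `^ (q - 1) * y <= x `^ q / (q / (q - 1)) + y `^ q / q.
    by apply: h; field; rewrite !gt_eqF.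
  rewrite -(ler_pM2l q0) mulrDr.
  have -> : q * (x `^ q / (q / (q - 1))) = (q - 1) * x `^ q by field; rewrite !gt_eqF.
  have -> : q * (y `^ q / q) = y `^ q by field; rewrite gt_eqF.
  by rewrite [_ * (x - y)]mulrBr -(mulr_powRB1 x0 q0) mulrBl; lra.
move=> a0 b0 q1; have q0 : 0 <= q by exact: le_trans q1.
have [ab|ba] := leP a b.
  by rewrite distrC ger0_norm ?subr_ge0 ?ge0_ler_powR// distrC ger0_norm ?subr_ge0// main.
rewrite ger0_norm ?subr_ge0 ?ge0_ler_powR ?nnegrE ?(ltW ba)//.
by rewrite ger0_norm ?subr_ge0 ?(ltW ba)// main ?(ltW ba).
Qed.

End PowerSums.

(** * Property A *)

Section PropertyA.
Variables (R : realType) (X : metricType R).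
Hypothesis bg : bounded_geometry X.

(** Partitions of unity labelled by the points of [X] themselves: bounded
geometry makes the sums finite, uniformly, without a further hypothesis on
multiplicity. *)
Definition point_partition (psi : X -> X -> R) (S : R) : Prop :=
  [/\ forall x y, 0 <= psi x y,
      forall x y, S < mdist x y -> psi x y = 0 &
      forall y s, uniq s -> (forall x, mdist x y <= S -> x \in s) ->
        \sum_(x <- s) psi x y = 1].

Definition point_variation (psi : X -> X -> R) (r e : R) : Prop :=
  forall y z s, mdist y z <= r -> uniq s ->
    \sum_(x <- s) `|psi x y - psi x z| <= e.

Lemma esum_finite_support (I : choiceType) (f : I -> R) (l : seq I) (M : R) :
  (forall i, 0 <= f i) -> uniq l -> (forall i, i \notin l -> f i = 0) ->
  (\esum_(i in [set: I]) (f i)%:E = M%:E)%E -> \sum_(i <- l) f i = M.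
Proof.
move=> f0 ul fl fM; apply/eqP; rewrite eq_le; apply/andP; split.
  have /(esum_EFin_leP M f0) : (\esum_(i in [set: I]) (f i)%:E <= M%:E)%E by rewrite fM.
  exact.
rewrite -lee_fin -fM; apply/esum_EFin_leP => // s us.
apply: (@le_trans _ _ (\sum_(i <- [seq i <- s | i \in l]) f i)).
  rewrite big_filter [leRHS]big_mkcond; apply: ler_sum => i _.
  by case: ifPn => // /fl ->.
rewrite (perm_big [seq i <- l | i \in s]).
  rewrite big_filter [leLHS]big_mkcond; apply: ler_sum => i _.
  by case: ifP.
apply: uniq_perm; rewrite ?filter_uniq// => i.
by rewrite !mem_filter andbC.
Qed.

(** The sets of a partition of unity are labelled by one of their points, and
the functions with the same label are added up; the functions to the power [q]
sum to 1, and the tangent line inequality bounds the variation of these powers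
by that of the functions. *)
Lemma property_A_point_partition (r e : R) : property_A X -> 0 < r -> 0 < e ->
  exists (psi : X -> X -> R) (S : R),
    [/\ 0 <= S, point_partition psi S & point_variation psi r e].
Proof.
move=> [q q1 hq] r0 e0; have q0 : 0 < q by exact: lt_le_trans q1.
pose e1 := e / (2 * q); have e10 : 0 < e1 by rewrite divr_gt0 ?mulr_gt0.
have [I [phi [[phi01 [D hD] [M hM] phi1] var]]] := hq r e1 r0 e10.
pose th i y := phi i y `^ q.
have th0 i y : 0 <= th i y by exact: powR_ge0.
have /choice[l hl] (y : X) : exists l : seq I, uniq l /\ forall i, i \notin l -> phi i y = 0.
  have fy : finite_set [set i | supp (phi i) y] by apply/finite_set_leP; exists M.
  exists (fset_set [set i | supp (phi i) y]); split; first exact: fset_uniq.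
  move=> i; rewrite in_fset_set// notin_setE /= supp_discrete//= => /negP.
  by rewrite negbK => /eqP.
have ul y : uniq (l y) by case: (hl y).
have th_out i y : i \notin l y -> th i y = 0.
  by case: (hl y) => _ h /h; rewrite /th => ->; rewrite powR0// gt_eqF.
have thsum y (l' : seq I) : uniq l' -> {subset l y <= l'} -> \sum_(i <- l') th i y = 1.
  move=> ul' sl; apply: (@esum_finite_support I (th^~ y)) .
  - by [].
  - by [].
  - by move=> i il; rewrite th_out//; apply: contra il => /sl.
  - exact: phi1.
pose pt i : option X :=
  if pselect (exists x, phi i x != 0) is left h then Some (projT1 (cid h)) else None.
have ptP i x : pt i = Some x -> phi i x != 0.
  by rewrite /pt; case: pselect => // h [<-]; case: (cid h).
have pt_some i y : phi i y != 0 -> exists2 x, pt i = Some x & phi i x != 0.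
  move=> iy; rewrite /pt; case: pselect => [h|[]]; last by exists y.
  by case: (cid h) => x /= ix; exists x.
pose psi x y := \sum_(i <- l y | pt i == Some x) th i y.
have psiE x y (l' : seq I) : uniq l' -> {subset l y <= l'} ->
    psi x y = \sum_(i <- l' | pt i == Some x) th i y.
  move=> ul' sl; rewrite /psi [RHS](bigID (mem (l y)))/= [X in _ + X]big1 ?addr0; last first.
    by move=> i /andP[_ /th_out].
  rewrite -big_filter -[RHS]big_filter; apply: perm_big.
  apply: uniq_perm; rewrite ?filter_uniq// => i; rewrite !mem_filter -andbA.
  by case: (boolP (i \in l y)) => [/sl ->|]; rewrite ?andbT ?andbF.
have one_label (s : seq X) (l' : seq I) (F : I -> R) : uniq s ->
    (forall i, 0 <= F i) ->
    \sum_(x <- s) \sum_(i <- l' | pt i == Some x) F i <= \sum_(i <- l') F i.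
  move=> us F0; under eq_bigr do rewrite big_mkcond.
  rewrite exchange_big; apply: ler_sum => i _; apply: sum_at_most_one => //.
  by move=> x x' /eqP + /eqP => -> [].
exists psi, `|D|; split => //.
  have near i x y : phi i x != 0 -> phi i y != 0 -> mdist x y <= `|D|.
    move=> ix iy; apply: le_trans (ler_norm D).
    by apply: (hD i); rewrite supp_discrete.
  split.
  - by move=> x y; apply: sumr_ge0.
  - move=> x y xy; rewrite /psi big1// => i /eqP /ptP ix; rewrite /th.
    have [->|iy] := eqVneq (phi i y) 0; first by rewrite powR0// gt_eqF.
    by have := near _ _ _ ix iy; rewrite leNgt xy.
  - move=> y s us hs; rewrite -[RHS](thsum y (l y))//.
    rewrite /psi; under eq_bigr do rewrite big_mkcond.
    rewrite exchange_big; apply: eq_bigr => i _.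
    have [iy|iy] := eqVneq (phi i y) 0.
      by rewrite /th iy powR0 ?gt_eqF// big1// => x _; case: ifP.
    have [x px ix] := pt_some i y iy.
    rewrite (bigD1_seq x)//=; last exact/hs/near/iy.
    rewrite px eqxx big1 ?addr0// => x' x'x; case: eqP => // -[xx'].
    by move: x'x; rewrite xx' eqxx.
move=> y z s yz us; pose L := undup (l y ++ l z).
have uL : uniq L by exact: undup_uniq.
have yL : {subset l y <= L} by move=> i il; rewrite mem_undup mem_cat il.
have zL : {subset l z <= L} by move=> i il; rewrite mem_undup mem_cat il orbT.
apply: (@le_trans _ _ (\sum_(i <- L) `|th i y - th i z|)).
  apply: le_trans (one_label s L (fun i => `|th i y - th i z|) us _) => //.
  apply: ler_sum => x _; rewrite (psiE x y L)// (psiE x z L)// -sumrB.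
  exact: ler_norm_sum.
have p01 i x : 0 <= phi i x by case/andP: (phi01 i x).
(* the maximum to the power [q] has sum at most 2 *)
pose w i := Num.max (phi i y) (phi i z) `^ q / 2.
have wsum : \sum_(i <- L) w i <= 1.
  apply: (@le_trans _ _ (\sum_(i <- L) (th i y + th i z) / 2)).
    apply: ler_sum => i _; rewrite ler_wpM2r ?invr_ge0// /th.
    by rewrite maxEle; case: ifP => _; rewrite ?lerDl ?lerDr powR_ge0.
  by rewrite -mulr_suml big_split/= !thsum//; lra.
have vsum : \sum_(i <- L) `|phi i y - phi i z| `^ q <= e1 `^ q.
  by apply: (esum_EFin_leP _ _).1 uL; [move=> i; exact: powR_ge0|exact/ltW/var].
have w0 i : 0 <= w i by rewrite divr_ge0 ?powR_ge0.
have := @sum_holder_le R I L w (fun i => `|phi i y - phi i z|) q e1 q1 (ltW e10)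
  w0 (fun i => normr_ge0 _) wsum vsum => hold.
have -> : e = 2 * q * e1 by rewrite /e1; field; rewrite gt_eqF.
apply: le_trans (ler_wpM2l _ hold); last by rewrite mulr_ge0 ?ltW.
rewrite mulr_sumr; apply: ler_sum => i _.
apply: le_trans (powR_dist_le (p01 i y) (p01 i z) q1) _.
rewrite [leRHS](_ : _ = q * (2 * w i `^ (1 - q^-1) * `|phi i y - phi i z|)); last by ring.
rewrite ler_wpM2l ?(ltW q0)// ler_wpM2r ?normr_ge0//.
rewrite /w; set m := Num.max _ _.
have m0 : 0 <= m by rewrite le_max p01.
have qi : 0 <= 1 - q^-1 <= 1.
  by rewrite subr_ge0 invf_le1// q1/= gerBl invr_ge0 ltW.
rewrite powRM ?powR_ge0 ?invr_ge0// -powRrM mulrBr mulr1 mulfV ?gt_eqF//.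
rewrite mulrCA -[leLHS]mulr1 ler_wpM2l ?powR_ge0//.
rewrite -powR_inv1// -powRrM mulN1r -[X in X * _]powRr1// -powRD; last by rewrite pnatr_eq0 implybT.
rewrite -[leLHS](powRr0 2) ler_powR ?ler1n//.
by case/andP: qi; lra.
Qed.

End PropertyA.

(** * Metric sparsification *)

Section LevelSets.
Variable R : realType.

(** The number of integers from 0 to [n - 1] below [a] is, up to 1, the smaller of
[a] and [n]. *)
Lemma count_below_le (a : R) (n : nat) : 0 <= a ->
  \sum_(k < n) (k%:R < a)%R%:R <= a + 1.
Proof.
move=> a0; have triv m : \sum_(k < m) (k%:R < a)%R%:R <= m%:R :> R.
  elim: m => [|m ih]; first by rewrite big_ord0.
  rewrite big_ord_recr/= -natr1 lerD//; by case: (_ < _); rewrite ?lexx ?ler01.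
elim: n => [|n ih]; first by rewrite big_ord0 addr_ge0.
rewrite big_ord_recr/=; case: ltP => [na|_]; last by rewrite addr0.
by rewrite lerD2r (le_trans (triv n))// ltW.
Qed.

Lemma count_below_ge (a : R) (n : nat) :
  Num.min a n%:R <= \sum_(k < n) (k%:R < a)%R%:R.
Proof.
elim: n => [|n ih]; first by rewrite big_ord0 ge_min lexx orbT.
rewrite big_ord_recr/=; case: ltP => na.
  by move: ih; rewrite (min_r (ltW na)) => ih; rewrite ge_min -natr1 lerD2r ih orbT.
by move: ih; rewrite (min_l na) addr0 ge_min => ->.
Qed.

(** Summation over the superlevel sets: the integral of a function is
approximated by the mean of the masses of its levels [k / n]. *)
Lemma sum_level_domination (T : Type) (s : seq T) (mu f g : T -> R) (c : R) :
  0 <= c -> (forall x, 0 <= mu x) -> (forall x, 0 <= f x <= 1) ->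
  (forall x, 0 <= g x) ->
  (forall t, 0 <= t -> c * (\sum_(x <- s | t < f x) mu x) <=
     \sum_(x <- s | t < g x) mu x) ->
  c * (\sum_(x <- s) mu x * f x) <= \sum_(x <- s) mu x * g x.
Proof.
move=> c0 mu0 f01 g0 h; apply/ler_addgt0Pl => d d0.
pose m := \sum_(x <- s) mu x; have m0 : 0 <= m by apply: sumr_ge0.
pose n := (Num.truncn (m / d)).+1.
have n0 : 0 < n%:R :> R by rewrite ltr0n.
have nd : m <= d * n%:R by rewrite mulrC -ler_pdivrMr// ltW// truncnS_gt.
have levels (u : T -> R) : \sum_(k < n) \sum_(x <- s | k%:R / n%:R < u x) mu x =
    \sum_(x <- s) mu x * \sum_(k < n) (k%:R < n%:R * u x)%R%:R.
  under eq_bigr do rewrite big_mkcond.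
  rewrite exchange_big; apply: eq_bigr => x _; rewrite mulr_sumr.
  apply: eq_bigr => k _; rewrite ltr_pdivrMr// (mulrC (u x)).
  by case: ifP; rewrite ?mulr1 ?mulr0.
rewrite -(ler_pM2l n0) mulrCA.
apply: (@le_trans _ _ (c * \sum_(k < n) \sum_(x <- s | k%:R / n%:R < f x) mu x)).
  rewrite ler_wpM2l// levels mulr_sumr; apply: ler_sum => x _.
  rewrite mulrCA ler_wpM2l//; apply: le_trans (count_below_ge _ _).
  by rewrite le_min lexx/= ler_piMr ?ler0n//; case/andP: (f01 x).
apply: (@le_trans _ _ (\sum_(k < n) \sum_(x <- s | k%:R / n%:R < g x) mu x)).
  by rewrite mulr_sumr; apply: ler_sum => k _; apply: h; rewrite divr_ge0.
rewrite levels.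
apply: (@le_trans _ _ (\sum_(x <- s) mu x * (n%:R * g x + 1))).
  by apply: ler_sum => x _; rewrite ler_wpM2l// count_below_le// mulr_ge0 ?ler0n.
under eq_bigr do rewrite mulrDr mulr1 mulrCA.
by rewrite big_split/= -mulr_sumr mulrDr addrC lerD2r mulrC.
Qed.

End LevelSets.

Section Sparsification.
Variables (R : realType) (X : metricType R).
Hypothesis bg : bounded_geometry X.
Implicit Types (T s : seq X) (mu : X -> R) (U : set X).

Definition thickening (r : R) U : set X := [set x | exists2 y, U y & mdist x y <= r].

(** Otherwise every superlevel set of every function of the partition would have
a large boundary; summing over the levels and over the partition, the total
variation of the partition would be large. *)
Lemma small_boundary (psi : X -> X -> R) (S r e eta : R) (N : nat) T mu :
  0 < r -> 0 <= e -> 0 < eta -> N%:R * e <= eta ->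
  (forall x s, uniq s -> (forall y, y \in s -> mdist x y <= r) -> (size s <= N)%N) ->
  point_partition psi S -> point_variation psi r e ->
  (forall x, 0 <= mu x) -> 0 < \sum_(x <- T) mu x ->
  exists U, [/\ forall x y, U x -> U y -> mdist x y <= 2 * S,
    0 < \sum_(x <- T | x \in U) mu x &
    \sum_(x <- T | x \in thickening r U `\` U) mu x <=
      2 * eta * \sum_(x <- T | x \in U) mu x].
Proof.
move=> r0 e0 eta0 Ne hN [psi0 psiS psi1] var mu0 muT; apply: contrapT => nU.
have /choice[nb hnb] (x : X) := ball_enum bg x r.
have /choice[bS hbS] (x : X) := ball_enum bg x S.
(* [g i] dominates [psi i] on the [r]-ball of each point *)
pose g i x := psi i x + \sum_(y <- nb x) `|psi i y - psi i x|.
have g0 i x : 0 <= g i x by rewrite addr_ge0// sumr_ge0.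
have psi_le1 i x : 0 <= psi i x <= 1.
  rewrite psi0/=; have [us hs] := hbS x.
  have [ix|ix] := leP (mdist i x) S; last by rewrite psiS.
  rewrite -(psi1 x (bS x) us) => [|y yx]; last by rewrite hs metric_sym.
  by rewrite (bigD1_seq i)//= ?hs 1?metric_sym// lerDl sumr_ge0.
have dom i : (1 + 2 * eta) * (\sum_(x <- T) mu x * psi i x) <=
    \sum_(x <- T) mu x * g i x.
  apply: sum_level_domination => // [|t t0]; first by lra.
  pose U := [set x | t < psi i x].
  have UE x : (x \in U) = (t < psi i x) by apply/idP/idP; rewrite inE.
  have Unear x : U x -> mdist i x <= S.
    move=> Ux; rewrite leNgt; apply/negP => /psiS ix.
    by move: Ux; rewrite /U/= ix ltNge t0.
  have := nU; move=> /forallNP/(_ U) nUU.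
  rewrite -(eq_bigl _ _ UE); have [mU|mU] := leP (\sum_(x <- T | x \in U) mu x) 0.
    apply: (@le_trans _ _ 0); last by apply: sumr_ge0.
    by rewrite mulr_ge0_le0//; lra.
  have hU : 2 * eta * \sum_(x <- T | x \in U) mu x <
      \sum_(x <- T | x \in thickening r U `\` U) mu x.
    rewrite ltNge; apply/negP => h; apply: nUU; split => // x y Ux Uy.
    apply: le_trans (metric_triangle x i y) _; rewrite (metric_sym x).
    by have := Unear _ Ux; have := Unear _ Uy; lra.
  apply: (@le_trans _ _ (\sum_(x <- T | x \in U) mu x +
      \sum_(x <- T | x \in thickening r U `\` U) mu x)); first by lra.
  rewrite [leLHS]addrC big_mkcond [X in _ + X]big_mkcond -big_split/=.
  rewrite [leRHS]big_mkcond/=; apply: ler_sum => x _; rewrite in_setD.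
  have [xU|xU] := boolP (x \in U); rewrite ?andbF ?andbT ?add0r ?addr0.
    case: ifPn => //; rewrite -leNgt => gt; move: xU; rewrite UE ltNge.
    by rewrite (le_trans _ gt)// lerDl sumr_ge0.
  case: ifPn => [|_]; last by case: ifP.
  rewrite inE => -[y Uy xy]; rewrite ifT//.
  have yx : y \in nb x by case: (hnb x) => _ ->.
  apply: (@lt_le_trans _ _ (psi i y)); first exact: Uy.
  rewrite /g (bigD1_seq y)//=; last by case: (hnb x).
  have := ler_norm (psi i y - psi i x).
  have : 0 <= \sum_(z <- nb x | z != y) `|psi i z - psi i x| by apply: sumr_ge0.
  lra.
pose s := undup (flatten (map bS T)).
have us : uniq s by exact: undup_uniq.
have hs x i : x \in T -> mdist i x <= S -> i \in s.
  move=> xT ix; rewrite mem_undup; apply/flatten_mapP; exists x => //.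
  by case: (hbS x) => _ ->; rewrite metric_sym.
have total : \sum_(i <- s) \sum_(x <- T) mu x * psi i x = \sum_(x <- T) mu x.
  rewrite exchange_big/= big_seq [RHS]big_seq; apply: eq_bigr => x xT.
  by rewrite -mulr_sumr psi1 ?mulr1// => i; exact: hs.
have : (1 + 2 * eta) * (\sum_(x <- T) mu x) <= (1 + eta) * \sum_(x <- T) mu x.
  rewrite -{1}total mulr_sumr.
  apply: le_trans (ler_sum _ (fun i _ => dom i)) _.
  rewrite exchange_big/= mulr_sumr big_seq [leRHS]big_seq; apply: ler_sum => x xT.
  rewrite -mulr_sumr [leLHS]mulrC; apply: ler_wpM2r => //.
  rewrite big_split/= psi1//; last by move=> i; exact: hs.
  rewrite lerD2l; apply: le_trans Ne; rewrite exchange_big/=.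
  apply: (@le_trans _ _ (\sum_(y <- nb x) e)).
    rewrite big_seq [leRHS]big_seq; apply: ler_sum => y yx.
    by apply: var => //; rewrite metric_sym; case: (hnb x) yx => _ ->.
  rewrite big_const_seq count_predT iter_addr_0 -[e *+ _]mulr_natl ler_wpM2r// ler_nat.
  by have [un hn] := hnb x; apply: (hN x) => // y; rewrite hn.
rewrite ler_pM2r//; lra.
Qed.

(** Property A implies the metric sparsification property: most of any finite
mass can be carried by uniformly bounded sets that are far apart.  One removes a
bounded set of small boundary together with its boundary, and iterates. *)
Lemma property_A_sparsification (r eta : R) : property_A X -> 0 < r -> 0 < eta ->
  exists D : R, forall T mu, uniq T -> (forall x, 0 <= mu x) ->
    exists Ws : seq (set X), [/\
      forall W, W \in Ws -> forall x y, W x -> W y -> mdist x y <= D,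
      forall W W', W \in Ws -> W' \in Ws -> W <> W' -> separated_by r W W' &
      \sum_(x <- T | ~~ has (fun W => x \in W) Ws) mu x <=
        eta * \sum_(x <- T) mu x].
Proof.
move=> pA r0 eta0; have [N hN] := bounded_geometry_seq bg (ltW r0).
have N1 : 0 < N%:R + 1 :> R by rewrite ltr_wpDl ?ler0n.
have eta2 : 0 < eta / 2 by rewrite divr_gt0.
have [psi [S [S0 part var]]] := property_A_point_partition bg pA r0 (divr_gt0 eta2 N1).
have Ne : N%:R * (eta / 2 / (N%:R + 1)) <= eta / 2.
  by rewrite mulrCA ger_pMr// ler_pdivrMr// mul1r lerDl.
exists (2 * S) => T mu uT mu0.
suff [Ws [h1 h2 h3 _]] : exists Ws : seq (set X), [/\
    forall W, W \in Ws -> forall x y, W x -> W y -> mdist x y <= 2 * S,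
    forall W W', W \in Ws -> W' \in Ws -> W <> W' -> separated_by r W W',
    \sum_(x <- T | ~~ has (fun W => x \in W) Ws) mu x <= eta * \sum_(x <- T) mu x &
    forall W x, W \in Ws -> W x -> x \in T] by exists Ws.
have [n] := ubnP (size T).
elim: n T uT => // n ih T uT; rewrite ltnS => Tn.
have [T0|T0] := leP (\sum_(x <- T) mu x) 0.
  exists [::]; split => //.
  have -> : \sum_(x <- T) mu x = 0.
    by apply/eqP; rewrite eq_le T0 sumr_ge0.
  by rewrite mulr0.
have [U [Udiam U0 Ubd]] :=
  small_boundary r0 (ltW (divr_gt0 eta2 N1)) eta2 Ne hN part var mu0 T0.
pose V := thickening r U; pose T' := [seq x <- T | x \notin V].
have UV x : x \in U -> x \in V.
  by rewrite !inE => Ux; exists x => //; rewrite mdistxx ltW.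
have T'n : (size T' < n)%N.
  apply: leq_trans Tn; rewrite size_filter -(count_predC (fun x => x \in V) T).
  rewrite -addn1 addnC leq_add2r -has_count.
  apply: contraPT U0 => /hasPn hT; rewrite big_seq_cond big1 ?ltxx// => x /andP[xT xU].
  by have := hT x xT; rewrite UV.
have [Ws [Wd Wsep Wsum WT]] := ih T' (filter_uniq _ uT) T'n.
pose W1 := U `&` [set` T].
have W1sep W : W \in Ws -> separated_by r W1 W.
  move=> WW x y [Ux _] /(WT W y WW); rewrite mem_filter => /andP[].
  rewrite notin_setE => Vy _.
  by rewrite ltNge; apply/negP => xy; apply: Vy; exists x => //; rewrite metric_sym.
exists (W1 :: Ws); split.
- move=> W; rewrite inE => /orP[/eqP -> x y [Ux _] [Uy _]|/Wd//].
  exact: Udiam.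
- move=> W W'; rewrite !inE => /orP[/eqP ->|WW] /orP[/eqP ->|WW'] // WW1.
  + exact: W1sep.
  + by move=> x y Wx Wy; rewrite metric_sym; exact: W1sep Wy Wx.
  + exact: Wsep.
- have step : \sum_(x <- T | ~~ has (fun W => x \in W) (W1 :: Ws)) mu x <=
      \sum_(x <- T | x \in V `\` U) mu x +
      \sum_(x <- T' | ~~ has (fun W => x \in W) Ws) mu x.
    rewrite big_filter_cond/= big_mkcond [X in _ + X]big_mkcond.
    rewrite [X in X + _]big_mkcond -big_split/= big_seq [leRHS]big_seq.
    apply: ler_sum => x xT; rewrite in_setD negb_or.
    have -> : (x \in W1) = (x \in U).
      by apply/idP/idP; rewrite !inE; [case|].
    have [xU|xU] := boolP (x \in U).
      by rewrite /= andbF add0r; case: ifP.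
    rewrite andbT/=; case: (x \in V) => /=; last by rewrite add0r.
    by rewrite addr0; case: ifP.
  apply: le_trans step _; apply: le_trans (lerD Ubd Wsum) _.
  rewrite [2 * _]mulrC divfK ?pnatr_eq0// -mulrDr ler_wpM2l ?(ltW eta0)//.
  rewrite big_filter big_mkcond [X in _ + X]big_mkcond -big_split/=.
  apply: ler_sum => x _; case: ifPn => [/UV ->|_]; first by rewrite addr0.
  by rewrite add0r; case: ifP.
- move=> W x; rewrite inE => /orP[/eqP -> [_]//|WW Wx].
  by have := WT W x WW Wx; rewrite mem_filter => /andP[].
Qed.

End Sparsification.

(** * Block diagonal parts *)

Lemma conjugation_defect (T : pzRingType) (w q a : T) : q + w = 1 ->
  a - (q - w) * a * (q - w) = (w * a * q + q * a * w) *+ 2.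
Proof.
move=> wq.
have zm (V : zmodType) (x y z t : V) :
    x + y + (z + t) - (x - y - (z - t)) = (z + y) *+ 2.
  rewrite !opprB !addrA.
  rewrite [LHS](ACl (1*8*4*6*3*2*5*7))/= subrr add0r subrr add0r.
  by rewrite mulr2n addrA.
have -> : a - (q - w) * a * (q - w) =
    (q + w) * a * (q + w) - (q - w) * a * (q - w) by rewrite wq mul1r mulr1.
rewrite ![in X in X - _]mulrDl ![in X in X - _]mulrDr.
rewrite ![in X in _ - X]mulrBl ![in X in _ - X]mulrBr.
exact: zm.
Qed.

Lemma scale_half (R : realType) (V : lmodType R[i]) (z : V) :
  2^-1%:C%C *: (z + z) = z.
Proof.
rewrite -[z in z + _]scale1r -[z in _ + z]scale1r -scalerDl scalerA.
by rewrite -rmorphD/= -rmorphM/= mulVf ?scale1r// pnatr_eq0.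
Qed.

Section BlockAverage.
Variables (R : realType) (p : \bar R) (hp : ((p == 0) || (1 <= p))%E).
Variables (X : metricType R) (E : normedModType R[i]).
Hypothesis bg : bounded_geometry X.
Local Notation L := (lspace hp X E).
Local Notation BL := (bop L).
Local Notation proj := (proj hp E bg).
Local Notation mulR := (mulR hp E bg).
Implicit Types (U W : set X) (Os : seq (set X)) (a b D : BL).

Definition reflection U : BL := proj (~` U) - proj U.

Lemma reflectionE U (v : L) x :
  reflection U v x = if x \in U then - v x else v x.
Proof.
rewrite bopBE -[LHS]/(proj (~` U) v x - proj U v x) !projE in_setC.
by case: (x \in U); rewrite /= ?sub0r ?subr0.
Qed.

(** The mean of the conjugates of [a] by the reflections in the unions of sets
of [Os]; it is the block diagonal part of [a] for the partition of [X] that [Os]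
generates. *)
Fixpoint block_average Os a : BL :=
  if Os is U :: Os' then
    2^-1%:C%C *: (block_average Os' a +
                  block_average Os' (reflection U * a * reflection U))
  else a.

Definition same_block Os x : set X :=
  [set y | all (fun U => (x \in U) == (y \in U)) Os].

Lemma block_averageE Os a (v : L) x :
  block_average Os a v x = a (proj (same_block Os x) v) x.
Proof.
elim: Os a => [|U Os ih] a.
  have -> : same_block [::] x = setT by apply/seteqP; split.
  by rewrite projT.
rewrite -[LHS]/(2^-1%:C%C *: (block_average Os a v x +
  block_average Os (reflection U * a * reflection U) v x)) !ih !bopME reflectionE.
set u := proj (same_block Os x) v.
pose sg : R[i] := if x \in U then -1 else 1.
have -> : (if x \in U then - a (reflection U u) x else a (reflection U u) x) =
    sg *: a (reflection U u) x.
  by rewrite /sg; case: ifP; rewrite ?scaleN1r ?scale1r.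
rewrite -[LHS]/((2^-1%:C%C *: (a u + sg *: a (reflection U u))) x).
rewrite -linearZ -linearD -linearZ; congr (a _ x); apply: lspace_ext => y.
rewrite -[LHS]/(2^-1%:C%C *: (u y + sg *: reflection U u y)) reflectionE /u !projE.
have -> : (y \in same_block (U :: Os) x) =
    ((x \in U) == (y \in U)) && (y \in same_block Os x).
  have memE l : (y \in same_block l x) = all (fun U => (x \in U) == (y \in U)) l.
    by apply/idP/idP; rewrite inE.
  by rewrite !memE.
rewrite /sg; case: (x \in U); case: (y \in U); case: (y \in same_block Os x) => /=;
  by rewrite ?scale1r ?scaleN1r ?opprK ?oppr0 ?subrr ?addr0 ?scaler0 ?scale_half.
Qed.

Definition block_measurable Os W : Prop :=
  forall x y, same_block Os x y -> W x -> W y.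

Lemma same_block_sym Os x y : same_block Os x y -> same_block Os y x.
Proof. by move=> /allP h; apply/allP => U /h; rewrite eq_sym. Qed.

Lemma reflectionM U W : reflection W * reflection U =
  reflection ((W `\` U) `|` (U `\` W)).
Proof.
apply: bop_ext => v; apply: lspace_ext => x.
rewrite bopME !reflectionE in_setU !in_setD.
by case: (x \in W); case: (x \in U); rewrite /= ?opprK.
Qed.

(** A mean of operators that are all within [eta] of [D] is within [eta] of
[D]; the conjugating reflections are those in unions of blocks. *)
Lemma block_average_dist Os a D (eta : R) :
  (forall W, block_measurable Os W ->
     rnorm (D - reflection W * a * reflection W) <= eta) ->
  rnorm (D - block_average Os a) <= eta.
Proof.
elim: Os a => [|U Os ih] a h.
  have := h set0; rewrite /reflection setC0 projT proj0 subr0 mul1r mulr1.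
  by apply=> x y.
have sub W : block_measurable Os W -> block_measurable (U :: Os) W.
  by move=> WO x y /andP[_]; exact: WO.
have h1 : rnorm (D - block_average Os a) <= eta by apply: ih => W /sub; exact: h.
have h2 : rnorm (D - block_average Os (reflection U * a * reflection U)) <= eta.
  apply: ih => W WO; rewrite !mulrA reflectionM -mulrA reflectionM.
  rewrite [X in reflection X * a](_ : _ = (U `\` W) `|` (W `\` U)); last by rewrite setUC.
  apply: h => x y /andP[/eqP xyU xy].
  have yW : W x -> W y := WO x y xy.
  have xW : W y -> W x := WO y x (same_block_sym xy).
  have xU : U x <-> U y by rewrite -[U x]in_setE -[U y]in_setE xyU.
  by case=> -[? nW]; [left|right]; split; [apply/xU| |apply: yW|] => //;
    move=> ?; apply: nW; [apply: xW|apply/xU].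
have -> : D - block_average (U :: Os) a = D - 2^-1%:C%C *: (block_average Os a +
      block_average Os (reflection U * a * reflection U)) by [].
have -> : D - 2^-1%:C%C *: (block_average Os a +
      block_average Os (reflection U * a * reflection U)) =
    2^-1%:C%C *: ((D - block_average Os a) +
      (D - block_average Os (reflection U * a * reflection U))).
  by rewrite addrACA -opprD scalerBr scale_half.
rewrite (@rnormZ R BL 2^-1%:C%C) rnorm_RtoC ger0_norm ?invr_ge0//.
rewrite mulrC ler_pdivrMr// mulr_natr mulr2n.
exact: le_trans (ler_rnormD _ _) (lerD h1 h2).
Qed.

(** Conjugation by a reflection changes the sign of two corners only. *)
Lemma reflection_defect a W : a - reflection W * a * reflection W =
  (proj W * a * proj (~` W) + proj (~` W) * a * proj W) *+ 2.
Proof.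
have wq : proj (~` W) + proj W = 1 by rewrite projC subrK.
exact: (@conjugation_defect BL (proj W) (proj (~` W)) a wq).
Qed.


Section SeparatedBlocks.
Variables (Us : seq (set X)) (r : R).
Hypothesis r0 : 0 <= r.
Hypothesis Us_sep : forall U U', U \in Us -> U' \in Us -> U <> U' ->
  separated_by r U U'.

Definition union_of : set X := [set x | has (fun U => x \in U) Us].

Lemma separated_inj U U' x : U \in Us -> U' \in Us -> U x -> U' x -> U = U'.
Proof.
move=> UU UU' Ux U'x; apply: contrapT => /(Us_sep UU UU') /(_ x x Ux U'x).
by rewrite mdistxx ltNge r0.
Qed.

Lemma union_ofP x : union_of x -> exists2 U, U \in Us & U x.
Proof. by move=> /hasP[U UU]; rewrite inE => Ux; exists U. Qed.

Lemma same_block_in U x : U \in Us -> U x ->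
  union_of `&` same_block Us x = U.
Proof.
move=> UU Ux; apply/seteqP; split=> y.
  move=> [_ /allP/(_ U UU)]; rewrite mem_set// => /eqP/esym.
  by move=> /set_mem.
move=> Uy; split; first by apply/hasP; exists U; rewrite ?mem_set.
apply/allP => U' UU'; apply/eqP; apply/idP/idP; rewrite !inE => h.
  by rewrite -(separated_inj UU UU' Ux h).
by rewrite -(separated_inj UU UU' Uy h).
Qed.

Lemma block_measurable_separated W : block_measurable Us W ->
  separated_by r (W `&` union_of) (union_of `\` W).
Proof.
move=> mW x y [Wx /union_ofP[U UU Ux]] [/union_ofP[U' UU' U'y] nWy].
have [UU1|/eqP UU1] := eqVneq U U'; last exact: (Us_sep UU UU' UU1).
exfalso; apply: nWy; apply: mW Wx.
have : U y by rewrite UU1.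
by rewrite -(same_block_in UU Ux) => -[].
Qed.

(** Off the diagonal blocks, an operator with small corners between separated
sets is small, however many blocks there are: the block diagonal part is a mean
of conjugates, and each of them differs from the operator by two corners. *)
Lemma rnorm_separated_blocks D (eta : R) : 0 <= eta ->
  (forall A B, separated_by r A B -> rnorm (proj A * D * proj B) <= eta) ->
  (forall U, U \in Us -> rnorm (proj U * D * proj U) <= eta) ->
  rnorm (proj union_of * D * proj union_of) <= 5 * eta.
Proof.
move=> eta0 hsep hdiag; set a := proj union_of * D * proj union_of.
have off : rnorm (a - block_average Us a) <= 4 * eta.
  apply: block_average_dist => W mW; rewrite reflection_defect mulr2n.
  have sW := block_measurable_separated mW.
  have cE A B : proj A * a * proj B =
      proj (A `&` union_of) * D * proj (union_of `&` B).
    by rewrite /a -!projM !mulrA.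
  have h1 : rnorm (proj W * a * proj (~` W)) <= eta by rewrite cE; exact: hsep.
  have h2 : rnorm (proj (~` W) * a * proj W) <= eta.
    rewrite cE; apply: hsep => x y [nWx Ux] [Uy Wy].
    by rewrite metric_sym; apply: sW.
  have h12 := le_trans (ler_rnormD _ _) (lerD h1 h2).
  by apply: le_trans (le_trans (ler_rnormD _ _) (lerD h12 h12)) _; lra.
have diag : rnorm (block_average Us a) <= eta.
  apply/rnorm_bop_leP => // v; apply/rnorm_lspace_leP.
    by rewrite mulr_ge0 ?rnorm_ge0.
  apply: (@block_le _ _ hp _ _ bg (set X)
    (fun x => nth set0 Us (find (fun U => x \in U) Us))
    (fun U => if U \in Us then U else set0)
    (fun U => if U \in Us then proj U * D * proj U else 0)) => //.
  - by move=> U; case: ifPn => [/hdiag//|_]; rewrite rnorm0.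
  - move=> U U' _ _ [x []]; case: ifP => // UU Ux; case: ifP => // UU' U'x.
    exact: separated_inj UU UU' Ux U'x.
  - move=> x; rewrite block_averageE.
    have [ux|ux] := boolP (has (fun U => x \in U) Us).
      have kU : nth set0 Us (find (fun U => x \in U) Us) \in Us.
        by rewrite mem_nth// -has_find.
      have kx : nth set0 Us (find (fun U => x \in U) Us) x.
        by have := nth_find set0 ux; rewrite inE.
      rewrite kU -!bopME /a -!mulrA projM (same_block_in kU kx) bopME.
      by rewrite projM setIid proj_in// mulrA bopME proj_in.
    rewrite hasNfind// nth_default//.
    have -> : a (proj (same_block Us x) v) x = 0.
      by rewrite /a !bopME proj_out//; exact/negP.
    by case: ifP => _; rewrite ?bop0E// proj0 mulr0 bop0E.
rewrite -[a](subrK (block_average Us a)).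
by apply: le_trans (le_trans (ler_rnormD _ _) (lerD off diag)) _; lra.
Qed.

End SeparatedBlocks.
End BlockAverage.

(** * Operator norm localization *)

Section Localization.
Variables (R : realType) (p : \bar R) (hp : ((p == 0) || (1 <= p))%E).
Variables (X : metricType R) (E : normedModType R[i]).
Hypothesis bg : bounded_geometry X.
Local Notation L := (lspace hp X E).
Local Notation BL := (bop L).
Local Notation proj := (proj hp E bg).
Variable r : R.
Hypothesis r1 : 1 <= r.
Hypothesis pr : p = r%:E.

Let rpos : 0 < r. Proof. exact: lt_le_trans r1. Qed.

Let lE (f : X -> E) M : lspace_le p f M <->
  forall s : seq X, uniq s -> \sum_(x <- s) rnorm (f x) `^ r <= M `^ r.
Proof.
have [[p0 _]|[r' [_ pr' lE']]] := lspace_le_cases hp X E.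
  by have := rpos; rewrite (p0 _ pr) ltxx.
by have [->] : r%:E = r'%:E by rewrite -pr.
Qed.

Lemma sum_rnorm_coord_le (v : L) (s : seq X) : uniq s ->
  \sum_(x <- s) rnorm (v x) `^ r <= rnorm v `^ r.
Proof. by move=> us; have /lE := rnorm_lspace_le v; apply. Qed.

Lemma rnorm_restriction_le (v : L) (T : seq X) (A : set X) (M : R) : uniq T ->
  0 <= M -> (forall x, x \notin T -> v x = 0) ->
  \sum_(x <- T | x \in A) rnorm (v x) `^ r <= M `^ r -> rnorm (proj A v) <= M.
Proof.
move=> uT M0 vT h; apply/rnorm_lspace_leP => //; apply/lE => s us.
apply: le_trans h.
apply: (@le_trans _ _ (\sum_(x <- [seq x <- s | x \in T] | x \in A) rnorm (v x) `^ r)).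
  rewrite big_filter_cond [leRHS]big_mkcond; apply: ler_sum => x _.
  rewrite projE; have [xT|/vT ->] := boolP (x \in T).
    by case: ifP => //= _; rewrite rnorm0 powR0 ?gt_eqF.
  by rewrite if_same rnorm0 powR0 ?gt_eqF.
rewrite (perm_big [seq x <- T | x \in s]); last first.
  apply: uniq_perm; rewrite ?filter_uniq// => x.
  by rewrite !mem_filter andbC.
rewrite big_filter_cond [leLHS]big_mkcond [leRHS]big_mkcond.
apply: ler_sum => x _; case: (x \in s); case: (x \in A) => //=.
exact: powR_ge0.
Qed.

(** Operator norm localization for quasi-local operators.  Given a vector [u],
the sparsification applied to the mass of [u] and of [D u] yields separated
bounded sets that carry most of both; there [D] is nearly block diagonal, with
small blocks. *)
Lemma rnorm_localization (C r0 eps : R) : property_A X ->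
  0 <= C -> 0 < r0 -> 0 < eps ->
  exists S : R, forall D : BL, rnorm D <= C ->
    (forall A B, separated_by r0 A B -> rnorm (proj A * D * proj B) <= eps) ->
    (forall U : set X, (forall x y, U x -> U y -> mdist x y <= S) ->
       rnorm (proj U * D * proj U) <= eps) ->
    rnorm D <= 6 * eps.
Proof.
move=> pA C0 r00 e0.
have C1 : 0 < 1 + C by rewrite ltr_pwDl.
(* [d * rnorm v] bounds what the vector and its image have off the blocks *)
pose d := eps / (1 + C); have d0 : 0 < d by rewrite divr_gt0.
have K0 : 0 < 1 + C `^ r by rewrite ltr_pwDl// powR_ge0.
pose eta := d `^ r / (1 + C `^ r).
have eta0 : 0 < eta by rewrite divr_gt0// powR_gt0.
have [S hS] := property_A_sparsification bg pA r00 eta0.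
exists S => D DC Dsep Dloc.
apply: (@rnorm_le_finite_support _ _ _ _ _ bg D).
- by rewrite pr.
- by rewrite mulr_ge0 ?ltW.
move=> v t; set u := proj [set` t] v.
have uv : rnorm u <= rnorm v by exact: proj_ler.
apply: rnorm_proj_exhaust => [|s]; first by rewrite !mulr_ge0 ?rnorm_ge0 ?ltW.
pose T := undup (t ++ s); have uT : uniq T by exact: undup_uniq.
pose w := proj [set` T] (D u).
have sw : rnorm (proj [set` s] (D u)) <= rnorm w.
  apply: rnorm_lspace_mono => x; rewrite !projE; case: ifPn => [|_].
    rewrite inE /= => xs; rewrite ifT ?lexx// inE /=.
    by rewrite mem_undup mem_cat xs orbT.
  by rewrite rnorm0 rnorm_ge0.
apply: le_trans sw _.
have wv : rnorm w <= C * rnorm v.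
  apply: le_trans (proj_ler _ _ _) _; apply: le_trans (rnorm_app_le _ _) _.
  by rewrite ler_pM ?rnorm_ge0.
pose mu x := rnorm (u x) `^ r + rnorm (w x) `^ r.
have mu0 x : 0 <= mu x by rewrite addr_ge0 ?powR_ge0.
have [Us [Udiam Usep Umu]] := hS T mu uT mu0.
have mass : \sum_(x <- T | ~~ has (fun U => x \in U) Us) mu x <= (d * rnorm v) `^ r.
  apply: le_trans Umu _.
  have -> : (d * rnorm v) `^ r = eta * ((1 + C `^ r) * rnorm v `^ r).
    by rewrite powRM ?rnorm_ge0 ?(ltW d0)// mulrA /eta divfK ?gt_eqF.
  rewrite ler_wpM2l ?(ltW eta0)// big_split mulrDl mul1r lerD//.
    apply: le_trans (sum_rnorm_coord_le _ uT) _.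
    by rewrite ge0_ler_powR ?nnegrE ?rnorm_ge0// ltW.
  apply: le_trans (sum_rnorm_coord_le _ uT) _.
  by rewrite -powRM ?rnorm_ge0// ge0_ler_powR ?nnegrE ?mulr_ge0 ?rnorm_ge0// ltW.
pose Om := union_of Us.
have OmE x : (x \in ~` Om) = ~~ has (fun U => x \in U) Us.
  by rewrite in_setC; congr (~~ _); apply/idP/idP; rewrite inE.
have rest (z : L) : (forall x, x \notin T -> z x = 0) ->
    (forall x, rnorm (z x) `^ r <= mu x) -> rnorm (proj (~` Om) z) <= d * rnorm v.
  move=> zT zmu; apply: (rnorm_restriction_le uT) => //.
    by rewrite mulr_ge0 ?rnorm_ge0 ?ltW.
  under eq_bigl do rewrite OmE.
  by apply: le_trans mass; apply: ler_sum.
have ru : rnorm (proj (~` Om) u) <= d * rnorm v.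
  apply: rest => x; last by rewrite lerDl powR_ge0.
  rewrite mem_undup mem_cat negb_or => /andP[xt _].
  by rewrite /u proj_out//=; exact/negP.
have rw : rnorm (proj (~` Om) w) <= d * rnorm v.
  apply: rest => x; last by rewrite lerDr powR_ge0.
  by move=> xT; rewrite /w proj_out//=; exact/negP.
have blocks : rnorm (proj Om * D * proj Om) <= 5 * eps.
  apply: (rnorm_separated_blocks (ltW r00) Usep (ltW e0) Dsep) => U UU.
  by apply: Dloc; exact: Udiam.
have split_w : w = proj (~` Om) w + proj [set` T] ((proj Om * D * proj Om) u) +
    proj [set` T] (proj Om (D (proj (~` Om) u))).
  have uE : proj Om u + proj (~` Om) u = u by rewrite projC bopBE addrC subrK.
  have -> : (proj Om * D * proj Om) u = proj Om (D (proj Om u)) by [].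
  rewrite -addrA -linearD -linearD -linearD uE.
  have wE : w = proj (~` Om) w + proj Om w by rewrite projC bopBE subrK.
  rewrite {1}wE; congr (_ + _).
  by rewrite /w -bopME projM setIC -projM.
rewrite split_w; apply: le_trans (ler_rnormD _ _) _.
have -> : 6 * eps * rnorm v = d * rnorm v + 5 * eps * rnorm v + C * (d * rnorm v).
  have -> : 6 * eps = d + 5 * eps + C * d by rewrite /d; field; rewrite gt_eqF.
  by ring.
apply: lerD.
  apply: le_trans (ler_rnormD _ _) _; apply: (lerD rw).
  apply: le_trans (proj_ler _ _ _) _; apply: le_trans (rnorm_app_le _ _) _.
  by rewrite ler_pM ?rnorm_ge0.
apply: le_trans (proj_ler _ _ _) _; apply: le_trans (proj_ler _ _ _) _.
apply: le_trans (rnorm_app_le _ _) _.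
by rewrite ler_pM ?rnorm_ge0.
Qed.

End Localization.

(** * Approximation under Property A *)

Lemma sum_finite_support (V : nmodType) (T : eqType) (s l : seq T) (f : T -> V) :
  uniq s -> uniq l -> {subset l <= s} -> (forall x, x \notin l -> f x = 0) ->
  \sum_(x <- s) f x = \sum_(x <- l) f x.
Proof.
move=> us ul ls fl; rewrite (bigID (mem l))/= [X in _ + X]big1 ?addr0//.
rewrite -big_filter; apply: perm_big; apply: uniq_perm; rewrite ?filter_uniq// => x.
by rewrite mem_filter; case: (boolP (x \in l)) => [/ls ->|].
Qed.

Section PropertyARoe.
Variables (R : realType) (p : \bar R) (hp : ((p == 0) || (1 <= p))%E).
Variables (X : metricType R) (E : normedModType R[i]).
Hypothesis bg : bounded_geometry X.
Local Notation L := (lspace hp X E).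
Local Notation BL := (bop L).
Local Notation proj := (proj hp E bg).
Local Notation mulR := (mulR hp E bg).
Variable r : R.
Hypothesis r1 : 1 <= r.
Hypothesis pr : p = r%:E.

Let rpos : 0 < r. Proof. exact: lt_le_trans r1. Qed.

Lemma rnorm_mulR_coord (f : X -> R) (v : L) x :
  (exists C, forall x, `|f x| <= C) -> rnorm (mulR f v x) = `|f x| * rnorm (v x).
Proof. by move=> h; rewrite mulRE// rnormZ rnorm_RtoC. Qed.

(** A matrix-free form of the Schur test: by Hoelder's inequality in [x], the
norm of [w y] to the power [r] is at most the sum over [x] of those of
[c (H x v) y], and the sum over [y] can be taken first. *)
Lemma weighted_sum_le (c : BL) (psi H : X -> X -> R) (beta : R) (v w : L) :
  0 <= beta -> (forall x y, 0 <= psi x y) ->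
  (forall y (s : seq X), uniq s -> \sum_(x <- s) psi x y <= 1) ->
  (forall x, exists C, forall y, `|H x y| <= C) ->
  (forall y (s : seq X), uniq s -> \sum_(x <- s) `|H x y| `^ r <= beta `^ r) ->
  (forall y, exists l : seq X, forall s, uniq s -> {subset l <= s} ->
     rnorm (w y) <= \sum_(x <- s) psi x y `^ (1 - r^-1) * rnorm (c (mulR (H x) v) y)) ->
  rnorm w <= rnorm c * beta * rnorm v.
Proof.
move=> beta0 psi0 psi1 Hbd Hbeta hw; have rge0 := ltW rpos.
have M0 : 0 <= rnorm c * beta * rnorm v by rewrite !mulr_ge0 ?rnorm_ge0.
have [[p0 _]|[r' [_ pr' lE']]] := lspace_le_cases hp X E.
  by have := rpos; rewrite (p0 _ pr) ltxx.
have rr' : r' = r by move: pr'; rewrite pr => -[].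
apply/rnorm_lspace_leP => //; apply/lE' => t ut; rewrite rr'.
have /choice[l hl] := hw.
pose s := undup (flatten (map l t)); have us : uniq s by exact: undup_uniq.
have ls y : y \in t -> {subset l y <= s}.
  by move=> yt x xl; rewrite mem_undup; apply/flatten_mapP; exists y.
pose f x y := rnorm (c (mulR (H x) v) y).
have f0 x y : 0 <= f x y by exact: rnorm_ge0.
apply: (@le_trans _ _ (\sum_(y <- t) \sum_(x <- s) f x y `^ r)).
  rewrite big_seq [leRHS]big_seq; apply: ler_sum => y yt.
  have S0 : 0 <= \sum_(x <- s) f x y `^ r by apply: sumr_ge0 => *; exact: powR_ge0.
  rewrite -[leRHS]powRr1// -(@mulVf _ r) ?gt_eqF// powRrM.
  rewrite ge0_ler_powR ?nnegrE ?powR_ge0 ?rnorm_ge0//.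
  apply: le_trans (hl y s us (ls y yt)) _.
  apply: (@sum_holder_le R X s (psi^~ y) (f^~ y) r _ r1) => //.
  - exact: powR_ge0.
  - exact: psi1.
  by rewrite -powRrM mulVf ?gt_eqF// powRr1.
rewrite exchange_big/=.
apply: (@le_trans _ _ (\sum_(x <- s) rnorm c `^ r * rnorm (mulR (H x) v) `^ r)).
  apply: ler_sum => x _; rewrite -powRM ?rnorm_ge0//.
  apply: le_trans (sum_rnorm_coord_le r1 pr _ ut) _.
  by rewrite ge0_ler_powR ?nnegrE ?mulr_ge0 ?rnorm_ge0// rnorm_app_le.
rewrite -mulr_sumr -mulrA powRM ?mulr_ge0 ?rnorm_ge0//.
rewrite ler_wpM2l ?powR_ge0//.
have -> : beta * rnorm v = rnorm (beta%:C%C *: v).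
  by rewrite rnormZ rnorm_RtoC ger0_norm.
apply: (sum_rnorm_powR r1 pr) => y.
rewrite -[(beta%:C%C *: v) y]/(beta%:C%C *: v y) rnormZ rnorm_RtoC (ger0_norm beta0).
rewrite powRM ?rnorm_ge0//.
under eq_bigr do rewrite rnorm_mulR_coord// powRM ?rnorm_ge0//.
by rewrite -mulr_suml ler_wpM2r ?powR_ge0// Hbeta.
Qed.

Lemma point_partition_le1 (psi : X -> X -> R) (S : R) :
  point_partition psi S ->
  forall y (s : seq X), uniq s -> \sum_(x <- s) psi x y <= 1.
Proof.
move=> [psi0 psiS psi1] y s us; have [bs [ub hb]] := ball_enum bg y S.
rewrite -(psi1 y (undup (s ++ bs))) ?undup_uniq//; last first.
  by move=> x xy; rewrite mem_undup mem_cat hb metric_sym xy orbT.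
rewrite [leRHS](bigID (mem s))/= -[leLHS]addr0 lerD ?sumr_ge0//.
rewrite -[leRHS]big_filter le_eqVlt; apply/orP; left; apply/eqP.
apply: perm_big; apply: uniq_perm; rewrite ?filter_uniq ?undup_uniq// => x.
by rewrite mem_filter mem_undup mem_cat; case: (x \in s).
Qed.

Variable B : set BL.
Hypothesis Balg : banach_subalgebra B.
Hypothesis Bmod : two_sided_products setT B = B.
Hypothesis Bcut : closed_under_block_cutdowns B.

(** The operator [b] is compared with the sum over [x] of
[psi x `^ (1 - 1 / r) * b * psi x `^ (1 / r)].  This averaging is contractive and
commutes with corners, so the difference is quasi-local with the control of [b],
whatever the partition; and it is small on sets where the partition varies
little.  Operator norm localization then bounds its norm. *)
Lemma quasi_local_Roe_property_A b : 1 < r -> property_A X ->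
  B b -> quasi_local_sets bg b -> Roe B b.
Proof.
move=> r1' pA Bb bql; apply/closure_rnorm => e e0.
have q0 : 0 < 1 - r^-1 by rewrite subr_gt0 invf_lt1.
have ri0 : 0 < r^-1 by rewrite invr_gt0.
pose eps := e / 12; have eps0 : 0 < eps by rewrite divr_gt0.
have [r0 r00 hr0] := bql _ (divr_gt0 eps0 (ltr0n R 2)).
have r10 : 0 < r0 + 1 by rewrite ltr_wpDl.
have C0 : 0 <= 2 * rnorm b by rewrite mulr_ge0 ?rnorm_ge0.
have [S0 hS0] := rnorm_localization hp E bg r1 pr pA C0 r10 eps0.
have S10 : 0 < `|S0| + 1 by rewrite ltr_wpDl.
have b1 : 0 < rnorm b + 1 by rewrite ltr_wpDl ?rnorm_ge0.
pose d := eps / (2 * (rnorm b + 1)); have d0 : 0 < d by rewrite divr_gt0 ?mulr_gt0.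
have dr0 : 0 < d `^ r by rewrite powR_gt0.
have [psi [S [S_ge0 part var]]] := property_A_point_partition bg pA S10 dr0.
have psi_le1 := point_partition_le1 part.
have [psi0 psiS psi1] := part.
have psi01 x y : 0 <= psi x y <= 1.
  by rewrite psi0/=; have := psi_le1 y [:: x] isT; rewrite big_seq1.
pose F x y := psi x y `^ (1 - r^-1); pose G x y := psi x y `^ r^-1.
have pow01 (t z : R) : 0 < t -> 0 <= z <= 1 -> 0 <= z `^ t <= 1.
  move=> t0 /andP[z0 z1]; have one : 1 `^ t = 1 :> R by rewrite powR1.
  rewrite powR_ge0/= -[leRHS]one.
  by rewrite ge0_ler_powR ?nnegrE// ltW.
have F01 x y : 0 <= F x y <= 1 by exact: pow01.
have G01 x y : 0 <= G x y <= 1 by exact: pow01.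
have FS x y : S < mdist x y -> F x y = 0.
  by move=> /psiS; rewrite /F => ->; rewrite powR0// gt_eqF.
have GS x y : S < mdist x y -> G x y = 0.
  by move=> /psiS; rewrite /G => ->; rewrite powR0// gt_eqF.
have [b' [Bb' fb' b'E]] := near_diagonal_sum bg Balg Bmod Bcut S_ge0 Bb F01 G01 FS GS.
have Gbd x : exists C, forall y, `|G x y| <= C.
  by exists 1 => y; case/andP: (G01 x y) => ? ?; rewrite ger0_norm.
have GrE x y : `|G x y| `^ r = psi x y.
  rewrite ger0_norm; last by case/andP: (G01 x y).
  by rewrite /G -powRrM mulVf ?gt_eqF// powRr1.
have FGE x y : F x y * G x y = psi x y.
  rewrite /F /G -powRD ?subrK ?powRr1//.
  by rewrite oner_eq0.
have /choice[bs hbs] (y : X) := ball_enum bg y S.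
have bs_in y (s : seq X) : {subset bs y <= s} -> forall x, mdist x y <= S -> x \in s.
  by move=> h x xy; apply: h; case: (hbs y) => _ ->; rewrite metric_sym.
have corner U V : rnorm (proj U * b' * proj V) <= rnorm (proj U * b * proj V).
  apply/rnorm_bop_leP => [|v]; first exact: rnorm_ge0.
  rewrite -[rnorm (_ * b * _)]mulr1.
  apply: (@weighted_sum_le _ psi G) => //.
    by move=> y s us; under eq_bigr do rewrite GrE; rewrite powR1 psi_le1.
  move=> y; exists (bs y) => s us ls.
  rewrite !bopME projE; case: ifPn => [yU|_]; last first.
    by rewrite rnorm0 sumr_ge0// => x _; rewrite mulr_ge0 ?powR_ge0 ?rnorm_ge0.
  rewrite (b'E _ y s us (bs_in y s ls)).
  apply: le_trans (ler_rnorm_sum _ _ _) _; apply: ler_sum => x _.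
  rewrite rnormZ rnorm_RtoC ger0_norm; last by case/andP: (F01 x y).
  rewrite ler_wpM2l//; first by case/andP: (F01 x y).
  by rewrite !bopME projE yU -[proj V (mulR _ _)]bopME proj_commute bopME.
exists b' => //; apply: (@le_lt_trans _ _ (6 * eps)); last by rewrite /eps; lra.
apply: hS0.
- have := corner setT setT; rewrite projT !mul1r !mulr1 => b'b.
  apply: le_trans (ler_rnormB _ _) _; lra.
- move=> U V sUV; have h : rnorm (proj U * b * proj V) < eps / 2.
    by apply: hr0; apply: separated_by_le sUV => //; rewrite lerDl.
  rewrite mulrBr mulrBl; apply: le_trans (ler_rnormB _ _) _.
  by have := corner U V; lra.
move=> U Udiam; have [->|/set0P[x0 Ux0]] := eqVneq U set0.
  by rewrite proj0 !mul0r rnorm0 ltW.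
apply/rnorm_bop_leP => [|v]; first exact: ltW.
(* on [U] the weights [G x] are nearly constant, equal to [G x x0]; [w1] is the
   error of this replacement after applying [b], [w1 - w] the error before *)
pose u := proj U v; pose w := (proj U * (b - b') * proj U) v.
pose h y := if y \in U then \sum_(x <- bs y) F x y * (G x y - G x x0) else 0.
have GG x y z : `|G x y - G x z| `^ r <= `|psi x y - psi x z|.
  by apply: powR_root_dist.
have varU y (s : seq X) : U y -> uniq s ->
    \sum_(x <- s) `|G x y - G x x0| `^ r <= d `^ r.
  move=> Uy us; apply: (@le_trans _ _ (\sum_(x <- s) `|psi x y - psi x x0|)).
    by apply: ler_sum => x _; exact: GG.
  apply: var => //; apply: le_trans (Udiam _ _ Uy Ux0) _.
  by have := ler_norm S0; lra.
have hd y : `|h y| <= d.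
  rewrite /h; case: ifPn => [|_]; last by rewrite normr0 ltW.
  rewrite inE => Uy; have [ub _] := hbs y.
  apply: le_trans (ler_norm_sum _ _ _) _.
  rewrite (eq_bigr (fun x => psi x y `^ (1 - r^-1) * `|G x y - G x x0|)).
    apply: sum_holder_le => //; first exact: ltW.
    - exact: psi_le1.
    - exact: varU.
  by move=> x _; rewrite normrM ger0_norm//; exact: powR_ge0.
have hbd : exists C, forall y, `|h y| <= C by exists d.
pose w1 : L := mulR h (b u).
have w1v : rnorm w1 <= d * (rnorm b * rnorm v).
  apply: (@le_trans _ _ (d * rnorm (b u))).
    apply: rnorm_lspace_scale => [|y]; first exact: ltW.
    by rewrite rnorm_mulR_coord// ler_wpM2r ?rnorm_ge0.
  rewrite ler_wpM2l ?(ltW d0)//; apply: le_trans (rnorm_app_le _ _) _.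
  by rewrite ler_wpM2l ?rnorm_ge0// proj_ler.
pose H x y := if y \in U then G x y - G x x0 else 0.
have Hbd x : exists C, forall y, `|H x y| <= C.
  exists 1 => y; rewrite /H; case: ifP => _; last by rewrite normr0.
  have := G01 x y; have := G01 x x0 => /andP[? ?] /andP[? ?].
  by rewrite ler_norml; apply/andP; split; lra.
have w2v : rnorm (w1 - w) <= rnorm b * d * rnorm v.
  apply: (@weighted_sum_le _ psi H) => //; first exact: ltW.
    move=> y s us; rewrite /H; have [|_] := boolP (y \in U).
      by rewrite inE => Uy; exact: varU.
    by rewrite big1 ?powR_ge0// => x _; rewrite normr0 powR0 ?gt_eqF.
  move=> y; exists (bs y) => s us ls; have [ub hb] := hbs y.
  rewrite -[(w1 - w) y]/(mulR h (b u) y - w y) mulRE// /w !bopME projE.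
  rewrite {1}/h; case: ifPn => [yU|_]; last first.
    rewrite scale0r subr0 rnorm0 sumr_ge0// => x _.
    by rewrite mulr_ge0 ?powR_ge0 ?rnorm_ge0.
  have -> : \sum_(x <- bs y) F x y * (G x y - G x x0) =
      \sum_(x <- s) F x y * (G x y - G x x0).
    apply/esym/sum_finite_support => // x.
    by rewrite hb metric_sym -ltNge => /FS ->; rewrite mul0r.
  have buE : b u y = \sum_(x <- s) (F x y * G x y)%:C%C *: b u y.
    rewrite -scaler_suml -rmorph_sum; under eq_bigr do rewrite FGE.
    by rewrite psi1 ?scale1r//; exact: bs_in.
  have -> : (b - b') (proj U v) y = b u y - b' u y by [].
  rewrite (b'E u y s us (bs_in y s ls)) {2}buE rmorph_sum scaler_suml.
  rewrite -!sumrB; apply: le_trans (ler_rnorm_sum _ _ _) _.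
  apply: ler_sum => x _.
  have -> : (F x y * (G x y - G x x0))%:C%C *: b u y -
      ((F x y * G x y)%:C%C *: b u y - (F x y)%:C%C *: b (mulR (G x) u) y) =
      (F x y)%:C%C *: b (mulR (H x) v) y.
    have -> : mulR (H x) v = mulR (G x) u - (G x x0)%:C%C *: u.
      apply: lspace_ext => z.
      rewrite -[RHS]/(mulR (G x) u z - (G x x0)%:C%C *: u z).
      rewrite (@mulRE _ _ hp _ E bg (H x) v z (Hbd x)).
      rewrite (@mulRE _ _ hp _ E bg (G x) u z (Gbd x)) /H /u projE.
      case: ifP => _; first by rewrite rmorphB scalerBl.
      by rewrite scale0r !scaler0 subr0.
    have -> : b (mulR (G x) u - (G x x0)%:C%C *: u) =
        b (mulR (G x) u) - (G x x0)%:C%C *: b u by rewrite linearB linearZ.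
    rewrite -[RHS]/((F x y)%:C%C *: (b (mulR (G x) u) y - (G x x0)%:C%C *: b u y)).
    rewrite scalerBr scalerA opprB addrCA -scalerBl -rmorphM -rmorphB.
    by rewrite mulrBr addrAC subrr add0r rmorphN scaleNr.
  rewrite rnormZ rnorm_RtoC ger0_norm//; case/andP: (F01 x y) => //.
rewrite -/w; have -> : w = w1 - (w1 - w) by rewrite opprB addrC subrK.
apply: le_trans (ler_rnormB _ _) _; apply: le_trans (lerD w1v w2v) _.
rewrite [rnorm b * d]mulrC -!mulrA -mulrDl !mulrA ler_wpM2r ?rnorm_ge0//.
by rewrite /d mulrAC ler_pdivrMr ?mulr_gt0//; nra.
Qed.

End PropertyARoe.

(** * The equivalence *)

Theorem theorem3p3 (R : realType) (X : metricType R)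
    (p : \bar R) (hp : ((p == 0) || (1 <= p))%E)
    (E : completeNormedModType R[i]) (B : set (bop (lspace hp X E))) :
  bounded_geometry X ->
  banach_subalgebra B ->
  two_sided_products setT B = B ->
  closed_under_block_cutdowns B ->
  forall b : bop (lspace hp X E), B b ->
  ((p = 0 \/ p = 1 \/ p = +oo)%E ->
     [<-> commutes_with_VL b;
          quasi_local b;
          higson_commutators_compact B b;
          Roe B b]) /\
  ((1 < p < +oo)%E ->
     [<-> commutes_with_VL b;
          quasi_local b;
          higson_commutators_compact B b] /\
     (property_A X ->
        [<-> commutes_with_VL b;
             quasi_local b;
             higson_commutators_compact B b;
             Roe B b])).
Proof.
move=> bg Balg Bmod Bcut b Bb.
have i_ii : commutes_with_VL b -> quasi_local b.
  by move=> h; apply/(quasi_localP bg)/VL_quasi_local.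
have ii_i : quasi_local b -> commutes_with_VL b.
  by move=> /(quasi_localP bg); exact: quasi_local_VL.
have ii_iii : quasi_local b -> higson_commutators_compact B b.
  by move=> /(quasi_localP bg); exact: quasi_local_higson.
have iii_ii : higson_commutators_compact B b -> quasi_local b.
  by move=> h; apply/(quasi_localP bg)/higson_quasi_local/h.
have iv_ii : Roe B b -> quasi_local b.
  by move=> h; apply/(quasi_localP bg)/Roe_quasi_local/h.
split=> [p01oo|/andP[p1 poo]].
  have ii_iv : quasi_local b -> Roe B b.
    move=> /(quasi_localP bg) bql.
    have [[_ supE]|[r [r1 pr _]]] := lspace_le_cases hp X E.
      exact: (quasi_local_Roe_sup Balg Bmod Bcut supE Bb bql).
    apply: (quasi_local_Roe1 Balg Bmod Bcut _ Bb bql).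
    case: p01oo => [p0|[//|poo]].
      by move: pr r1; rewrite p0 => -[<-]; rewrite ler10.
    by move: pr; rewrite poo.
  by tfae; auto.
split; first by tfae; auto.
move=> pA; have ii_iv : quasi_local b -> Roe B b.
  move=> /(quasi_localP bg) bql.
  have rE : p = (fine p)%:E.
    by rewrite fineK// fin_numElt poo andbT (lt_trans _ p1)// ltNye.
  have r1 : 1 < fine p by rewrite -lte_fin -rE.
  exact: (quasi_local_Roe_property_A (ltW r1) rE Balg Bmod Bcut r1 pA Bb bql).
by tfae; auto.
Qed.
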